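(* Let $\Bbbk$ be an algebraically closed field of characteristic $p>2$ and let $H$ be a nonsemisimple Hopf algebra of dimension $p^n$ over $\Bbbk$, with antipode $S$. Suppose $H$ admits a semisimple primitive element $x$ such that $\dim \Bbbk[x]=p^{n-1}$, where $\Bbbk[x]$ is the subalgebra of $H$ generated by $x$. Then $S^{2p}=\mathrm{id}$, and for every primitive idempotent $e\in\Bbbk[x]$ the left $H$-module $He$ is a $p$-dimensional indecomposable projective $H$-module. If, in addition, $H$ is unimodular, then $S^2=\mathrm{id}$.
   Context: An element $x\in H$ is primitive if $\Delta(x)=x\otimes 1+1\otimes x$. A primitive element $x$ is called semisimple if the finite-dimensional commutative algebra $\Bbbk[x]$ is semisimple (equivalently, multiplication by $x$ is diagonalizable). A primitive idempotent of $\Bbbk[x]$ is a nonzero idempotent of the algebra $\Bbbk[x]$ that is not a sum of two nonzero orthogonal idempotents of $\Bbbk[x]$. $H$ is semisimple if it is semisimple as an algebra; $H$ is unimodular if its spaces of left and right integrals coincide. *)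

(* Defs.v *)
From HB Require Import structures.
From mathcomp Require Import all_boot all_algebra all_field.

Set Implicit Arguments.
Unset Strict Implicit.
Unset Printing Implicit Defensive.

Import GRing.Theory VectorInternalTheory.
Local Open Scope ring_scope.

(* The tensor product of two finite-dimensional spaces, modelled by coordinate
   matrices: u (x) v is the outer product of the coordinates of u and v. The
   universal property is given by tlift, tlift_tens and tens_ind below. *)
Definition tensor (k : fieldType) (U V : vectType k) : Type :=
  'M[k]_(dim U, dim V).

HB.instance Definition _ (k : fieldType) (U V : vectType k) :=
  Vector.copy (tensor U V) 'M[k]_(dim U, dim V).

Section Tensor.
Variables (k : fieldType) (U V : vectType k).

Definition tens (u : U) (v : V) : tensor U V := (v2r u)^T *m v2r v.

Definition coord_basis (W : vectType k) (i : 'I_(dim W)) : W :=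
  r2v (delta_mx 0 i).

(* The linear map induced by f when f is bilinear. *)
Definition tlift (W : lmodType k) (f : U -> V -> W) (t : tensor U V) : W :=
  \sum_i \sum_j (t : 'M[k]_(_, _)) i j *: f (coord_basis i) (coord_basis j).

Lemma tlift_is_linear (W : lmodType k) (f : U -> V -> W) : linear (tlift f).
Proof.
move=> a s t; rewrite /tlift scaler_sumr -big_split; apply: eq_bigr => i _ /=.
rewrite scaler_sumr -big_split; apply: eq_bigr => j _ /=.
by rewrite !mxE scalerDl scalerA.
Qed.

HB.instance Definition _ (W : lmodType k) (f : U -> V -> W) :=
  GRing.isLinear.Build k (tensor U V) W *:%R (tlift f) (tlift_is_linear f).

Lemma tens_linearl v : linear (tens^~ v).
Proof. by move=> a x y; rewrite /tens !linearP /= mulmxDl -scalemxAl. Qed.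

Lemma tens_linearr u : linear (tens u).
Proof. by move=> a x y; rewrite /tens linearP /= mulmxDr -scalemxAr. Qed.

Lemma coord_basisE (W : vectType k) (w : W) :
  w = \sum_i v2r w 0 i *: coord_basis i.
Proof.
rewrite -[LHS]v2rK [X in r2v X]row_sum_delta linear_sum.
by apply: eq_bigr => i _; rewrite linearZ.
Qed.

Lemma tlift_tens (W : lmodType k) (f : U -> V -> W) :
    (forall v, linear (f^~ v)) -> (forall u, linear (f u)) ->
  forall u v, tlift f (tens u v) = f u v.
Proof.
move=> fl fr u v.
pose fL v0 := GRing.isLinear.Build _ _ _ _ (f^~ v0) (fl v0).
pose fR u0 := GRing.isLinear.Build _ _ _ _ (f u0) (fr u0).
pose gL v0 : {linear U -> W} := HB.pack (f^~ v0) (fL v0).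
pose gR u0 : {linear V -> W} := HB.pack (f u0) (fR u0).
have -> : f u v = \sum_i v2r u 0 i *: f (coord_basis i) v.
  rewrite -[LHS]/(gL v u) {1}[u]coord_basisE linear_sum.
  by apply: eq_bigr => i _; rewrite linearZ.
apply: eq_bigr => i _.
have -> : f (coord_basis i) v =
    \sum_j v2r v 0 j *: f (coord_basis i) (coord_basis j).
  rewrite -[LHS]/(gR (coord_basis i) v) {1}[v]coord_basisE linear_sum.
  by apply: eq_bigr => j _; rewrite linearZ.
rewrite scaler_sumr; apply: eq_bigr => j _.
by rewrite scalerA /tens mxE big_ord1 mxE.
Qed.

Lemma tens_ind (P : tensor U V -> Prop) :
    P 0 -> (forall s t, P s -> P t -> P (s + t)) ->
    (forall u v, P (tens u v)) ->
  forall t, P t.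
Proof.
move=> P0 PD Pt t; rewrite -[t]/(t : 'M_(_, _)) [t]matrix_sum_delta.
apply: (big_ind P) => // i _; apply: (big_ind P) => // j _.
have -> : t i j *: delta_mx i j = tens (t i j *: coord_basis i) (coord_basis j).
  rewrite /tens /coord_basis linearZ /= !r2vK linearZ /= -scalemxAl.
  by rewrite trmx_delta mul_delta_mx.
exact: Pt.
Qed.

End Tensor.

Section TensorMaps.
Variable k : fieldType.

Definition tmap (U V U' V' : vectType k) (f : U -> U') (g : V -> V') :
    tensor U V -> tensor U' V' :=
  tlift (fun u v => tens (f u) (g v)).

Definition tassoc (U V W : vectType k) :
    tensor (tensor U V) W -> tensor U (tensor V W) :=
  tlift (fun t w => tlift (fun u v => tens u (tens v w)) t).

Lemma tmap_tens (U V U' V' : vectType k)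
    (f : {linear U -> U'}) (g : {linear V -> V'}) u v :
  tmap f g (tens u v) = tens (f u) (g v).
Proof.
rewrite /tmap tlift_tens // => ? a x y; rewrite linearP /=.
  exact: tens_linearl.
exact: tens_linearr.
Qed.

Lemma tassoc_tens (U V W : vectType k) (u : U) (v : V) (w : W) :
  tassoc (tens (tens u v) w) = tens u (tens v w).
Proof.
have inner (w' : W) (u' : U) (v' : V) : tlift (fun u v => tens u (tens v w')) (tens u' v')
    = tens u' (tens v' w').
  rewrite tlift_tens // => ? a x y; first exact: tens_linearl.
  by rewrite tens_linearl tens_linearr.
rewrite /tassoc tlift_tens; [exact: inner| |].
  by move=> w' a x y; exact: tlift_is_linear.
move=> t a x y /=; elim/tens_ind: t => [|s t Hs Ht|u' v'].
- by rewrite !linear0 addr0.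
- have D f : tlift f (s + t) = tlift f s + tlift f t :> tensor U (tensor V W).
    exact: linearD.
  by rewrite !D Hs Ht scalerDr addrACA.
- by rewrite !inner !tens_linearr.
Qed.

End TensorMaps.

Section TensorAlgebra.
Variables (k : fieldType) (A B : falgType k).
Implicit Types (s t r : tensor A B).

Definition tmul s t : tensor A B :=
  tlift (fun a b => tlift (fun c d => tens (a * c) (b * d)) t) s.

Lemma tmul_linearl t : linear (tmul^~ t).
Proof. exact: tlift_is_linear. Qed.

Lemma tmul_linearr s : linear (tmul s).
Proof.
move=> z x y; pose F t a b := tlift (fun c d => tens (a * c) (b * d)) t.
have FP a b : F (z *: x + y) a b = z *: F x a b + F y a b.
  exact: tlift_is_linear.
rewrite /tmul [LHS]/tlift [X in _ = _ *: X + _]/tlift [X in _ = _ + X]/tlift.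
rewrite scaler_sumr -big_split; apply: eq_bigr => i _ /=.
rewrite scaler_sumr -big_split; apply: eq_bigr => j _ /=.
by rewrite -/(F _ _ _) FP scalerDr !scalerA mulrC.
Qed.

Let tmull t : {linear tensor A B -> tensor A B} :=
  HB.pack (tmul^~ t) (GRing.isLinear.Build _ _ _ _ _ (tmul_linearl t)).
Let tmulr s : {linear tensor A B -> tensor A B} :=
  HB.pack (tmul s) (GRing.isLinear.Build _ _ _ _ _ (tmul_linearr s)).

Lemma tmulDl : left_distributive tmul +%R.
Proof. by move=> s t r; exact: (linearD (tmull r)). Qed.
Lemma tmulDr : right_distributive tmul +%R.
Proof. by move=> s t r; exact: (linearD (tmulr s)). Qed.
Lemma tmul0t t : tmul 0 t = 0. Proof. exact: (linear0 (tmull t)). Qed.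
Lemma tmult0 t : tmul t 0 = 0. Proof. exact: (linear0 (tmulr t)). Qed.

Lemma tmul_tens (a c : A) (b d : B) :
  tmul (tens a b) (tens c d) = tens (a * c) (b * d).
Proof.
have inner a' b' :
    tlift (fun c d => tens (a' * c) (b' * d)) (tens c d)
  = tens (a' * c) (b' * d).
  rewrite tlift_tens // => ? z x y; rewrite mulrDr -scalerAr.
    exact: tens_linearl.
  exact: tens_linearr.
rewrite /tmul tlift_tens; first exact: inner.
  by move=> b' z x y; rewrite !inner mulrDl -scalerAl tens_linearl.
by move=> a' z x y; rewrite !inner mulrDl -scalerAl tens_linearr.
Qed.

Lemma tmulA : associative tmul.
Proof.
move=> s t r; elim/tens_ind: s => [|s s' Hs Hs'|a b]; first by rewrite !tmul0t.
  by rewrite !tmulDl Hs Hs'.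
elim/tens_ind: t => [|t t' Ht Ht'|c d]; first by rewrite tmul0t tmult0 tmul0t.
  by rewrite tmulDl !tmulDr tmulDl Ht Ht'.
elim/tens_ind: r => [|r r' Hr Hr'|e f]; first by rewrite !tmult0.
  by rewrite !tmulDr Hr Hr'.
by rewrite !tmul_tens !mulrA.
Qed.

Lemma tmul1t : left_id (tens 1 1) tmul.
Proof.
move=> t; elim/tens_ind: t => [|s t Hs Ht|a b]; first by rewrite tmult0.
  by rewrite tmulDr Hs Ht.
by rewrite tmul_tens !mul1r.
Qed.

Lemma tmult1 : right_id (tens 1 1) tmul.
Proof.
move=> t; elim/tens_ind: t => [|s t Hs Ht|a b]; first by rewrite tmul0t.
  by rewrite tmulDl Hs Ht.
by rewrite tmul_tens !mulr1.
Qed.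

Lemma tens1_neq0 : tens 1 1 != 0 :> tensor A B.
Proof.
have nz (C : falgType k) : exists i, v2r (1 : C) 0 i != 0.
  apply/existsP; apply: contraNT (oner_neq0 C) => /existsPn z.
  rewrite -[1]v2rK (_ : v2r 1 = 0) ?linear0 //.
  by apply/rowP => i; rewrite mxE; apply/eqP; move: (z i); rewrite negbK.
have [[i Hi] [j Hj]] := (nz A, nz B).
apply: contraTneq (mulf_neq0 Hi Hj) => /matrixP/(_ i j).
by rewrite /tens !mxE big_ord1 mxE negbK => ->.
Qed.

HB.instance Definition _ := GRing.Zmodule_isNzRing.Build (tensor A B)
  tmulA tmul1t tmult1 tmulDl tmulDr tens1_neq0.

Lemma tscaleAl (a : k) s t : a *: (s * t) = (a *: s) * t.
Proof. by symmetry; apply: (linearZ_LR (tmull t)). Qed.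
Lemma tscaleAr (a : k) s t : a *: (s * t) = s * (a *: t).
Proof. by symmetry; apply: (linearZ_LR (tmulr s)). Qed.

HB.instance Definition _ :=
  GRing.Lmodule_isLalgebra.Build k (tensor A B) tscaleAl.
HB.instance Definition _ :=
  GRing.Lalgebra_isAlgebra.Build k (tensor A B) tscaleAr.

End TensorAlgebra.

HB.mixin Record Falgebra_isHopf (k : fieldType) H of Falgebra k H := {
  comul : {lrmorphism H -> tensor H H};
  counit : {lrmorphism H -> k^o};
  antipode : {linear H -> H};
  comulA : forall h : H,
    tassoc (tmap comul idfun (comul h)) = tmap idfun comul (comul h);
  counitl : forall h : H, tlift (fun a b => counit a *: b) (comul h) = h;
  counitr : forall h : H, tlift (fun a b => counit b *: a) (comul h) = h;
  antipodel : forall h : H,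
    tlift (fun a b => antipode a * b) (comul h) = (counit h : k)%:A;
  antipoder : forall h : H,
    tlift (fun a b => a * antipode b) (comul h) = (counit h : k)%:A
}.

#[short(type="hopfAlgType")]
HB.structure Definition Hopf (k : fieldType) :=
  { H of Falgebra_isHopf k H & Falgebra k H }.

Section HopfNotions.
Variables (k : fieldType) (H : hopfAlgType k).

Definition primitive_element (x : H) : Prop :=
  comul x = tens x 1 + tens 1 x.

Definition left_integral (L : H) : Prop :=
  forall h : H, h * L = (counit h : k) *: L.

Definition right_integral (L : H) : Prop :=
  forall h : H, L * h = (counit h : k) *: L.

Definition unimodular : Prop :=
  forall L : H, left_integral L <-> right_integral L.

End HopfNotions.

Section Algebras.
Variables (k : fieldType) (A : falgType k).

Definition left_ideal (I : {vspace A}) : Prop := ({:A} * I <= I)%VS.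

Definition minimal_left_ideal (I : {vspace A}) : Prop :=
  [/\ left_ideal I, I <> 0%VS &
      forall J : {vspace A}, left_ideal J -> (J <= I)%VS -> J = 0%VS \/ J = I].

(* The regular module is a finite direct sum of simple submodules. *)
Definition semisimple_algebra : Prop :=
  exists (m : nat) (L : 'I_m -> {vspace A}),
    [/\ forall i, minimal_left_ideal (L i),
        directv (\sum_i L i) & (\sum_i L i)%VS = fullv].

Definition gen_subalg (x : A) : {aspace A} := <<1; x>>%AS.

Definition idempotent (e : A) : Prop := e * e = e.

Definition primitive_idempotent (B : {aspace A}) (e : A) : Prop :=
  [/\ e \in B, e <> 0, idempotent e &
      forall f g : A, f \in B -> g \in B -> idempotent f -> idempotent g ->
        f * g = 0 -> g * f = 0 -> e = f + g -> f = 0 \/ g = 0].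

End Algebras.

Definition semisimple_element (k : fieldType) (A : falgType k) (x : A) : Prop :=
  semisimple_algebra (subvs_of (gen_subalg x)).

Section Modules.
Variables (R : pzRingType) (M : lmodType R).

Definition indecomposable_module : Prop :=
  (exists m : M, m <> 0) /\
  forall N P : submodClosed M,
    (forall m, exists n p, [/\ n \in N, p \in P & m = n + p]) ->
    (forall m, m \in N -> m \in P -> m = 0) ->
    (forall n, n \in N -> n = 0) \/ (forall p, p \in P -> p = 0).

Definition projective_module : Prop :=
  forall (X Y : lmodType R) (g : {linear X -> Y}) (f : {linear M -> Y}),
    (forall y, exists x, g x = y) ->
  exists h : {linear M -> X}, forall m, g (h m) = f m.

End Modules.

Section PrincipalLeftIdeal.
Variables (k : fieldType) (A : falgType k) (e : A).

Definition principal_left_ideal : {vspace A} := ({:A} * <[e]>)%VS.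

Lemma principal_left_idealP (a : A) :
  reflect (exists b, a = b * e) (a \in principal_left_ideal).
Proof.
apply: (iffP idP) => [|[b ->]]; last by rewrite memv_mul ?memvf ?memv_line.
rewrite /principal_left_ideal -limg_amulr => /memv_imgP[b _ ->]; exists b.
by rewrite lfunE.
Qed.

(* The left ideal as a submodule of the regular left A-module A^o. *)
Definition principal_left_ideal_pred : {pred A^o} :=
  fun a => (a : A) \in principal_left_ideal.

Lemma principal_left_ideal_submod : submod_closed principal_left_ideal_pred.
Proof.
split=> [|a u v]; first by rewrite /in_mem /=; apply: mem0v.
move=> /principal_left_idealP[b ub] /principal_left_idealP[c vc].
by apply/principal_left_idealP; exists (a * b + c); rewrite ub vc mulrDl -mulrA.
Qed.

HB.instance Definition _ := GRing.isSubmodClosed.Build A A^o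
  principal_left_ideal_pred principal_left_ideal_submod.

Record principal_left_module : Type := PrincipalLeftModule {
  plm_val : A^o;
  _ : plm_val \in principal_left_ideal_pred
}.

HB.instance Definition _ := [isSub of principal_left_module for plm_val].
HB.instance Definition _ := [Choice of principal_left_module by <:].
HB.instance Definition _ :=
  [SubChoice_isSubZmodule of principal_left_module by <:].
HB.instance Definition _ :=
  [SubZmodule_isSubLmodule of principal_left_module by <:].

End PrincipalLeftIdeal.

(* Main.v *)
Require Import Defs.
From mathcomp Require Import all_boot all_algebra all_field.
From HB Require Import structures.
From Stdlib Require Import Classical.
Set Implicit Arguments.
Unset Strict Implicit.
Unset Printing Implicit Defensive.
Local Open Scope ring_scope.

(** The element x splits k[x] into weight idempotents e_v, and H (x) H is, as a
    module over k[x], both a sum of copies of H and the tensor square of H. So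
    all weights have the same multiplicity in H, whence dim He_v = p; the same
    count for grouplikes shows that those in Radford's formula for S^4 have
    p-power order, so that S^4 is unipotent.

    If L is an integral and lambda a cointegral, the trace of h |-> S^2(h) a is
    eps(L) lambda(a), hence zero, as H is not semisimple (Maschke). On He_v the
    eigenvalues of S^2 are 1 and -1, its trace vanishes and the dimension p is
    odd, so S^2 is unipotent on a space of dimension p, and S^(2p) = 1.

    If He_v were decomposable, it would contain Hf for a primitive idempotent f
    with dim Hf < p. An isomorphism of Hf with a conjugate of it under S^(2i),
    0 < i < p, would have an invertible twisted norm, but that norm is nilpotent
    by the vanishing of the traces. Hence the p conjugates of f are linearly
    independent and fill He_v, so that Hf is a line; a projective module of
    dimension 1 makes H semisimple.

    In the unimodular case S^4 is conjugation by a grouplike g that commutes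
    with x. Unless g = 1, the elements of k[g]e_v fill He_v for every v, so
    that g is central; in both cases S^4 = 1, and p is odd. *)
Import GRing.Theory VectorInternalTheory.

(** * Linearity and Sweedler sums *)

Section Linear.
Variable k : fieldType.

(** The two structures on H (x) H are compared only by an inequality: the canonical map is
    injective, so each weight of H occurs in the tensor square, where weights add, at least dim H
    times as often as in H. For a weight of maximal multiplicity this forces all weights to be
    maximal and their set to be closed under differences, or quotients in the multiplicative case;
    their number then divides dim H. The trace formula is needed with an arbitrary second factor a:
    a = e_v isolates S^2 on He_v, and a in S^2(f) H f turns h |-> S^2(h) a into an operator on Hf
    whose p-th power is right multiplication by a norm. In characteristic p a scalar has only one
    p-th root, so this operator has a single eigenvalue, repeated dim Hf < p times; trace 0 makes it
    0. Radford's formula controls S^4 only, and the eigenvalue -1 of S^2 cannot be excluded before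
    the trace is used; this is one use of p > 2. *)

Definition lin (U V : lmodType k) (f : U -> V) : Prop :=
  forall c u v, f (c *: u + v) = c *: f u + f v.

Definition bilin (U V W : lmodType k) (f : U -> V -> W) : Prop :=
  (forall v, lin (f^~ v)) /\ (forall u, lin (f u)).

Definition trilin (U V W X : lmodType k) (f : U -> V -> W -> X) : Prop :=
  [/\ forall v w, lin (fun u => f u v w), forall u w, lin (fun v => f u v w)
    & forall u v, lin (f u v)].

Definition quadrilin (U V W X Y : lmodType k) (f : U -> V -> W -> X -> Y) :
    Prop :=
  [/\ forall v w x, lin (fun u => f u v w x),
      forall u w x, lin (fun v => f u v w x),
      forall u v x, lin (fun w => f u v w x)
    & forall u v w, lin (f u v w)].

Implicit Types U V W : lmodType k.

Lemma lin_id U : lin (fun u : U => u). Proof. by []. Qed.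
Lemma lin_linear U V (f : U -> V) : lin f -> linear f. Proof. by []. Qed.
Lemma lin_map U V W (L : {linear V -> W}) (f : U -> V) :
  lin f -> lin (fun x => L (f x)).
Proof. by move=> hf c u v; rewrite hf linearP. Qed.
Lemma lin_comp U V W (g : V -> W) (f : U -> V) :
  lin g -> lin f -> lin (fun x => g (f x)).
Proof. by move=> hg hf c u v; rewrite hf hg. Qed.
Lemma lin_scaler U V (a : k) (f : U -> V) : lin f -> lin (fun x => a *: f x).
Proof. by move=> hf c u v; rewrite hf scalerDr !scalerA mulrC. Qed.
Lemma lin_scalel U V (f : U -> k^o) (w : V) :
  lin f -> lin (fun x => (f x : k) *: w).
Proof. by move=> hf c u v; rewrite hf scalerDl scalerA. Qed.
Lemma lin_add U V (f g : U -> V) :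
  lin f -> lin g -> lin (fun x => f x + g x).
Proof. by move=> hf hg c u v; rewrite hf hg scalerDr addrACA. Qed.
Lemma lin_sum U V I r (P : pred I) (f : I -> U -> V) :
  (forall i, lin (f i)) -> lin (fun x => \sum_(i <- r | P i) f i x).
Proof.
move=> hf c u v; rewrite scaler_sumr -big_split.
by apply: eq_bigr => i _; apply: hf.
Qed.
Lemma lin_opp U V (f : U -> V) : lin f -> lin (fun x => - f x).
Proof. by move=> hf c u v; rewrite hf opprD scalerN. Qed.
Lemma lin_mull U (A : algType k) (a : A) (f : U -> A) :
  lin f -> lin (fun x => a * f x).
Proof. by move=> hf c u v; rewrite hf mulrDr scalerAr. Qed.
Lemma lin_mulr U (A : lalgType k) (a : A) (f : U -> A) :
  lin f -> lin (fun x => f x * a).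
Proof. by move=> hf c u v; rewrite hf mulrDl scalerAl. Qed.
Lemma lin_tensl (X Y : vectType k) U (f : U -> X) (y : Y) :
  lin f -> lin (fun x => tens (f x) y).
Proof. by move=> hf c u v; rewrite hf tens_linearl. Qed.
Lemma lin_tensr (X Y : vectType k) U (f : U -> Y) (y : X) :
  lin f -> lin (fun x => tens y (f x)).
Proof. by move=> hf c u v; rewrite hf tens_linearr. Qed.
Lemma tens0l (X Y : vectType k) (y : Y) : tens 0 y = 0 :> tensor X Y.
Proof. by rewrite /tens linear0 linear0 mul0mx. Qed.
Lemma tens0r (X Y : vectType k) (x : X) : tens x 0 = 0 :> tensor X Y.
Proof. by rewrite /tens linear0 mulmx0. Qed.
Lemma tensDl (X Y : vectType k) (x x' : X) (y : Y) :
  tens (x + x') y = tens x y + tens x' y.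
Proof. by rewrite /tens !linearD mulmxDl. Qed.
Lemma tensDr (X Y : vectType k) (x : X) (y y' : Y) :
  tens x (y + y') = tens x y + tens x y'.
Proof. by rewrite /tens linearD mulmxDr. Qed.
Lemma lin0 U V (f : U -> V) : lin f -> f 0 = 0.
Proof.
by move=> hf; have := hf (-1) 0 0; rewrite scaler0 addr0 scaleN1r addNr.
Qed.
Lemma linZ U V (f : U -> V) c u : lin f -> f (c *: u) = c *: f u.
Proof. by move=> hf; rewrite -[c *: u]addr0 hf (lin0 hf) addr0. Qed.
Lemma linD U V (f : U -> V) u v : lin f -> f (u + v) = f u + f v.
Proof. by move=> hf; have := hf 1 u v; rewrite !scale1r. Qed.
Lemma linB U V (f : U -> V) u v : lin f -> f (u - v) = f u - f v.
Proof. by move=> hf; rewrite linD // -scaleN1r linZ // scaleN1r. Qed.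
Lemma lin_bigsum U V (f : U -> V) I r (P : pred I) (F : I -> U) : lin f ->
  f (\sum_(i <- r | P i) F i) = \sum_(i <- r | P i) f (F i).
Proof.
by move=> hf; apply: big_morph => [u v|]; [apply: linD | apply: lin0].
Qed.

Lemma lin_tlift_arg (X Y : vectType k) W U (F : X -> Y -> W) (g : U -> tensor X Y) :
  lin g -> lin (fun x => tlift F (g x)).
Proof. by move=> hg c u v; rewrite hg linearP. Qed.

Lemma lin_tlift_fun (X Y : vectType k) W U (F : U -> X -> Y -> W) t :
  (forall a b, lin (fun x => F x a b)) -> lin (fun x => tlift (F x) t).
Proof.
move=> hF c u v; rewrite /tlift scaler_sumr -big_split; apply: eq_bigr => i _.
rewrite /= scaler_sumr -big_split; apply: eq_bigr => j _ /=.
by rewrite hF scalerDr !scalerA mulrC.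
Qed.

End Linear.

Section Sweedler.
Variables (k : fieldType) (H : hopfAlgType k).
Implicit Types (U W : lmodType k) (h a b : H).

(* The Sweedler sum of the f h_(1) h_(2). *)
Definition sw W (f : H -> H -> W) h : W := tlift f (comul h).

Lemma lin_sw_arg U W (f : H -> H -> W) (g : U -> H) :
  lin g -> lin (fun x => sw f (g x)).
Proof. by move=> hg; apply: lin_tlift_arg => c u v; rewrite hg linearP. Qed.

Lemma lin_sw_fun U W (F : U -> H -> H -> W) h :
  (forall a b, lin (fun x => F x a b)) -> lin (fun x => sw (F x) h).
Proof. exact: lin_tlift_fun. Qed.

Lemma eq_sw W (f g : H -> H -> W) h :
  (forall a b, f a b = g a b) -> sw f h = sw g h.
Proof.
by move=> e; apply: eq_bigr => i _; apply: eq_bigr => j _; rewrite e.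
Qed.

Lemma tlift_lin (X Y : vectType k) U W (L : U -> W) (f : X -> Y -> U) t :
  lin L -> L (tlift f t) = tlift (fun x y => L (f x y)) t.
Proof.
move=> hL; rewrite /tlift (lin_bigsum _ _ _ hL); apply: eq_bigr => i _.
by rewrite (lin_bigsum _ _ _ hL); apply: eq_bigr => j _; rewrite linZ.
Qed.

Lemma sw_lin U W (L : U -> W) (f : H -> H -> U) h :
  lin L -> L (sw f h) = sw (fun a b => L (f a b)) h.
Proof. exact: tlift_lin. Qed.

Lemma tlift_pair (X Y : vectType k) W (f : X -> Y -> W) t :
  tlift f t = \sum_(p : 'I_(dim X) * 'I_(dim Y))
    (t : 'M[k]_(_, _)) p.1 p.2 *: f (Defs.coord_basis p.1) (Defs.coord_basis p.2).
Proof. by rewrite /tlift pair_big. Qed.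

Lemma sw_exch W (F : H -> H -> H -> H -> W) h a :
  sw (fun h1 h2 => sw (fun a1 a2 => F h1 h2 a1 a2) a) h =
  sw (fun a1 a2 => sw (fun h1 h2 => F h1 h2 a1 a2) h) a.
Proof.
rewrite /sw !tlift_pair; under eq_bigr do rewrite tlift_pair scaler_sumr.
rewrite exchange_big; apply: eq_bigr => p _; rewrite tlift_pair scaler_sumr.
by apply: eq_bigr => q _; rewrite !scalerA mulrC.
Qed.

End Sweedler.

(** A hook tried by [lin_step] before the rule for bundled maps; it is redefined once the coordinate
    functions of H are available. *)
Ltac lin_extra := fail.

Ltac lin_step :=
  match goal with |- lin ?f => change (lin (fun x => f x)); cbv beta end;
  match goal with
  | |- lin (fun x => x) => exact: lin_id
  | h : forall v, lin (fun u => ?f u v) |- lin (fun x => ?f (@?g x) _) =>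
      refine (lin_comp (h _) (_ : lin g))
  | |- lin (fun x => @sw _ _ _ ?f (@?g x)) => apply: lin_sw_arg
  | |- lin (fun x => @sw _ _ _ (@?f x) ?h) => apply: lin_sw_fun => ? ?
  | |- lin (fun x => @tlift _ _ _ _ ?f (@?g x)) => apply: lin_tlift_arg
  | |- lin (fun x => @tlift _ _ _ _ (@?f x) ?h) => apply: lin_tlift_fun => ? ?
  | |- lin (fun x => @GRing.mul _ ?a (@?g x)) => apply: lin_mull
  | |- lin (fun x => @GRing.mul _ (@?g x) ?a) => apply: lin_mulr
  | |- lin (fun x => @GRing.scale _ _ ?a (@?g x)) => apply: lin_scaler
  | |- lin (fun x => @GRing.scale _ _ (@?g x) ?a) => apply: (lin_scalel (f := g))
  | |- lin (fun x => @tens _ _ _ ?a (@?g x)) => apply: lin_tensr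
  | |- lin (fun x => @tens _ _ _ (@?g x) ?a) => apply: lin_tensl
  | |- lin (fun x => Algebra.add (@?f x) (@?g x)) => apply: lin_add
  | |- lin (fun x => Algebra.opp (@?f x)) => apply: lin_opp
  | |- lin (fun x => \sum_(i <- _ | _) _) => apply: lin_sum => ?
  | h : lin ?f |- lin (fun x => ?f (@?g x)) =>
      refine (lin_comp (h : lin f) (_ : lin g))
  | h : forall v, lin (?f v) |- lin (fun x => ?f ?v (@?g x)) =>
      refine (lin_comp (h v) (_ : lin g))
  | h : forall v w, lin (?f v w) |- lin (fun x => ?f ?v ?w (@?g x)) =>
      refine (lin_comp (h v w) (_ : lin g))
  | h : forall u w, lin (fun v => ?f v u w) |- lin (fun x => ?f (@?g x) ?u ?w) =>
      refine (lin_comp (h u w) (_ : lin g))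
  | h : forall u w, lin (fun v => ?f u v w) |- lin (fun x => ?f ?u (@?g x) ?w) =>
      refine (lin_comp (h u w) (_ : lin g))
  | |- _ => lin_extra
  | |- lin (fun x => _ (@?g x)) => refine (lin_map _ (_ : lin g))
  | |- lin _ => (move=> ? ? ? /=; rewrite linearP //; fail) || fail
  end.

(* Reads W off the sums: the type of the equation may be a different path to
   the same module. *)
Ltac eqsw :=
  cbv beta;
  match goal with
  | |- @eq _ (@sw ?k ?H ?W ?f ?h) (@sw _ _ _ ?g _) =>
      refine (@eq_sw k H W f g h _)
  end.

(** Linearity is a predicate on bare functions because the arguments of Sweedler sums are lambda
    terms; this tactic discharges the side conditions by recursion on the body. *)
Ltac lintac :=
  intros; rewrite /=;
  try match goal with
  | |- GRing.linear_for _ _ => apply: lin_linear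
  | |- bilin _ => split
  | |- trilin _ => split
  | |- quadrilin _ => split
  end; intros; rewrite /=; repeat lin_step; try assumption.

(** * The antipode *)

Section Hopf.
Variables (k : fieldType) (H : hopfAlgType k).
Implicit Types (W : lmodType k).
Local Notation S := (@antipode k H).
Local Notation eps := (@counit k H).

(** Coassociativity for summands: a trilinear F factors through a linear map [G] on the triple
    tensor product, and both sides are [G] applied to the two sides of [comulA]. *)
Lemma swA W (F : H -> H -> H -> W) (h : H) : trilin F ->
  sw (fun a b => sw (fun c d => F c d b) a) h =
  sw (fun a b => sw (fun c d => F a c d) b) h.
Proof.
case=> F1 F2 F3.
pose G : tensor H (tensor H H) -> W := tlift (fun a t => tlift (F a) t).
have GE a b c : G (tens a (tens b c)) = F a b c.
  rewrite /G tlift_tens; first 1 last.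
  - by move=> t; apply: lin_tlift_fun => ? ?; apply: F1.
  - by move=> u; apply: lin_tlift_arg; apply: lin_id.
  by rewrite tlift_tens // => ?; [apply: F2 | apply: F3].
have linG : lin G by exact: linearP.
have linA : lin (@tassoc k H H H) by exact: linearP.
rewrite /sw -[LHS](_ : G (tassoc (tmap comul idfun (comul h))) = _); last first.
  elim/tens_ind: (comul h) => [|s t hs ht|u v].
  - by rewrite /tmap !linear0 lin0 // lin0.
  - by rewrite /tmap !linearD linD // linD // -/(tmap _ _ _) hs ht.
  rewrite tmap_tens tlift_tens; first 1 last.
  - by move=> w; lintac.
  - by move=> w; lintac.
  suff E (s : tensor H H) : G (tassoc (tens s v)) = tlift (fun c d => F c d v) s.
    exact: E.
  elim/tens_ind: s => [|s t hs ht|a b].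
  - by rewrite linear0 tens0l (lin0 linA) lin0.
  - rewrite tensDl (linD _ _ linA) linD // hs ht; apply: esym; exact: linearD.
  rewrite tassoc_tens GE tlift_tens // => ?; lintac.
rewrite comulA; elim/tens_ind: (comul h) => [|s t hs ht|u v].
- by rewrite /tmap !linear0 lin0.
- by rewrite /tmap !linearD linD // -/(tmap _ _ _) hs ht.
rewrite tmap_tens tlift_tens; first 1 last.
- by move=> w; lintac.
- by move=> w; lintac.
suff E (s : tensor H H) : G (tens u s) = tlift (F u) s by exact: E.
elim/tens_ind: s => [|s t hs ht|a b].
- by rewrite linear0 tens0r lin0.
- rewrite tensDr linD // hs ht; apply: esym; exact: linearD.
by rewrite GE tlift_tens // => ?; lintac.
Qed.

Lemma swM W (f : H -> H -> W) (a b : H) : bilin f ->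
  sw f (a * b) = sw (fun a1 a2 => sw (fun b1 b2 => f (a1 * b1) (a2 * b2)) b) a.
Proof.
case=> f1 f2; rewrite /sw rmorphM /=.
suff E (s r : tensor H H) : tlift f (s * r) = tlift (fun a1 a2 =>
    tlift (fun b1 b2 => f (a1 * b1) (a2 * b2)) r) s by exact: E.
elim/tens_ind: s => [|s t hs ht|u v].
- by rewrite mul0r !linear0.
- transitivity (tlift f (s * r) + tlift f (t * r)).
    by rewrite mulrDl; apply: linearD.
  by rewrite hs ht; apply: esym; apply: linearD.
rewrite [RHS]tlift_tens; first 1 last.
- by move=> w; lintac.
- by move=> w; lintac.
elim/tens_ind: r => [|s t hs ht|c d].
- by rewrite mulr0 !linear0.
- transitivity (tlift f (tens u v * s) + tlift f (tens u v * t)).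
    by rewrite mulrDr; apply: linearD.
  by rewrite hs ht; apply: esym; apply: linearD.
by rewrite [_ * _]tmul_tens !tlift_tens // => ?; lintac.
Qed.

Lemma sw_tens (h : H) : sw (fun a b => tens a b : tensor H H) h = comul h.
Proof.
rewrite /sw; elim/tens_ind: (comul h) => [|s t hs ht|u v].
- exact: linear0.
- by rewrite -[in RHS]hs -[in RHS]ht; apply: linearD.
by rewrite tlift_tens // => ?; lintac.
Qed.

Lemma sw1 W (f : H -> H -> W) : bilin f -> sw f 1 = f 1 1.
Proof. by case=> f1 f2; rewrite /sw rmorph1 [LHS]tlift_tens. Qed.

Lemma sw_counitl W (f : H -> W) h : lin f ->
  sw (fun a b => (eps a : k) *: f b) h = f h.
Proof.
move=> hf; rewrite -[in RHS](counitl h) (sw_lin _ _ hf); eqsw => a b.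
by rewrite linZ.
Qed.

Lemma sw_counitr W (f : H -> W) h : lin f ->
  sw (fun a b => (eps b : k) *: f a) h = f h.
Proof.
move=> hf; rewrite -[in RHS](counitr h) (sw_lin _ _ hf); eqsw => a b.
by rewrite linZ.
Qed.

Lemma sw_antil W (f : H -> W) h : lin f ->
  sw (fun a b => f (S a * b)) h = (eps h : k) *: f 1.
Proof.
by move=> hf; rewrite -linZ // -antipodel [f (tlift _ _)](sw_lin _ _ hf).
Qed.

Lemma sw_antir W (f : H -> W) h : lin f ->
  sw (fun a b => f (a * S b)) h = (eps h : k) *: f 1.
Proof.
by move=> hf; rewrite -linZ // -antipoder [f (tlift _ _)](sw_lin _ _ hf).
Qed.

Lemma counitM a b : (eps (a * b) : k) = (eps a : k) * (eps b : k).
Proof. exact: rmorphM. Qed.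

Lemma counit1 : (eps 1 : k) = 1.
Proof. exact: rmorph1. Qed.

Lemma antipode1 : S 1 = 1.
Proof.
have := antipodel (1 : H); rewrite -/(sw _ _) sw1; last by lintac.
by rewrite mulr1 counit1 scale1r.
Qed.

(* Both sides compute S (a1 b1) a2 b2 S b3 S a3. *)
Lemma antipodeM (a b : H) : S (a * b) = S b * S a.
Proof.
transitivity (sw (fun x a3 => sw (fun a1 a2 => sw (fun y b3 => sw (fun b1 b2 =>
   S (a1 * b1) * (a2 * b2) * (S b3 * S a3)) y) b) x) a); last first.
  rewrite -(sw_counitl (f := fun z => S b * S z)); last by lintac.
  eqsw => x a3; rewrite sw_exch.
  rewrite -(sw_counitl (f := fun z => S z * S a3)); last by lintac.
  rewrite [RHS](sw_lin _ _ (L := fun z : H => (eps x : k) *: z)); last by lintac.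
  eqsw => y b3.
  rewrite -(swM (f := fun u v => S u * v * (S b3 * S a3))); last by lintac.
  rewrite [LHS](sw_antil (f := fun z => z * (S b3 * S a3))); last by lintac.
  by rewrite mul1r counitM scalerA.
rewrite (swA (F := fun a1 a2 a3 => sw (fun y b3 => sw (fun b1 b2 =>
   S (a1 * b1) * (a2 * b2) * (S b3 * S a3)) y) b)); last by lintac.
rewrite -(sw_counitr (f := fun z => S (z * b))); last by lintac.
eqsw => a1 z; symmetry.
rewrite -[X in _ = _ *: X]mulr1.
rewrite -[RHS](sw_antir (f := fun u => S (a1 * b) * u)); last by lintac.
eqsw => a2 a3.
rewrite (swA (F := fun b1 b2 b3 => S (a1 * b1) * (a2 * b2) * (S b3 * S a3)));
  last by lintac.
rewrite -(sw_counitr (f := fun z => S (a1 * z) * _)); last by lintac.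
eqsw => b1 w.
transitivity (sw (fun u v => S (a1 * b1) * (a2 * (u * S v * S a3))) w).
  by eqsw => u v; rewrite !mulrA.
rewrite [LHS](sw_antir (f := fun u => S (a1 * b1) * (a2 * (u * S a3)))).
  by rewrite mul1r.
by lintac.
Qed.

(** In the convolution algebra of maps from H to A, f = f (g v) = (f g) v = v: a left inverse of g
    equals a right inverse. *)
Lemma conv_inv_uniq (A : algType k) (f g v : H -> A) :
    lin f -> lin g -> lin v ->
    (forall h, sw (fun a b => f a * g b) h = (eps h : k) *: 1) ->
    (forall h, sw (fun a b => g a * v b) h = (eps h : k) *: 1) ->
  forall h, f h = v h.
Proof.
move=> hf hg hv fg gv h.
rewrite -[RHS](sw_counitl (f := v)) //.
transitivity (sw (fun x c => sw (fun a b => f a * g b * v c) x) h); last first.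
  eqsw => x c; rewrite -[v c in RHS]mul1r scalerAl -fg.
  by rewrite (sw_lin _ _ (L := fun z => z * v c)); last by lintac.
rewrite (swA (F := fun a b c => f a * g b * v c)); last by lintac.
rewrite -[LHS](sw_counitr (f := f)) //; eqsw => a x.
rewrite -[f a in LHS]mulr1 scalerAr -gv (sw_lin _ _ (L := fun z => f a * z)).
  by eqsw => b c; rewrite mulrA.
by lintac.
Qed.

(** In the convolution algebra of maps from H to H (x) H, [comul] has h |-> comul (S h) as a left
    inverse and h |-> S h2 (x) S h1 as a right inverse. *)
Lemma comul_antipode (h : H) :
  comul (S h) = sw (fun a b => tens (S b) (S a)) h.
Proof.
pose f h := comul (S h) : tensor H H.
pose g h := comul h : tensor H H.
pose v h : tensor H H := sw (fun a b => tens (S b) (S a)) h.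
have hf : lin f by move=> c x y; rewrite /f !linearP.
have hg : lin g by move=> c x y; rewrite /g !linearP.
have hv : lin v by rewrite /v; lintac.
apply: (conv_inv_uniq (f := f) (g := g) (v := v)) => // {}h.
  transitivity (sw (fun a b => g (S a * b)) h).
    by eqsw => a b; rewrite /g rmorphM.
  by rewrite sw_antil // /g rmorph1.
transitivity (sw (fun a b => sw (fun a1 a2 => sw (fun c d =>
   (tens (a1 * S d) (a2 * S c) : tensor H H)) b) a) h).
  eqsw => a b; rewrite /g /v -[comul a](sw_tens a).
  rewrite [LHS](sw_lin _ _ (L := fun z => z * _)); last by lintac.
  eqsw => a1 a2.
  rewrite [LHS](sw_lin _ _ (L := fun z => _ * z)); last by lintac.
  by eqsw => c d; rewrite [LHS]tmul_tens.
rewrite (swA (F := fun a1 a2 b => sw (fun c d =>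
   (tens (a1 * S d) (a2 * S c) : tensor H H)) b)); last by lintac.
transitivity (sw (fun a1 x => (tens (a1 * S x) 1 : tensor H H)) h).
  eqsw => a1 x.
  rewrite -(swA (F := fun a2 c d => (tens (a1 * S d) (a2 * S c) : tensor H H)));
    last by lintac.
  rewrite -(sw_counitl (f := fun d => tens (a1 * S d) 1)); last by lintac.
  eqsw => y d.
  by rewrite [LHS](sw_antir (f := fun z => tens (a1 * S d) z)); last by lintac.
by rewrite [LHS](sw_antir (f := fun z => tens z 1)); last by lintac.
Qed.

Lemma sw_antipode W (f : H -> H -> W) h : bilin f ->
  sw f (S h) = sw (fun a b => f (S b) (S a)) h.
Proof.
case=> f1 f2; rewrite /sw comul_antipode.
rewrite (sw_lin _ _ (L := tlift f)); last by move=> ? ? ?; apply: linearP.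
by apply: eq_sw => a b; rewrite tlift_tens.
Qed.

Lemma sw_antipode2 W (f : H -> H -> W) h : bilin f ->
  sw f (S (S h)) = sw (fun a b => f (S (S a)) (S (S b))) h.
Proof.
by case=> f1 f2; rewrite !sw_antipode //; lintac.
Qed.

End Hopf.

(** * Integrals and the Frobenius form *)

Section Trace.
Variable k : fieldType.

Definition basis_vec (V : vectType k) (i : 'I_(dim V)) : V := Defs.coord_basis i.
Definition basis_coord (V : vectType k) (i : 'I_(dim V)) (v : V) : k^o := v2r v 0 i.

Implicit Types U V : vectType k.

Lemma lin_basis_coord V (i : 'I_(dim V)) : lin (basis_coord i).
Proof. by move=> c u v; rewrite /basis_coord linearP !mxE. Qed.

Lemma basis_vecE V (v : V) : v = \sum_i (basis_coord i v : k) *: basis_vec i.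
Proof. exact: coord_basisE. Qed.

Lemma basis_coord_vec V (i j : 'I_(dim V)) : basis_coord i (basis_vec j) = (i == j)%:R :> k.
Proof. by rewrite /basis_coord /basis_vec /Defs.coord_basis r2vK mxE eqxx. Qed.

Lemma basis_coord_inj V (u v : V) : (forall i, basis_coord i u = basis_coord i v) -> u = v.
Proof. by move=> e; rewrite [u]basis_vecE [v]basis_vecE; apply: eq_bigr => i _; rewrite e. Qed.

Lemma lin_basisE V (W : lmodType k) (f : V -> W) v : lin f ->
  f v = \sum_i (basis_coord i v : k) *: f (basis_vec i).
Proof.
move=> hf; rewrite [v in LHS]basis_vecE (lin_bigsum _ _ _ hf).
by apply: eq_bigr => i _; rewrite linZ.
Qed.

Definition trl V (F : V -> V) : k := \sum_i basis_coord i (F (basis_vec i)).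

Lemma eq_trl V (F G : V -> V) : F =1 G -> trl F = trl G.
Proof. by move=> e; apply: eq_bigr => i _; rewrite e. Qed.

Lemma trl_comm U V (A : U -> V) (B : V -> U) : lin A -> lin B ->
  trl (fun v => A (B v)) = trl (fun u => B (A u)).
Proof.
move=> hA hB; rewrite /trl.
under eq_bigr => i _.
  rewrite (lin_basisE (f := fun u => basis_coord i (A u) : k^o)); last first.
    exact: lin_comp (lin_basis_coord i) hA.
over.
rewrite exchange_big; apply: eq_bigr => j _.
rewrite [RHS](lin_basisE (f := fun v => basis_coord j (B v) : k^o)); last first.
  exact: lin_comp (lin_basis_coord j) hB.
by apply: eq_bigr => i _; apply: mulrC.
Qed.

Lemma trl_sum V I r (P : pred I) (F : I -> V -> V) :
  trl (fun v => \sum_(i <- r | P i) F i v) = \sum_(i <- r | P i) trl (F i).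
Proof.
rewrite exchange_big; apply: eq_bigr => i _.
by rewrite (lin_bigsum _ _ _ (@lin_basis_coord _ i)).
Qed.

Lemma trlZ V c (F : V -> V) : trl (fun v => c *: F v) = c * trl F.
Proof.
by rewrite mulr_sumr; apply: eq_bigr => i _; rewrite (linZ _ _ (lin_basis_coord i)).
Qed.

End Trace.

#[export] Hint Resolve lin_basis_coord : core.

Section Integral.
Variables (k : fieldType) (H : hopfAlgType k).
Local Notation S := (@antipode k H).
Local Notation eps := (@counit k H).

Lemma sw_sum (W : lmodType k) I r (P : pred I) (F : I -> H -> H -> W) h :
  sw (fun a b => \sum_(i <- r | P i) F i a b) h =
  \sum_(i <- r | P i) sw (F i) h.
Proof.
rewrite /sw tlift_pair; under [RHS]eq_bigr do rewrite tlift_pair.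
by rewrite exchange_big; apply: eq_bigr => p _; rewrite scaler_sumr.
Qed.

Definition hvec (i : 'I_(dim H)) : H := basis_vec i.
Definition hcoord (i : 'I_(dim H)) (h : H) : k^o := basis_coord i h.

Lemma lin_hcoord i : lin (hcoord i). Proof. exact: lin_basis_coord. Qed.
Lemma hcoord_inj (u v : H) : (forall i, hcoord i u = hcoord i v) -> u = v.
Proof. exact: basis_coord_inj. Qed.
Lemma lin_hcoordE (W : lmodType k) (f : H -> W) v : lin f ->
  f v = \sum_i (hcoord i v : k) *: f (hvec i).
Proof. exact: lin_basisE. Qed.
Lemma trlE (F : H -> H) : trl F = \sum_i hcoord i (F (hvec i)). Proof. by []. Qed.
End Integral.

#[export] Hint Resolve lin_hcoord : core.

Ltac lin_extra ::=
  match goal with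
  | |- lin (fun x => hcoord _ (@?g x)) => refine (lin_comp (lin_hcoord _) (_ : lin g))
  end.

Section Cointegral.
Variables (k : fieldType) (H : hopfAlgType k).
Local Notation S := (@antipode k H).
Local Notation eps := (@counit k H).

Definition lact (f : H -> k^o) (h : H) : H := sw (fun a b => (f a : k) *: b) h.

(** A trace form that makes cointegrals out of arbitrary functionals, in place of the structure
    theorem for Hopf modules: each [trint f] is a right cointegral, and [trint_span] recovers any
    functional from such forms, so they do not all vanish. *)
Definition trint (f : H -> k^o) (y : H) : k^o :=
  trl (fun z => lact f (S (S z) * y)).

Lemma lin_lact (f : H -> k^o) : lin f -> lin (lact f).
Proof. by move=> hf; rewrite /lact; lintac. Qed.

Lemma lin_trint (f : H -> k^o) : lin f -> lin (trint f).
Proof.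
move=> hf c u v; rewrite /trint !trlE scaler_sumr -big_split.
apply: eq_bigr => i _ /=; rewrite mulrDr -scalerAr.
by rewrite (lin_lact hf) lin_hcoord.
Qed.

(** [A] is the map under the trace in [trint f y]. The map [Phi], whose trace is the left side,
    equals the sum of the R' i A R i. As the trace is cyclic, it remains to sum the R i R' i, which
    gives g (S h2 h3) h1 = g(1) h. *)
Lemma trint_test (f g : H -> k^o) (y : H) : lin f -> lin g ->
  sw (fun y1 y2 => (g y2 : k) *: trint f y1) y = g 1 *: trint f y.
Proof.
move=> hf hg; have hl := lin_lact hf.
pose A z := lact f (S (S z) * y).
pose R i z : H := sw (fun a b => (hcoord i (S b) : k) *: a) z.
pose R' i h : H := sw (fun a b => (g (hvec i * b) : k) *: a) h.
have hA : lin A by rewrite /A; lintac.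
have hR i : lin (R i) by rewrite /R; lintac.
have hR' i : lin (R' i) by rewrite /R'; lintac.
have gE u v : g (u * v) = \sum_i (hcoord i u : k) *: g (hvec i * v).
  by rewrite (lin_hcoordE (f := fun u => g (u * v))); last by lintac.
pose Phi z := sw (fun y1 y2 => (g y2 : k) *: lact f (S (S z) * y1)) y.
have PhiE z : Phi z = \sum_i R' i (A (R i z)).
  transitivity (\sum_i sw (fun z1 z2 => sw (fun v d =>
     (hcoord i (S z2) : k) *: ((g (hvec i * d) : k) *: lact f v)) (S (S z1) * y)) z).
    transitivity (sw (fun z1 z2 => sw (fun v d =>
        (g (S z2 * d) : k) *: lact f v) (S (S z1) * y)) z); last first.
      rewrite -sw_sum; eqsw => z1 z2; rewrite -sw_sum.
      by eqsw => v d; rewrite gE scaler_suml; under eq_bigr do rewrite -scalerA.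
    transitivity (sw (fun z1 z2 => sw (fun p q => sw (fun y1 y2 =>
       (g (S z2 * (S (S q) * y2)) : k) *: lact f (S (S p) * y1)) y) z1) z); last first.
      eqsw => z1 z2; rewrite swM; last by lintac.
      by rewrite sw_antipode2; last by lintac.
    rewrite (swA (F := fun p q z2 => sw (fun y1 y2 =>
      (g (S z2 * (S (S q) * y2)) : k) *: lact f (S (S p) * y1)) y)); last by lintac.
    rewrite -[LHS](sw_counitr (f := Phi)); last by rewrite /Phi; lintac.
    eqsw => p w.
    transitivity (sw (fun q z2 => sw (fun y1 y2 =>
      (g (S (S q * z2) * y2) : k) *: lact f (S (S p) * y1)) y) w); last first.
      by eqsw => q z2; eqsw => y1 y2; rewrite antipodeM mulrA.
    rewrite [RHS](sw_antil (f := fun u => sw (fun y1 y2 =>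
      (g (S u * y2) : k) *: lact f (S (S p) * y1)) y)); last by lintac.
    by congr (_ *: _); rewrite /Phi; eqsw => y1 y2; rewrite antipode1 mul1r.
  apply: eq_bigr => i _; rewrite /R.
  rewrite [X in R' i X](sw_lin _ _ hA) (sw_lin _ _ (hR' i)).
  eqsw => z1 z2; rewrite (linZ _ _ hA) (linZ _ _ (hR' i)).
  rewrite -[LHS](sw_lin _ _ (L := fun u : H => (hcoord i (S z2) : k) *: u));
    last by lintac.
  congr (_ *: _); rewrite /A.
  rewrite [X in R' i X]/lact (sw_lin _ _ (hR' i)).
  transitivity (sw (fun v d => sw (fun a c =>
     (f a : k) *: ((g (hvec i * d) : k) *: c)) v) (S (S z1) * y)).
    eqsw => v d.
    rewrite [LHS](sw_lin _ _ (L := fun u : H => (g (hvec i * d) : k) *: u));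
      last by lintac.
    by eqsw => a c; rewrite !scalerA mulrC.
  rewrite (swA (F := fun a c d => (f a : k) *: ((g (hvec i * d) : k) *: c)));
    last by lintac.
  eqsw => a b; rewrite (linZ _ _ (hR' i)) /R'.
  by rewrite [RHS](sw_lin _ _ (L := fun u : H => (f a : k) *: u)); last by lintac.
transitivity (trl Phi : k^o).
  rewrite /trint !trlE.
  under eq_sw do rewrite scaler_sumr.
  rewrite sw_sum; apply: eq_bigr => i _.
  rewrite [RHS](sw_lin _ _ (lin_hcoord i)).
  by eqsw => a b; rewrite (linZ _ _ (lin_hcoord i)).
rewrite (eq_trl PhiE) trl_sum.
under eq_bigr => i _.
  rewrite (trl_comm (A := fun u => R' i (A u)) (B := R i)) //; last by lintac.
over.
rewrite -[RHS]trlZ -trl_sum; apply: eq_trl => z.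
set h := A z; rewrite -(sw_counitr (f := fun u : H => (g 1 : k) *: u)); last by lintac.
transitivity (sw (fun a b => sw (fun c d => (g (S d * b) : k) *: c) a) h).
  transitivity (\sum_i sw (fun a b => (g (hvec i * b) : k) *: R i a) h).
    apply: eq_bigr => i _; rewrite [X in R i X]/R' (sw_lin _ _ (hR i)).
    by eqsw => a b; rewrite (linZ _ _ (hR i)).
  rewrite -sw_sum; eqsw => a b.
  under [RHS]eq_sw do rewrite gE scaler_suml.
  rewrite sw_sum; apply: eq_bigr => i _.
  rewrite [LHS](sw_lin _ _ (L := fun u : H => (g (hvec i * b) : k) *: u));
    last by lintac.
  by eqsw => c d; rewrite scalerA mulrC.
rewrite (swA (F := fun c d b => (g (S d * b) : k) *: c)); last by lintac.
eqsw => c w.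
by rewrite [LHS](sw_antil (f := fun u => (g u : k) *: c)); last by lintac.
Qed.

(** A right integral of the dual Hopf algebra. *)
Definition right_cointegral (l : H -> k^o) : Prop :=
  forall y, sw (fun y1 y2 => (l y1 : k) *: y2) y = (l y : k) *: 1.

Lemma trint_cointegral f : lin f -> right_cointegral (trint f).
Proof.
move=> hf y; have hl := lin_trint hf; apply: hcoord_inj => i.
rewrite (linZ _ _ (lin_hcoord i)) [LHS](sw_lin _ _ (lin_hcoord i)).
rewrite [RHS]mulrC -[RHS](trint_test y hf (lin_hcoord i)); eqsw => a b.
by rewrite (linZ _ _ (lin_hcoord i)) [LHS]mulrC.
Qed.

(** Expanded in coordinates, the left side is the sum over l of f(c) times the l-th coordinate of S
    (d S b) y, where c, d, b are the Sweedler components of [hvec l]; d S b collapses and f y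
    remains. *)
Lemma trint_span (f : H -> k^o) (y : H) : lin f ->
  \sum_i trint (fun h => sw (fun a b => (f a : k) *: hcoord i b) h) (S (hvec i) * y)
    = f y.
Proof.
move=> hf.
pose Q l (d b : H) : k^o := hcoord l (S (d * S b) * y).
pose G i j u : k^o := sw (fun c w => sw (fun d b =>
  (f c : k) *: ((hcoord i d : k) *: hcoord j b)) w) u.
have QE l d b : Q l d b =
    \sum_i \sum_j (hcoord i d : k) *: ((hcoord j b : k) *: Q l (hvec i) (hvec j)).
  rewrite (lin_hcoordE (f := fun d => Q l d b)); last by rewrite /Q; lintac.
  apply: eq_bigr => i _; rewrite -scaler_sumr; congr (_ *: _).
  by rewrite (lin_hcoordE (f := Q l (hvec i))) //; rewrite /Q; lintac.
have GE i j u : hcoord j (lact (fun h => sw (fun a b => (f a : k) *: hcoord i b) h) u)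
    = G i j u.
  rewrite [LHS](sw_lin _ _ (lin_hcoord j)) /G.
  rewrite -(swA (F := fun c d b => (f c : k) *: ((hcoord i d : k) *: hcoord j b)));
    last by lintac.
  eqsw => a b; rewrite (linZ _ _ (lin_hcoord j)) [LHS]mulrC.
  rewrite [LHS](sw_lin _ _ (L := fun z : k^o => (hcoord j b : k) *: z)); last by lintac.
  by eqsw => c d; rewrite [RHS]mulrA [LHS]mulrC.
transitivity (\sum_l (f (hvec l) : k) *: hcoord l y); last first.
  by rewrite [RHS](lin_hcoordE _ hf); apply: eq_bigr => l _; apply: mulrC.
transitivity (\sum_l sw (fun c w => sw (fun d b =>
   (f c : k) *: Q l d b) w) (hvec l)); last first.
  apply: eq_bigr => l _.
  rewrite -[RHS](sw_counitr (f := fun c => (f c : k) *: hcoord l y)); last by lintac.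
  eqsw => c w.
  rewrite [LHS](sw_antir (f := fun z => (f c : k) *: hcoord l (S z * y)));
    last by lintac.
  by rewrite antipode1 mul1r.
transitivity (\sum_l \sum_i \sum_j (Q l (hvec i) (hvec j) : k) *: G i j (hvec l));
    last first.
  apply: eq_bigr => l _.
  transitivity (\sum_i \sum_j sw (fun c w => sw (fun d b => (f c : k) *:
     ((hcoord i d : k) *: ((hcoord j b : k) *: Q l (hvec i) (hvec j)))) w) (hvec l)).
    apply: eq_bigr => i _; apply: eq_bigr => j _.
    rewrite [LHS](sw_lin _ _ (L := fun z : k^o => (Q l (hvec i) (hvec j) : k) *: z));
      last by lintac.
    eqsw => c w.
    rewrite [LHS](sw_lin _ _ (L := fun z : k^o => (Q l (hvec i) (hvec j) : k) *: z));
      last by lintac.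
    by eqsw => d b; rewrite !scalerA [RHS]mulrC -[LHS]/(_ * _ : k) !mulrA.
  under eq_bigr do rewrite -sw_sum; rewrite -sw_sum; eqsw => c w.
  under eq_bigr do rewrite -sw_sum; rewrite -sw_sum; eqsw => d b.
  under eq_bigr do rewrite -scaler_sumr; rewrite -scaler_sumr.
  by rewrite [in RHS]QE.
rewrite [RHS]exchange_big; apply: eq_bigr => i _.
rewrite [RHS]exchange_big; apply: eq_bigr => j _.
rewrite -[LHS]/(hcoord j (lact _ _)) GE (lin_hcoordE (f := G i j)); last by rewrite /G; lintac.
by apply: eq_bigr => l _; rewrite /Q antipodeM mulrA.
Qed.

(** In [trint_span] with f the counit and y = 1 the total is 1, so some summand is nonzero. *)
Lemma exists_right_cointegral : exists l : H -> k^o,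
  [/\ lin l, right_cointegral l & exists y, l y != 0].
Proof.
pose f i (h : H) := sw (fun a b => (eps a : k) *: hcoord i b) h.
have hf i : lin (f i) by rewrite /f; lintac.
case: (pickP (fun i => trint (f i) (S (hvec i) * 1) != 0)) => [i ne|all0].
  exists (trint (f i)); split; [exact: lin_trint|exact: trint_cointegral|].
  by exists (S (hvec i) * 1).
have he : lin eps by lintac.
have e := trint_span 1 he; case/eqP: (oner_neq0 k); rewrite -(counit1 H) -e.
by apply: big1 => i _; apply/eqP; move/negbT: (all0 i); rewrite negbK.
Qed.

End Cointegral.

Section Form.
Variables (k : fieldType) (V : vectType k) (B : V -> V -> k^o).
Hypothesis linB : bilin B.

Let gram : 'M[k]_(dim V) := \matrix_(i, j) B (basis_vec i) (basis_vec j).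

Let gramE u v : B u v = (v2r u *m gram *m (v2r v)^T) 0 0 :> k.
Proof.
case: linB => Bl Br; rewrite [LHS](lin_basisE (f := B u)) //.
rewrite mxE; apply: eq_bigr => j _; rewrite mxE [LHS]mulrC; congr (_ * _).
  rewrite [LHS](lin_basisE (f := B^~ (basis_vec j))) //; apply: eq_bigr => i _.
  by rewrite mxE.
by rewrite mxE.
Qed.

(** The Gram matrix is square, so a trivial left radical already makes it invertible. *)
Lemma nondegenerate_flip : (forall u, (forall v, B u v = 0) -> u = 0) ->
  (forall f : V -> k^o, lin f -> exists v, forall u, B u v = f u) /\
  (forall v, (forall u, B u v = 0) -> v = 0).
Proof.
move=> nd; have Gu : gram \in unitmx.
  rewrite -row_free_unit -kermx_eq0; apply/eqP/row_matrixP => i.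
  rewrite row0; set r := row i _; have rG : r *m gram = 0.
    by rewrite -row_mul mulmx_ker row0.
  rewrite -[r]r2vK (nd (r2v r)) ?linear0 // => v.
  by rewrite gramE r2vK rG mul0mx mxE.
split=> [f hf|v Bv0].
  pose c : 'cV[k]_(dim V) := invmx gram *m \col_i f (basis_vec i).
  exists (r2v c^T) => u; rewrite [LHS]gramE r2vK trmxK -mulmxA mulKVmx //.
  rewrite mxE [RHS](lin_basisE _ hf); apply: eq_bigr => i _.
  by rewrite mxE.
have G0 : gram *m (v2r v)^T = 0.
  apply/matrixP => i j; rewrite ord1 [RHS]mxE.
  have := gramE (r2v (delta_mx 0 i)) v; rewrite r2vK Bv0 -mulmxA -rowE.
  by rewrite [RHS]mxE => <-.
by rewrite -[v]v2rK -[v2r v]trmxK -[X in X^T](mulKmx Gu) G0 mulmx0 trmx0 linear0.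
Qed.

End Form.

(** * Nondegeneracy of a cointegral and bijectivity of the antipode *)

Section Cointegral.
Variables (k : fieldType) (H : hopfAlgType k).
Local Notation S := (@antipode k H).
Local Notation eps := (@counit k H).

Section Antipode.
Variable l : H -> k^o.
Hypotheses (hl : lin l) (il : right_cointegral l) (l0 : exists y, l y != 0).

(** Invariance of l at the product S h2 y, multiplied by h1 on the left; the factor h1 S h2 created
    in this way cancels. *)
Lemma cointegral_antipode (h y : H) :
  sw (fun y1 y2 => (l (S h * y1) : k) *: y2) y =
  sw (fun a b => (l (S b * y) : k) *: a) h.
Proof.
transitivity (sw (fun a w => sw (fun c d => sw (fun y1 y2 =>
   (l (S d * y1) : k) *: (a * S c * y2)) y) w) h); last first.
  eqsw => a w; rewrite -[X in _ = _ *: X]mulr1 scalerAr -il.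
  rewrite [RHS](sw_lin _ _ (L := fun z => a * z)); last by lintac.
  rewrite swM; last by lintac.
  rewrite sw_antipode; last by lintac.
  eqsw => c d; eqsw => y1 y2; rewrite -scalerAr mulrA //.
rewrite -(swA (F := fun a c d => sw (fun y1 y2 =>
   (l (S d * y1) : k) *: (a * S c * y2)) y)); last by lintac.
rewrite -[LHS](sw_counitl (f := fun h => sw (fun y1 y2 =>
   (l (S h * y1) : k) *: y2) y)); last by lintac.
eqsw => x d.
rewrite [RHS](sw_antir (f := fun z => sw (fun y1 y2 =>
   (l (S d * y1) : k) *: (z * y2)) y)); last by lintac.
by congr (_ *: _); eqsw => y1 y2; rewrite mul1r.
Qed.

(** eps h l y = l (S (S h1 h2) y) = l (S h2 S (S h1) y), and by [cointegral_antipode] the hypothesis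
    kills l (S h2 z) h1 for every z. *)
Let counit_ker h : (forall y, l (S h * y) = 0) -> eps h = 0 :> k.
Proof.
move=> h0; have z y : sw (fun a b => (l (S b * y) : k) *: a) h = 0.
  rewrite -cointegral_antipode.
  rewrite (_ : sw _ y = sw (fun _ _ => 0 *: 0) y); last first.
    by eqsw => a b; rewrite h0 !scale0r.
  by rewrite -(sw_lin (L := fun u : H => 0 *: u)) ?scale0r //; lintac.
have [y ly] := l0; apply: (mulIf ly); rewrite mul0r.
transitivity (\sum_i
  hcoord i (S (S (sw (fun a b => (l (S b * hvec i) : k) *: a) h)) * y) : k).
  have e : sw (fun a b => l (S (S a * b) * y)) h = (eps h : k) *: l y.
    rewrite [LHS](sw_antil h (f := fun u => l (S u * y))); last by lintac.
    by rewrite antipode1 mul1r.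
  rewrite -[LHS]e.
  transitivity (\sum_i sw (fun a b => (hcoord i (S (S a) * y) : k) *: l (S b * hvec i)) h).
    rewrite -sw_sum; eqsw => a b; rewrite antipodeM -mulrA.
    by rewrite [LHS](lin_hcoordE (f := fun u => l (S b * u))); last by lintac.
  apply: eq_bigr => i _.
  rewrite [RHS](sw_lin _ _ (L := fun u => hcoord i (S (S u) * y))); last by lintac.
  eqsw => a b; rewrite !linearZ -scalerAl (linZ _ _ (lin_hcoord i)).
  exact: mulrC.
by apply: big1 => i _; rewrite z !linear0 mul0r (lin0 (lin_hcoord i)).
Qed.

(** The elements satisfying the hypothesis form a space stable under h |-> phi(h1) h2 for every
    functional phi. The counit of this image is phi(h), so [counit_ker] kills every coordinate of
    h. *)
Lemma cointegral_nondeg (h : H) : (forall y, l (S h * y) = 0) -> h = 0.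
Proof.
move=> h0; apply: hcoord_inj => i; rewrite (lin0 (lin_hcoord i)).
have <- : eps (sw (fun a b => (hcoord i a : k) *: b) h) = hcoord i h.
  rewrite (sw_lin _ _ (L := eps)); last by lintac.
  rewrite -[RHS](sw_counitr (f := hcoord i)) //; eqsw => a b.
  by rewrite linearZ; apply: mulrC.
apply: counit_ker => y.
rewrite [LHS](sw_lin _ _ (L := fun u => l (S u * y))); last by lintac.
transitivity (hcoord i (sw (fun a b => (l (S b * y) : k) *: a) h)).
  rewrite [RHS](sw_lin _ _ (lin_hcoord i)); eqsw => a b.
  by rewrite linearZ -scalerAl (linZ _ _ hl) (linZ _ _ (lin_hcoord i)); apply: mulrC.
rewrite -cointegral_antipode.
rewrite [X in hcoord i X](_ : _ = sw (fun _ _ => 0 *: 0) y); last first.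
  by eqsw => a b; rewrite h0 !scale0r.
by rewrite -(sw_lin (L := fun u : H => 0 *: u)) ?scale0r ?(lin0 (lin_hcoord i)) //; lintac.
Qed.

End Antipode.

(** If S h = 0 then l (S h y) = 0 for all y, so nondegeneracy gives injectivity, and the dimension
    is finite. *)
Lemma antipode_bij : exists T : {linear H -> H}, cancel S T /\ cancel T S.
Proof.
have [l [hl il l0]] := exists_right_cointegral H.
have inj h : S h = 0 -> h = 0.
  by move=> h0; apply: (cointegral_nondeg hl il l0) => y; rewrite h0 mul0r lin0.
have k0 : lker (linfun S) == 0%VS.
  apply/eqP/vspaceP => h; rewrite memv_ker memv0 lfunE /=.
  by apply/eqP/eqP => [/inj //|->]; rewrite linear0.
exists (linfun S)^-1%VF; split=> h.
  by have := lker0_lfunK k0 h; rewrite lfunE.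
by have := lker0_lfunVK k0 h; rewrite lfunE.
Qed.

End Cointegral.

(** L represents the counit for the form l (u v); it is then a left integral with l L = 1. Both
    radicals appear, so that equalities can be tested against l on either side. *)
Definition frobenius_pair (k : fieldType) (H : hopfAlgType k)
    (l : H -> k^o) (L : H) : Prop :=
  [/\ lin l, right_cointegral l, forall u, (forall v, l (u * v) = 0) -> u = 0,
      forall v, (forall u, l (u * v) = 0) -> v = 0
    & forall y, l (y * L) = counit y].

Section Frobenius.
Variables (k : fieldType) (H : hopfAlgType k).
Local Notation S := (@antipode k H).
Local Notation eps := (@counit k H).

Lemma exists_frobenius_pair : exists (l : H -> k^o) (L : H), frobenius_pair l L.
Proof.
have [l [hl il l0]] := exists_right_cointegral H.
have [T [ST TS]] := antipode_bij H.
have nd u : (forall v, l (u * v) = 0) -> u = 0.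
  move=> z; rewrite -[u]TS (cointegral_nondeg hl il l0 (h := T u)) ?linear0 //.
  by move=> y; rewrite TS.
have [ex nd'] : _ /\ _ := nondegenerate_flip (B := fun u v => l (u * v))
   (ltac:(lintac)) nd.
have [|L hL] := ex eps; first by lintac.
by exists l, L.
Qed.

Variables (l : H -> k^o) (L : H).
Hypothesis lL : frobenius_pair l L.

Let hl : lin l. Proof. by case: lL. Qed.
Let il : right_cointegral l. Proof. by case: lL. Qed.
Let ndl u : (forall v, l (u * v) = 0) -> u = 0. Proof. by case: lL => ? ? h ? ?; exact: h. Qed.
Let ndr v : (forall u, l (u * v) = 0) -> v = 0. Proof. by case: lL => ? ? ? h ?; exact: h. Qed.
Let lyL y : l (y * L) = eps y. Proof. by case: lL. Qed.
Let lL1 : l L = 1. Proof. by rewrite -[L]mul1r lyL counit1. Qed.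

Lemma frobenius_injl u v : (forall y, l (u * y) = l (v * y)) -> u = v.
Proof.
move=> e; apply/eqP; rewrite -subr_eq0; apply/eqP/ndl => y.
by rewrite mulrBl linB // e subrr.
Qed.

Lemma frobenius_injr u v : (forall y, l (y * u) = l (y * v)) -> u = v.
Proof.
move=> e; apply/eqP; rewrite -subr_eq0; apply/eqP/ndr => y.
by rewrite mulrBr linB // e subrr.
Qed.

Lemma frobenius_integral : left_integral L.
Proof.
move=> y; apply: frobenius_injr => z.
by rewrite mulrA lyL -scalerAr linZ // lyL counitM mulrC.
Qed.

(** Invariance of m at a b1, multiplied by S b2 on the right: in a2 b2 S b3 the last two factors
    cancel. *)
Lemma cointegral_shift (m : H -> k^o) (a b : H) : lin m -> right_cointegral m ->
  sw (fun a1 a2 => (m (a1 * b) : k) *: a2) a =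
  sw (fun b1 b2 => (m (a * b1) : k) *: S b2) b.
Proof.
move=> hm im.
transitivity (sw (fun x b3 => sw (fun b1 b2 => sw (fun a1 a2 =>
   (m (a1 * b1) : k) *: (a2 * b2 * S b3)) a) x) b); last first.
  eqsw => x b3; rewrite -[X in _ = _ *: X]mul1r scalerAl -im.
  rewrite [RHS](sw_lin _ _ (L := fun z => z * S b3)); last by lintac.
  rewrite swM; last by lintac.
  by rewrite [RHS]sw_exch; eqsw => b1 b2; eqsw => a1 a2; rewrite -scalerAl.
rewrite (swA (F := fun b1 b2 b3 => sw (fun a1 a2 =>
   (m (a1 * b1) : k) *: (a2 * b2 * S b3)) a)); last by lintac.
rewrite -[LHS](sw_counitr (f := fun b => sw (fun a1 a2 =>
   (m (a1 * b) : k) *: a2) a)); last by lintac.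
eqsw => b1 w.
transitivity (sw (fun b2 b3 => sw (fun a1 a2 =>
   (m (a1 * b1) : k) *: (a2 * (b2 * S b3))) a) w); last first.
  by eqsw => b2 b3; eqsw => a1 a2; rewrite mulrA.
rewrite [RHS](sw_antir (f := fun z => sw (fun a1 a2 =>
   (m (a1 * b1) : k) *: (a2 * z)) a)); last by lintac.
by congr (_ *: _); eqsw => a1 a2; rewrite mulr1.
Qed.

(** L1 and S L2 are dual bases for the form l (u v): this is [cointegral_shift] at b = L, where l
    (a1 L) = eps a1. *)
Lemma frobenius_expand_l (a : H) : a = sw (fun u v => (l (a * u) : k) *: S v) L.
Proof.
rewrite -cointegral_shift //.
rewrite -[LHS](sw_counitl (f := fun u => u)) //; eqsw => a1 a2.
by rewrite lyL.
Qed.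

Lemma frobenius_expand_r (a : H) : a = sw (fun u v => (l (S v * a) : k) *: u) L.
Proof.
apply: frobenius_injr => y.
rewrite [RHS](sw_lin _ _ (L := fun z => l (y * z))); last by lintac.
rewrite [y in LHS]frobenius_expand_l.
rewrite [LHS](sw_lin _ _ (L := fun z => l (z * a))); last by lintac.
eqsw => u v; rewrite -scalerAl -scalerAr !linZ //; exact: mulrC.
Qed.

Lemma trl_frobenius (F : H -> H) : lin F ->
  trl F = sw (fun u v => l (S v * F u)) L.
Proof.
move=> hF; rewrite trlE.
transitivity (\sum_i sw (fun u v =>
   (hcoord i (F u) : k) *: l (S v * hvec i)) L); last first.
  rewrite -sw_sum; eqsw => u v.
  by rewrite [RHS](lin_hcoordE (f := fun z => l (S v * z))); last by lintac.
apply: eq_bigr => i _; rewrite [hvec i in LHS]frobenius_expand_r.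
rewrite [LHS](sw_lin _ _ (L := fun z => hcoord i (F z))); last by lintac.
by eqsw => u v; rewrite (linZ _ _ hF) (linZ _ _ (lin_hcoord i)); apply: mulrC.
Qed.

(** With the dual bases given by L the trace is l (S L2 S (S L1) a) = l (S (S L1 L2) a), and S L1 L2
    is eps L. *)
Lemma trl_antipode2 (a : H) :
  trl (fun h => S (S h) * a) = (eps L : k) * l a.
Proof.
rewrite trl_frobenius; last by lintac.
transitivity (sw (fun u v => l (S (S u * v) * a)) L).
  by eqsw => u v; rewrite antipodeM mulrA.
rewrite [LHS](sw_antil (f := fun z => l (S z * a))); last by lintac.
by rewrite antipode1 mul1r.
Qed.

(** The distinguished character of H, which measures the failure of L to be a right integral. *)
Definition modular_function (h : H) : k^o := l (L * h).
Local Notation alpha := modular_function.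

(** The distinguished grouplike element, the counterpart of [modular_function] for the cointegral
    l. *)
Definition modular_element : H := sw (fun a b => (l b : k) *: a) L.
Local Notation g := modular_element.

Lemma lin_modular_function : lin alpha.
Proof. by rewrite /alpha; lintac. Qed.
Let ha := lin_modular_function.

Lemma modular_functionE h : L * h = (alpha h : k) *: L.
Proof.
apply: frobenius_injr => y; rewrite mulrA frobenius_integral -scalerAl -scalerAr.
by rewrite !linZ // lyL; apply: mulrC.
Qed.

Lemma modular_functionM a b : alpha (a * b) = alpha a * alpha b :> k.
Proof.
rewrite [LHS]/alpha mulrA modular_functionE -scalerAl linZ // modular_functionE.
Qed.

Lemma modular_function1 : alpha 1 = 1 :> k.
Proof. by rewrite /alpha mulr1. Qed.

(** [cointegral_shift] at a = 1 and b = L gives m(L) 1 = m(L1) S L2; multiplying by h and applying l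
    turns the right side into m(h), by the dual bases. *)
Lemma cointegral_uniq (m : H -> k^o) h : lin m -> right_cointegral m ->
  m h = m L * l h :> k.
Proof.
move=> hm im; have e1 : (m L : k) *: (1 : H) = sw (fun u v => (m u : k) *: S v) L.
  have := cointegral_shift 1 L hm im; rewrite sw1; last by lintac.
  by rewrite mul1r => ->; eqsw => u v; rewrite mul1r.
rewrite -[LHS]mulr1.
transitivity (l ((m L : k) *: 1 * h)); last by rewrite -scalerAl linZ // mul1r.
rewrite e1 mulr1 [h in LHS]frobenius_expand_r [LHS](sw_lin _ _ hm).
rewrite [RHS](sw_lin _ _ (L := fun z => l (z * h))); last by lintac.
eqsw => u v; rewrite -scalerAl !linZ //; exact: mulrC.
Qed.

(** For each coordinate phi the functional h |-> phi(h1) l(h2) is again a right cointegral, hence a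
    multiple of l, the factor being its value at L. *)
Lemma modular_elementE h : sw (fun a b => (l b : k) *: a) h = (l h : k) *: g.
Proof.
apply: hcoord_inj => i; pose m h := hcoord i (sw (fun a b => (l b : k) *: a) h).
have hm : lin m by rewrite /m; lintac.
rewrite -[LHS]/(m h) (linZ _ _ (lin_hcoord i)) [RHS]mulrC.
apply: (cointegral_uniq h hm) => y; apply: esym.
transitivity (sw (fun a z => sw (fun b c =>
    (hcoord i a : k) *: ((l b : k) *: c)) z) y).
  rewrite /m [LHS](sw_lin _ _ (L := fun z : H => (hcoord i z : k) *: 1));
    last by lintac.
  eqsw => a z; rewrite (linZ _ _ (lin_hcoord i)).
  rewrite -[RHS](sw_lin _ _ (L := fun u : H => (hcoord i a : k) *: u)); last by lintac.
  by rewrite [X in _ = _ *: X]il scalerA; congr (_ *: _); apply: mulrC.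
rewrite -(swA (F := fun a b c => (hcoord i a : k) *: ((l b : k) *: c))); last by lintac.
eqsw => a c; rewrite /m.
rewrite [RHS](sw_lin _ _ (L := fun z : H => (hcoord i z : k) *: c)); last by lintac.
by eqsw => u v; rewrite (linZ _ _ (lin_hcoord i)) scalerA; congr (_ *: _); apply: mulrC.
Qed.

Lemma comul_modular_element : comul g = tens g g.
Proof.
have hc' : lin (fun h : H => comul h : tensor H H) by move=> *; apply: linearP.
rewrite /g [LHS](sw_lin _ _ hc').
transitivity (sw (fun a w => sw (fun c b =>
    (l b : k) *: (tens a c : tensor H H)) w) L).
  rewrite -(swA (F := fun a c b => (l b : k) *: (tens a c : tensor H H)));
    last by lintac.
  eqsw => x b; rewrite (linZ _ _ hc') -sw_tens.
  by rewrite [LHS](sw_lin _ _ (L := fun z : tensor H H => (l b : k) *: z)); last by lintac.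
rewrite -/g [RHS](sw_lin _ _ (L := fun z : H => tens z g)); last by lintac.
eqsw => a w; rewrite (linZ _ _ (f := fun z => tens z g)); last by lintac.
have <- := linZ (f := tens a) (l w) g; last by lintac.
rewrite -modular_elementE.
rewrite [RHS](sw_lin _ _ (L := tens a)); last by lintac.
by eqsw => c b; rewrite (linZ _ _ (f := tens a)) //; lintac.
Qed.

Lemma counit_modular_element : eps g = 1 :> k.
Proof.
rewrite /g [LHS](sw_lin _ _ (L := eps)); last by lintac.
rewrite -[RHS]lL1 -[RHS](sw_counitl (f := l)) //; eqsw => a b.
by rewrite linearZ; apply: mulrC.
Qed.
End Frobenius.

Definition grouplike (k : fieldType) (H : hopfAlgType k) (g : H) : Prop :=
  comul g = tens g g /\ (counit g : k) = 1.

Section Grouplike.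
Variables (k : fieldType) (H : hopfAlgType k).
Local Notation S := (@antipode k H).
Local Notation eps := (@counit k H).

Lemma sw_grouplike (W : lmodType k) (f : H -> H -> W) (g : H) : grouplike g ->
  bilin f -> sw f g = f g g.
Proof. by case=> gg _ [f1 f2]; rewrite /sw gg tlift_tens. Qed.

Lemma grouplike_mulVr (g : H) : grouplike g -> S g * g = 1.
Proof.
move=> gg; have := sw_antil g (f := fun u => u) (lin_id (U:=H)).
rewrite sw_grouplike //; last by lintac.
by case: gg => _ ->; rewrite scale1r.
Qed.

Lemma grouplike_mulrV (g : H) : grouplike g -> g * S g = 1.
Proof.
move=> gg; have := sw_antir g (f := fun u => u) (lin_id (U:=H)).
rewrite sw_grouplike //; last by lintac.
by case: gg => _ ->; rewrite scale1r.
Qed.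

Lemma grouplike_antipode2 (g : H) : grouplike g -> S (S g) = g.
Proof.
move=> gg; rewrite -[LHS]mulr1 -(grouplike_mulVr gg) mulrA -antipodeM.
by rewrite grouplike_mulrV // antipode1 mul1r.
Qed.

Lemma grouplikeX (g : H) m : grouplike g -> grouplike (g ^+ m).
Proof.
case=> gg eg; split; last by rewrite rmorphXn /= eg expr1n.
elim: m => [|m IH]; first exact: rmorph1.
by rewrite !exprS rmorphM /= IH gg [LHS]tmul_tens.
Qed.

End Grouplike.

(** * Radford's formula *)

Section Radford.
Variables (k : fieldType) (H : hopfAlgType k).
Local Notation S := (@antipode k H).
Local Notation eps := (@counit k H).
Variables (l : H -> k^o) (L : H) (T : {linear H -> H}).
Hypotheses (lL : frobenius_pair l L) (ST : cancel S T) (TS : cancel T S).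
Local Notation alpha := (modular_function l L).
Local Notation g := (modular_element l L).

Let hl : lin l. Proof. by case: lL. Qed.
Let ha : lin alpha. Proof. exact: lin_modular_function. Qed.
Let lyL y : l (y * L) = eps y. Proof. by case: lL. Qed.

Let gg : grouplike g.
Proof. by split; [apply: comul_modular_element | apply: counit_modular_element]. Qed.

Lemma sw_antipodeV (W : lmodType k) (f : H -> W) h : lin f ->
  sw (fun a b => f (b * T a)) h = (eps h : k) *: f 1.
Proof.
move=> hf; have T1 : T 1 = 1 by rewrite -[1 in LHS](antipode1 H) ST.
rewrite -[X in f X]T1 -[RHS](sw_antir (f := fun z => f (T z))); last by lintac.
by eqsw => a b; rewrite -[b * _]ST antipodeM TS.
Qed.

Lemma antipodeVM a b : T (a * b) = T b * T a.
Proof. by rewrite -[a in LHS]TS -[b in LHS]TS -antipodeM ST. Qed.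

(** The companion of [cointegral_shift] in the other leg, where l is invariant only up to g and the
    excess factor is cancelled by T instead of S. *)
Lemma cointegral_shiftV (a b : H) :
  sw (fun a1 a2 => (l (a2 * b) : k) *: a1) a =
  sw (fun b1 b2 => (l (a * b2) : k) *: (g * T b1)) b.
Proof.
transitivity (sw (fun b1 w => sw (fun c d => sw (fun a1 a2 =>
   (l (a2 * d) : k) *: (a1 * c * T b1)) a) w) b); last first.
  eqsw => b1 w; rewrite scalerAl -(modular_elementE lL).
  rewrite [RHS](sw_lin _ _ (L := fun z => z * T b1)); last by lintac.
  rewrite swM; last by lintac.
  by rewrite [RHS]sw_exch; eqsw => c d; eqsw => a1 a2; rewrite -scalerAl.
rewrite -(swA (F := fun b1 c d => sw (fun a1 a2 =>
   (l (a2 * d) : k) *: (a1 * c * T b1)) a)); last by lintac.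
rewrite -[LHS](sw_counitl (f := fun b => sw (fun a1 a2 =>
   (l (a2 * b) : k) *: a1) a)); last by lintac.
eqsw => x d.
transitivity (sw (fun b1 c => sw (fun a1 a2 =>
   (l (a2 * d) : k) *: (a1 * (c * T b1))) a) x); last first.
  by eqsw => b1 c; eqsw => a1 a2; rewrite mulrA.
rewrite [RHS](sw_antipodeV (f := fun z => sw (fun a1 a2 =>
   (l (a2 * d) : k) *: (a1 * z)) a)); last by lintac.
by congr (_ *: _); eqsw => a1 a2; rewrite mulr1.
Qed.

(** A second pair of dual bases, L2 and g T L1; comparing it with the first pair yields Radford's
    formula. *)
Lemma frobenius_expandV_l (a : H) :
  a = sw (fun u v => (l (a * v) : k) *: (g * T u)) L.
Proof.
rewrite -cointegral_shiftV.
rewrite -[LHS](sw_counitr (f := fun u => u)) //; eqsw => a1 a2.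
by rewrite lyL.
Qed.

Lemma frobenius_expandV_r (a : H) :
  a = sw (fun u v => (l (g * T u * a) : k) *: v) L.
Proof.
apply: (frobenius_injr lL) => y.
rewrite [RHS](sw_lin _ _ (L := fun z => l (y * z))); last by lintac.
rewrite [y in LHS]frobenius_expandV_l.
rewrite [LHS](sw_lin _ _ (L := fun z => l (z * a))); last by lintac.
eqsw => u v; rewrite -scalerAl -scalerAr !linZ //; exact: mulrC.
Qed.

(** Since L h is alpha(h) L, and in L2 h2 S h3 the last two factors cancel, a right multiplication
    moves from the first leg of L to the second at the price of alpha. *)
Lemma integral_mulr_l (W : lmodType k) (F : H -> H -> W) h : bilin F ->
  sw (fun u v => F (u * h) v) L =
  sw (fun a b => (alpha a : k) *: sw (fun u v => F u (v * S b)) L) h.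
Proof.
case=> F1 F2.
transitivity (sw (fun a b => sw (fun c d => sw (fun u v =>
   F (u * c) (v * (d * S b))) L) a) h); last first.
  eqsw => a b.
  rewrite -(linZ (f := sw (fun u v => F u (v * S b)))); last exact: lin_sw_arg (lin_id (U := H)).
  rewrite -(modular_functionE lL).
  rewrite swM; last by lintac.
  by rewrite [RHS]sw_exch; eqsw => c d; eqsw => u v; rewrite mulrA.
rewrite (swA (F := fun c d b => sw (fun u v =>
   F (u * c) (v * (d * S b))) L)); last by lintac.
rewrite -[LHS](sw_counitr (f := fun h => sw (fun u v => F (u * h) v) L));
  last by lintac.
eqsw => c w.
rewrite [RHS](sw_antir (f := fun z => sw (fun u v => F (u * c) (v * z)) L));
  last by lintac.
by congr (_ *: _); eqsw => u v; rewrite mulr1.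
Qed.

Lemma integral_mulr_r (W : lmodType k) (F : H -> H -> W) h : bilin F ->
  sw (fun u v => F u (v * h)) L =
  sw (fun a b => (alpha b : k) *: sw (fun u v => F (u * T a) v) L) h.
Proof.
case=> F1 F2.
transitivity (sw (fun a b => sw (fun c d => sw (fun u v =>
   F (u * (c * T a)) (v * d)) L) b) h); last first.
  eqsw => a b.
  rewrite -(linZ (f := sw (fun u v => F (u * T a) v)));
    last exact: lin_sw_arg (lin_id (U := H)).
  rewrite -(modular_functionE lL).
  rewrite swM; last by lintac.
  by rewrite [RHS]sw_exch; eqsw => c d; eqsw => u v; rewrite mulrA.
rewrite -(swA (F := fun a c d => sw (fun u v =>
   F (u * (c * T a)) (v * d)) L)); last by lintac.
rewrite -[LHS](sw_counitl (f := fun h => sw (fun u v => F u (v * h)) L));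
  last by lintac.
eqsw => w d.
rewrite [RHS](sw_antipodeV (f := fun z => sw (fun u v => F (u * z) (v * d)) L));
  last by lintac.
by congr (_ *: _); eqsw => u v; rewrite mulr1.
Qed.

(** The Nakayama automorphism N of l, characterized by l (w h) = l (N h w), read off from the dual
    bases L1 and S L2. *)
Lemma nakayama_l w h :
  l (w * h) = l (sw (fun a b => (alpha a : k) *: S (S b)) h * w) :> k.
Proof.
rewrite [w in LHS](frobenius_expand_r lL).
rewrite [LHS](sw_lin _ _ (L := fun z => l (z * h))); last by lintac.
transitivity (sw (fun u v => (l (u * h) : k) *: l (S v * w)) L).
  by eqsw => u v; rewrite -scalerAl linZ //; apply: mulrC.
rewrite (integral_mulr_l (F := fun u v => (l u : k) *: l (S v * w)));
  last by lintac.
rewrite [RHS](sw_lin _ _ (L := fun z => l (z * w))); last by lintac.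
eqsw => a b; rewrite -scalerAl linZ //; congr (_ *: _).
rewrite -[S (S b)]mulr1 [1 in RHS](frobenius_expand_l lL).
rewrite [RHS](sw_lin _ _ (L := fun z => l (S (S b) * z * w))); last by lintac.
by eqsw => u v; rewrite mul1r -scalerAr -scalerAl linZ // antipodeM.
Qed.

(** The same automorphism, from the dual bases L2 and g T L1. *)
Lemma nakayama_r w h :
  l (w * h) = l (sw (fun a b => (alpha b : k) *: (g * T (T a) * S g)) h * w) :> k.
Proof.
rewrite [w in LHS]frobenius_expandV_r.
rewrite [LHS](sw_lin _ _ (L := fun z => l (z * h))); last by lintac.
transitivity (sw (fun u v => (l (v * h) : k) *: l (g * T u * w)) L).
  by eqsw => u v; rewrite -scalerAl linZ //; apply: mulrC.
rewrite (integral_mulr_r (F := fun u v => (l v : k) *: l (g * T u * w)));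
  last by lintac.
rewrite [RHS](sw_lin _ _ (L := fun z => l (z * w))); last by lintac.
eqsw => a b; rewrite -scalerAl linZ //; congr (_ *: _).
rewrite -[_ * S g]mulr1 [1 in RHS]frobenius_expandV_l.
rewrite [RHS](sw_lin _ _ (L := fun z => l (g * T (T a) * S g * z * w)));
  last by lintac.
eqsw => u v; rewrite mul1r -scalerAr -scalerAl linZ // antipodeVM !mulrA.
by rewrite -(mulrA _ (S g) g) grouplike_mulVr // mulr1.
Qed.

(* Radford's formula, from the two computations of the Nakayama automorphism. *)
Lemma radford h : sw (fun a b => (alpha a : k) *: S (S (S (S b)))) h =
  g * sw (fun a b => (alpha b : k) *: a) h * S g.
Proof.
have e : sw (fun a b => (alpha a : k) *: S (S b)) h =
    sw (fun a b => (alpha b : k) *: (g * T (T a) * S g)) h.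
  by apply: (frobenius_injl lL) => w; rewrite -nakayama_l -nakayama_r.
rewrite [RHS](sw_lin _ _ (L := fun z : H => g * z * S g)); last by lintac.
transitivity (S (S (sw (fun a b => (alpha a : k) *: S (S b)) h))).
  rewrite [RHS](sw_lin _ _ (L := fun z : H => S (S z))); last by lintac.
  by eqsw => a b; rewrite !linearZ.
rewrite e [LHS](sw_lin _ _ (L := fun z : H => S (S z))); last by lintac.
eqsw => a b; rewrite !linearZ /= -scalerAr -scalerAl; congr (_ *: _).
by rewrite !antipodeM !TS (grouplike_antipode2 gg).
Qed.

End Radford.

Lemma lin_hom (k : fieldType) (U V : vectType k) (f : U -> V) : lin f ->
  exists F : 'Hom(U, V), forall u, F u = f u.
Proof.
move=> hf; pose fL := GRing.isLinear.Build _ _ _ _ f (lin_linear hf).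
by exists (linfun (HB.pack f fL : {linear U -> V})) => u; rewrite lfunE.
Qed.

(** * Semisimplicity from complements of left ideals *)

Section Semisimple.
Variables (k : fieldType) (A : falgType k).

Lemma left_idealP (I : {vspace A}) :
  left_ideal I <-> forall a b, b \in I -> a * b \in I.
Proof.
split=> [/prodvP h a b bI|h]; first by apply: h; rewrite ?memvf.
by apply/prodvP => a b _; apply: h.
Qed.

Lemma left_idealI (I J : {vspace A}) :
  left_ideal I -> left_ideal J -> left_ideal (I :&: J)%VS.
Proof.
move=> /left_idealP hI /left_idealP hJ; apply/left_idealP => a b.
by rewrite !memv_cap => /andP[bI bJ]; rewrite hI // hJ.
Qed.

Lemma exists_minimal_left_ideal (I : {vspace A}) : left_ideal I -> I <> 0%VS ->
  exists M, minimal_left_ideal M /\ (M <= I)%VS.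
Proof.
have [n] := ubnP (\dim I); elim: n I => // n IH I /ltnSE dI hI I0.
have [[J [hJ JI J0 nJI]]|no] := classic (exists J : {vspace A},
  [/\ left_ideal J, (J <= I)%VS, J <> 0%VS & J <> I]).
  have dJ : (\dim J < n)%N.
    apply: leq_trans dI; rewrite ltn_neqAle dimvS // andbT.
    by apply/eqP => e; apply: nJI; apply/eqP; rewrite eqEdim JI e leqnn.
  have [M [mM MJ]] := IH J dJ hJ J0.
  by exists M; split=> //; apply: subv_trans JI.
exists I; split=> //; split=> // J hJ JI.
have [J0|J0] := classic (J = 0%VS); first by left.
by right; apply: NNPP => JnI; apply: no; exists J.
Qed.

(** Induction on the dimension of a left ideal I: a minimal left ideal M inside I has a complement J
    in A, and by the modular law the intersection of I and J is a complement of M in I. *)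
Lemma semisimple_of_complements :
  (forall I : {vspace A}, left_ideal I -> exists J : {vspace A},
     [/\ left_ideal J, (I :&: J)%VS = 0%VS & (I + J)%VS = fullv]) ->
  semisimple_algebra A.
Proof.
move=> compl.
suff ss (I : {vspace A}) : left_ideal I ->
    exists (m : nat) (L : 'I_m -> {vspace A}),
    [/\ forall i, minimal_left_ideal (L i),
        directv (\sum_i L i) & (\sum_i L i)%VS = I].
  by apply: (ss fullv); apply/left_idealP => *; apply: memvf.
have [n] := ubnP (\dim I); elim: n I => // n IH I /ltnSE dI hI.
have [I0|I0] := classic (I = 0%VS).
  exists 0%N, (fun=> 0%VS); split; first by case.
    by rewrite directvE /= !big_ord0 dimv0.
  by rewrite big_ord0 I0.
have [M [mM MI]] := exists_minimal_left_ideal hI I0.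
have [hM M0 _] := mM; have [J [hJ MJ MJf]] := compl M hM.
have hIJ := left_idealI hI hJ.
have IE : (M + (I :&: J))%VS = I.
  apply/eqP; rewrite eqEsubv; apply/andP; split.
    by rewrite subv_add MI capvSl.
  apply/subvP => v vI.
  have : v \in (M + J)%VS by rewrite MJf memvf.
  case/memv_addP=> a aM [b bJ vE]; apply/memv_addP; exists a => //.
  exists b => //; rewrite memv_cap bJ andbT.
  have -> : b = v - a by rewrite vE addrC addKr.
  by rewrite rpredB // (subvP MI).
have cap0 : (M :&: (I :&: J))%VS = 0%VS.
  apply/eqP; rewrite -subv0 -MJ; apply/subvP => v.
  by rewrite !memv_cap => /and3P[-> _ ->].
have dS : \dim I = (\dim M + \dim (I :&: J))%N.
  by rewrite -{1}IE dimv_disjoint_sum.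
have dM : (0 < \dim M)%N by rewrite lt0n dimv_eq0; apply/eqP.
have dIJ : (\dim (I :&: J) < n)%N.
  by apply: leq_trans dI; rewrite dS -add1n leq_add2r.
have [m [L [mL dL LE]]] := IH (I :&: J)%VS dIJ hIJ.
pose L' (i : 'I_m.+1) := if unlift ord0 i is Some j then L j else M.
exists m.+1, L'; split.
- by move=> i; rewrite /L'; case: unliftP.
- rewrite directvE /= !big_ord_recl /L' unlift_none.
  under eq_bigr do rewrite liftK.
  under [X in (_ == _ + X)%N]eq_bigr do rewrite liftK.
  rewrite LE IE dS; apply/eqP; congr (_ + _)%N.
  by move: dL; rewrite directvE /= LE => /eqP.
- rewrite big_ord_recl /L' unlift_none; under eq_bigr do rewrite liftK.
  by rewrite LE IE.
Qed.

End Semisimple.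

(** * Maschke's theorem *)

Section Maschke.
Variables (k : fieldType) (H : hopfAlgType k).
Local Notation S := (@antipode k H).
Local Notation eps := (@counit k H).

(** Both sides equal S h1 h2 L1 (x) h3 L2: on the left S h1 h2 cancels, on the right the second and
    third components of h act on comul L by the counit. *)
Lemma integral_shift (W : lmodType k) (F : H -> H -> W) (L h : H) : bilin F ->
  left_integral L ->
  sw (fun u v => F u (h * v)) L = sw (fun u v => F (S h * u) v) L.
Proof.
case=> F1 F2 iL.
transitivity (sw (fun a w => sw (fun b c => sw (fun u v =>
   F (S a * b * u) (c * v)) L) w) h); last first.
  rewrite -[RHS](sw_counitr (f := fun h => sw (fun u v => F (S h * u) v) L));
    last by lintac.
  eqsw => a w.
  rewrite -(linZ (f := sw (fun u v => F (S a * u) v)));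
    last exact: lin_sw_arg (lin_id (U := H)).
  rewrite -iL swM; last by lintac.
  by eqsw => b c; eqsw => u v; rewrite mulrA.
rewrite -(swA (F := fun a b c => sw (fun u v =>
   F (S a * b * u) (c * v)) L)); last by lintac.
rewrite -[LHS](sw_counitl (f := fun h => sw (fun u v => F u (h * v)) L));
  last by lintac.
eqsw => x c.
rewrite [RHS](sw_antil (f := fun z => sw (fun u v => F (z * u) (c * v)) L));
  last by lintac.
by congr (_ *: _); eqsw => u v; rewrite mul1r.
Qed.

(** A linear projection q onto I, averaged by the integral to pi h = L1 q (S L2 h), becomes H-linear
    with values in I and acts on I as the scalar eps L; its kernel is the complement sought. *)
Lemma maschke (L : H) : left_integral L -> (eps L : k) != 0 ->
  semisimple_algebra H.
Proof.
move=> iL e0; apply: semisimple_of_complements => I hI.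
have /left_idealP hI' := hI.
have [T [ST TS]] := antipode_bij H.
pose q (h : H) : H := projv I h.
have hq : lin q by move=> c u v; apply: linearP.
have qI h : q h \in I by apply: memv_proj.
have qid h : h \in I -> q h = h by apply: projv_id.
pose pi (h : H) : H := sw (fun u v => u * q (S v * h)) L.
have hpi : lin pi by rewrite /pi; lintac.
have piI h : pi h \in I.
  rewrite /pi /sw /tlift; apply: memv_suml => i _; apply: memv_suml => j _.
  by rewrite memvZ // hI'.
have piid h : h \in I -> pi h = (eps L : k) *: h.
  move=> h_I; transitivity (sw (fun u v => u * S v * h) L).
    by rewrite /pi; eqsw => u v; rewrite qid ?mulrA // hI'.
  by rewrite [LHS](sw_antir (f := fun z => z * h)) ?mul1r //; lintac.
have piM y h : pi (y * h) = y * pi h.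
  rewrite /pi [RHS](sw_lin _ _ (L := fun z => y * z)); last by lintac.
  transitivity (sw (fun u v => u * q (S (T y * v) * h)) L).
    by eqsw => u v; rewrite antipodeM TS !mulrA.
  rewrite (integral_shift (F := fun u v => u * q (S v * h))) ?TS //; last by lintac.
  by eqsw => u v; rewrite mulrA.
have [pif pifE] := lin_hom hpi.
exists (lker pif); split.
- apply/left_idealP => a b; rewrite !memv_ker !pifE piM => /eqP ->.
  by rewrite mulr0.
- apply/eqP; rewrite -subv0; apply/subvP => v; rewrite memv_cap memv_ker pifE.
  case/andP => vI; rewrite piid // scaler_eq0 (negPf e0) memv0 //.
- apply/eqP; rewrite eqEsubv subvf; apply/subvP => v _.
  apply/memv_addP; exists ((eps L : k)^-1 *: pi v); first by rewrite memvZ.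
  exists (v - (eps L : k)^-1 *: pi v); last by rewrite addrC subrK.
  rewrite memv_ker pifE (linB _ _ hpi) (linZ _ _ hpi) (piid (pi v)) // scalerA mulVf // scale1r.
  by rewrite subrr.
Qed.

Lemma nonsemisimple_integral (L : H) : ~ semisimple_algebra H ->
  left_integral L -> eps L = 0 :> k.
Proof.
by move=> ns iL; apply/eqP/negPn/negP => e0; apply: ns; apply: maschke e0.
Qed.

End Maschke.

(** The index is a finite type rather than an ordinal, so that pairs can index a basis of the tensor
    square. *)
Definition dual_bases (k : fieldType) (V : lmodType k) (P : finType)
    (b : P -> V) (beta : P -> V -> k^o) : Prop :=
  [/\ forall p, lin (beta p), forall p q, beta p (b q) = (p == q)%:R
    & forall x, x = \sum_p (beta p x : k) *: b p].

Definition eigenbasis (k : fieldType) (V : lmodType k) (P : finType)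
    (F : V -> V) (w : P -> k) (b : P -> V) (beta : P -> V -> k^o) : Prop :=
  dual_bases b beta /\ forall p, F (b p) = w p *: b p.

(** * Weights *)

Section Count.
Variables (k : fieldType).

Lemma eigenbasis_coord (V : lmodType k) (P : finType) F (w : P -> k) (b : P -> V)
    beta p x : lin F -> eigenbasis F w b beta ->
  beta p (F x) = w p * beta p x :> k.
Proof.
move=> hF [[hb bb xE] Fb].
rewrite {1}(xE x) (lin_bigsum _ _ _ hF) (lin_bigsum _ _ _ (hb p)).
rewrite (bigD1 p) //= big1 => [|q qp].
  rewrite addr0 (linZ _ _ hF) Fb !(linZ _ _ (hb p)) bb eqxx.
  by rewrite /GRing.scale /= mulr1 mulrC.
rewrite (linZ _ _ hF) Fb !(linZ _ _ (hb p)) bb eq_sym (negPf qp).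
by rewrite /GRing.scale /= !mulr0.
Qed.

(** Psi embeds the span of the t p with a' p = v into the eigenspace of D for v. The comparison of
    dimensions is a rank bound for the matrix of Psi between the two index sets. *)
Lemma eigen_count (X : lmodType k) (P : finType) (D Psi : X -> X) (a a' : P -> k)
    (t : P -> X) tau (v : k) :
    lin D -> lin Psi -> (forall x, Psi x = 0 -> x = 0) ->
    eigenbasis D a t tau -> (forall p, D (Psi (t p)) = a' p *: Psi (t p)) ->
  (#|[pred p | a' p == v]| <= #|[pred p | a p == v]|)%N.
Proof.
move=> hD hPsi inj eb DPsi; have [[ht tt xE] _] := eb.
pose M : 'M[k]_(#|[pred p | a' p == v]|, #|[pred p | a p == v]|) :=
  \matrix_(i, j) tau (enum_val j) (Psi (t (enum_val i))).
suff : row_free M by rewrite /row_free => /eqP <-; apply: rank_leq_col.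
rewrite -kermx_eq0; apply/eqP/row_matrixP => i; rewrite row0.
set r := row i _; have rM : r *m M = 0 by rewrite -row_mul mulmx_ker row0.
pose x := \sum_i r 0 i *: t (enum_val i).
have Dx : D (Psi x) = v *: Psi x.
  rewrite /x !(lin_bigsum _ _ _ hPsi) (lin_bigsum _ _ _ hD) scaler_sumr.
  apply: eq_bigr => q _; rewrite (linZ _ _ hPsi) (linZ _ _ hD) DPsi.
  by have := enum_valP q; rewrite inE => /eqP ->; rewrite !scalerA mulrC.
have tx q : tau q (Psi x) = 0.
  have [aq|aq] := boolP (a q == v).
    have qA : q \in [pred p | a p == v] by [].
    have := congr1 (fun m : 'rV_ _ => m 0 (enum_rank_in qA q)) rM.
    rewrite mxE [RHS]mxE => e; rewrite -[RHS]e.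
    rewrite /x (lin_bigsum _ _ _ hPsi) (lin_bigsum _ _ _ (ht q)).
    apply: eq_bigr => j _; rewrite (linZ _ _ hPsi) (linZ _ _ (ht q)) [M _ _]mxE.
    by rewrite enum_rankK_in.
  have := eigenbasis_coord q (Psi x) hD eb; rewrite Dx (linZ _ _ (ht q)).
  move/eqP; rewrite -subr_eq0 -mulrBl mulf_eq0 subr_eq0 eq_sym (negPf aq) /=.
  by move/eqP.
have x0 : x = 0.
  apply: inj; rewrite (xE (Psi x)); apply: big1 => q _.
  by rewrite tx scale0r.
apply/rowP => j; rewrite [RHS]mxE.
have := congr1 (tau (enum_val j)) x0; rewrite (lin0 (ht _)) => <-.
rewrite /x (lin_bigsum _ _ _ (ht _)) (bigD1 j) //= big1 => [|q qj].
  rewrite addr0 (linZ _ _ (ht _)) tt eqxx; apply: esym; apply: mulr1.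
rewrite (linZ _ _ (ht _)) tt (inj_eq enum_val_inj) eq_sym (negPf qj).
exact: mulr0.
Qed.

Lemma tens_dual_bases (U V : vectType k) (P Q : finType) (b : P -> U) beta
    (c : Q -> V) gamma : dual_bases b beta -> dual_bases c gamma ->
  dual_bases (fun p : P * Q => tens (b p.1) (c p.2))
    (fun p => tlift (fun u v => (beta p.1 u : k) *: gamma p.2 v)).
Proof.
move=> [hb bb bE] [hc cc cE]; have bl p : bilin
    (fun u v => (beta p.1 u : k) *: gamma p.2 v) by split=> ?; lintac.
have tt p u v : tlift (fun u v => (beta p.1 u : k) *: gamma p.2 v) (tens u v)
    = (beta p.1 u : k) *: gamma p.2 v.
  by case: (bl p) => ? ?; rewrite tlift_tens.
split=> [p|p q|x].
- by lintac.
- rewrite tt bb cc -pair_eqE /= /pair_eq; do 2!case: eqP => _ /=;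
  by rewrite /GRing.scale /= ?mulr1 ?mulr0.
elim/tens_ind: x => [|s t hs ht|u v].
- apply: esym; apply: big1 => p _.
  by rewrite (lin0 (f := tlift _)) ?scale0r //; lintac.
- rewrite {1}hs {1}ht -big_split; apply: eq_bigr => p _.
  by rewrite (linD s t (f := tlift _)) ?[RHS]scalerDl //; lintac.
rewrite [u in LHS]bE (lin_bigsum _ _ _ (f := fun u => tens u v)); last by lintac.
rewrite -(pair_bigA _ (fun i j => (tlift (fun u v =>
  (beta i u : k) *: gamma j v) (tens u v) : k) *: tens (b i) (c j))) /=.
apply: eq_bigr => i _; rewrite (linZ _ _ (f := fun u => tens u v)); last by lintac.
rewrite [v in LHS]cE (lin_bigsum _ _ _ (f := tens _)); last by lintac.
rewrite scaler_sumr; apply: eq_bigr => j _.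
rewrite (linZ _ _ (f := tens _)); last by lintac.
by rewrite (tt (i, j)) scalerA.
Qed.

End Count.

Section UniformWeights.
Variables (T : eqType) (I : finType) (w : I -> T) (op d : T -> T -> T).
Hypothesis opC : commutative op.
Hypothesis opd : forall i u v, (op (w i) u == v) = (u == d v (w i)).
Hypothesis count_le : forall v, (#|I| * #|[pred i | w i == v]| <=
  #|[pred p : I * I | op (w p.1) (w p.2) == v]|)%N.

Let c v := #|[pred i | w i == v]|.

(** For a weight v of maximal multiplicity c, |I| c is at most the sum over i of the multiplicities
    of d v (w i), each at most c, so all are equal to c. The operation stays abstract to cover sums
    with differences and products with quotients. *)
Lemma uniform_weights : exists M,
  [/\ forall i, #|[pred j | w j == w i]| = M,
      (size (undup (codom w)) * M = #|I|)%N
    & forall i j, exists l, w l = d (w i) (w j)].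
Proof.
have [i0 _|I0] := pickP (fun _ : I => true); last first.
  have cI : #|I| = 0%N by apply: eq_card0 => i; have := I0 i.
  exists 0%N; split=> [i||i]; try by have := I0 i.
  by rewrite muln0 cI.
pose i1 := [arg max_(i > i0) c (w i)].
have cmax i : (c (w i) <= c (w i1))%N.
  by rewrite /i1; case: arg_maxnP => // j _; apply.
have c0 v : (forall i, w i != v) -> c v = 0%N.
  by move=> h; apply: eq_card0 => i; rewrite inE (negPf (h i)).
have cmax' v : (c v <= c (w i1))%N.
  have [/existsP[i /eqP <-]//|] := boolP [exists i, w i == v].
  by rewrite negb_exists => /forallP /c0 ->.
have pairE v : #|[pred p : I * I | op (w p.1) (w p.2) == v]| =
    (\sum_i c (d v (w i)))%N.
  rewrite -sum1_card (eq_bigl (fun p : I * I => xpredT p.1 && (op (w p.1) (w p.2) == v))) //.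
  rewrite -(pair_big_dep xpredT (fun i j => op (w i) (w j) == v) (fun _ _ => 1%N)) /=.
  apply: eq_bigr => i _; rewrite sum1_card; apply: eq_card => j.
  by rewrite [RHS]inE; apply: opd.
have max_d v i : c v = c (w i1) -> c (d v (w i)) = c (w i1).
  move=> cv; have := count_le v; rewrite -/(c v) pairE cv => le.
  have : (\sum_i (c (w i1) - c (d v (w i))) == 0)%N.
    rewrite sumnB => [|j _]; last exact: cmax'.
    by rewrite sum_nat_const subn_eq0.
  rewrite sum_nat_eq0 => /forall_inP /(_ i isT); rewrite subn_eq0 => h.
  by apply/eqP; rewrite eqn_leq cmax'.
have cpos i : (0 < c (w i))%N by apply/card_gt0P; exists i; rewrite inE.
have mem_d v i : c v = c (w i1) -> exists l, w l = d v (w i).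
  move=> cv; have : (0 < c (d v (w i)))%N by rewrite max_d ?cpos.
  by case/card_gt0P => l; rewrite inE => /eqP; exists l.
have call i : c (w i) = c (w i1).
  (* Dividing w i1 by w i gives a weight w l, and dividing w i1 by w l returns w i, which is
     therefore maximal too. *)
  have [l wl] := mem_d (w i1) i (erefl _).
  suff -> : w i = d (w i1) (w l) by apply: max_d.
  by apply/eqP; rewrite -opd opC opd wl.
exists (c (w i1)); split=> [i||i j]; [exact: call| |by apply: mem_d].
have := perm_size (perm_count_undup (codom w)); rewrite size_codom => <-.
rewrite size_flatten /shape -map_comp sumnE big_map.
rewrite (eq_big_seq (fun=> c (w i1))) ?big_const_seq ?count_predT ?iter_addn_0 1?mulnC // => v.
rewrite mem_undup => /codomP[i ->]; rewrite /= size_nseq -(call i).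
rewrite /c cardE size_filter /codom /image_mem count_map -enumT.
by apply: eq_count.
Qed.

End UniformWeights.

(** * Powers of p and diagonalization *)

Section PChar.
Variables (k : fieldType) (p : nat).
Hypothesis pk : p \in [pchar k].

Lemma pchar_pnat a : ([pchar k]).-nat (p ^ a)%N.
Proof. by rewrite pnatX pnatE ?pk ?(pcharf_prime pk). Qed.

Lemma expr_pchar_inj a : injective (fun x : k => x ^+ (p ^ a)).
Proof.
move=> x y /= e; apply/eqP; rewrite -subr_eq0; apply/eqP.
have : (x - y) ^+ (p ^ a) = 0.
  have := exprDn_pchar (x - y) y (pchar_pnat a); rewrite subrK e => /eqP.
  by rewrite -subr_eq0 opprD addrA addrAC subrr sub0r oppr_eq0 => /eqP.
by move/eqP; rewrite expf_eq0 => /andP[_ /eqP].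
Qed.

Lemma exp_XsubC_pchar a (c : k) :
  ('X - c%:P) ^+ (p ^ a) = 'X^(p ^ a) - (c ^+ (p ^ a))%:P.
Proof.
have cP : ([pchar {poly k}]).-nat (p ^ a)%N.
  by apply: sub_in_pnat (pchar_pnat a) => x _; rewrite pchar_poly.
by apply/eqP; rewrite polyC_exp eq_sym subr_eq -exprDn_pchar // subrK.
Qed.

End PChar.

Section Diagonalization.
Variables (k : closedFieldType) (p : nat).
Hypothesis pk : p \in [pchar k].

(** For q = p^a, the q-th power of the product of X - r over the distinct eigenvalues r is the
    product of the X^q - r^q. The characteristic polynomial divides it once q bounds the
    multiplicities, so A^q is killed by a polynomial with simple roots. *)
Lemma diagonalizable_exp_pchar n (A : 'M[k]_n.+1) :
  exists a, diagonalizable (A ^+ (p ^ a)).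
Proof.
have [rs Ars] := closed_field_poly_normal (char_poly A).
rewrite (eqP (char_poly_monic A)) scale1r in Ars.
have [a ha] : exists a, (size rs <= p ^ a)%N.
  by exists (size rs); apply: ltnW; apply: ltn_expl; apply: prime_gt1 (pcharf_prime pk).
exists a; set q := (p ^ a)%N in ha *.
apply/diagonalizableP; exists [seq r ^+ q | r <- undup rs].
  by rewrite map_inj_uniq ?undup_uniq //; apply: expr_pchar_inj.
apply: mxminpoly_min; rewrite big_map.
have E : (\prod_(r <- undup rs) ('X - r%:P)) ^+ q =
    \prod_(r <- undup rs) ('X^q - (r ^+ q)%:P) :> {poly k}.
  by rewrite -prodrXl; apply: eq_bigr => r _; apply: exp_XsubC_pchar.
have : char_poly A %| (\prod_(r <- undup rs) ('X - r%:P)) ^+ q.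
  rewrite {1}Ars -prodrXl -big_undup_iterop_count /=.
  elim/big_ind2: _ => // [u v u' v'|r _]; first exact: dvdp_mul.
  by apply: dvdp_exp2l; apply: leq_trans ha; apply: count_size.
case/dvdpP=> Q QE; transitivity (horner_mx A (Q * char_poly A)); last first.
  by rewrite rmorphM /= Cayley_Hamilton mulr0.
rewrite -QE E !rmorph_prod /=; apply: eq_bigr => r _.
by rewrite !rmorphB /= [horner_mx A 'X^q]rmorphXn /= !horner_mx_X !horner_mx_C.
Qed.

End Diagonalization.

Section Eigenbasis.
Variables (k : closedFieldType) (p : nat).
Hypothesis pk : p \in [pchar k].
Variables (V : vectType k).
Hypothesis V0 : (0 < dim V)%N.

Lemma matrix_model : exists (m : nat) (phi : V -> 'rV[k]_m.+1) (psi : 'rV[k]_m.+1 -> V),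
  [/\ lin phi, lin psi, cancel phi psi, cancel psi phi & m.+1 = dim V].
Proof.
have E : (dim V).-1.+1 = dim V by rewrite prednK.
exists (dim V).-1, (fun v => castmx (erefl, esym E) (v2r v)),
  (fun r => r2v (castmx (erefl, E) r)); split=> //.
- by move=> c u v; rewrite linearP; apply/matrixP => i j; rewrite !(castmxE, mxE).
- move=> c u v; rewrite -linearP; congr r2v.
  by apply/matrixP => i j; rewrite !(castmxE, mxE).
- by move=> v; rewrite [castmx _ _](castmxKV (erefl 1%N) E) v2rK.
- by move=> v; rewrite r2vK [LHS](castmxK (erefl 1%N) E).
Qed.

Lemma eigenbasis_of_diagonalizable m (phi : V -> 'rV[k]_m.+1) psi
    (F : V -> V) (A : 'M[k]_m.+1) : lin phi -> lin psi ->
    cancel phi psi -> cancel psi phi ->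
    (forall u, phi (F (psi u)) = u *m A) -> diagonalizable A ->
  exists w b beta, @eigenbasis k V 'I_m.+1 F w b beta.
Proof.
move=> hphi hpsi phiK psiK FA [P Pu /similar_diagPex[D /(similarP Pu) PA]].
exists (fun i => D 0 i), (fun i => psi (row i P)),
  (fun i v => (phi v *m invmx P) 0 i); split; last first.
  move=> i; rewrite -[LHS]phiK FA -linZ //; congr psi.
  by rewrite -row_mul PA row_mul row_diag_mx -scalemxAl -rowE.
split=> [i|i j|v].
- by move=> c u v; rewrite hphi mulmxDl -scalemxAl !mxE.
- by rewrite psiK -row_mul mulmxV // row1 mxE eqxx /= eq_sym.
rewrite -[LHS]phiK -[X in psi X = _](mulmxKV Pu) mulmx_sum_row (lin_bigsum _ _ _ hpsi).
by apply: eq_bigr => i _; rewrite (linZ _ _ hpsi).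
Qed.

End Eigenbasis.

Section PowerEigenbasis.
Variables (k : closedFieldType) (p : nat).
Hypothesis pk : p \in [pchar k].
Variables (V : vectType k).
Hypothesis V0 : (0 < dim V)%N.

Lemma iter_model m (phi : V -> 'rV[k]_m.+1) psi (F : V -> V) (A : 'M[k]_m.+1) :
    cancel phi psi -> cancel psi phi -> (forall u, phi (F (psi u)) = u *m A) ->
  forall n u, phi (iter n F (psi u)) = u *m (A ^+ n).
Proof.
move=> phiK psiK FA; elim=> [|n IH] u /=; first by rewrite psiK mulmx1.
by rewrite -[iter n F _]phiK FA IH -mulmxA exprSr.
Qed.

Lemma exists_matrix m (phi : V -> 'rV[k]_m.+1) psi (F : V -> V) :
    lin phi -> lin psi -> lin F ->
  exists A : 'M[k]_m.+1, forall u, phi (F (psi u)) = u *m A.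
Proof.
move=> hphi hpsi hF; exists (\matrix_i phi (F (psi (delta_mx 0 i)))) => u.
have hG : lin (fun u => phi (F (psi u))) by lintac.
rewrite {1}(row_sum_delta u) (lin_bigsum _ _ _ hG) mulmx_sum_row.
by apply: eq_bigr => i _; rewrite (linZ _ _ hG) rowK.
Qed.

Lemma exists_pchar_eigenbasis (F : V -> V) : lin F ->
  exists a (m : nat), m = dim V /\
    exists w b beta, @eigenbasis k V 'I_m (iter (p ^ a) F) w b beta.
Proof.
move=> hF; have [m [phi [psi [hphi hpsi phiK psiK mE]]]] := matrix_model V0.
have [A FA] := exists_matrix hphi hpsi hF.
have [a dA] := diagonalizable_exp_pchar pk A.
exists a, m.+1; split=> //; apply: eigenbasis_of_diagonalizable dA => // u.
exact: iter_model phiK psiK FA _ _.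
Qed.

(* The weights are stable under division, so multiplication by one of them
   permutes them: their number, a power of p, annihilates each of them. *)
Lemma weights_eq1 (I : finType) (w : I -> k) (n : nat) :
    #|I| = (p ^ n)%N -> (forall i, w i != 0) ->
    (forall v, (#|I| * #|[pred i | w i == v]| <=
      #|[pred q : I * I | (w q.1 * w q.2)%R == v]|)%N) ->
  forall i, w i = 1.
Proof.
move=> cI w0 cnt i; have opd i' u v : (w i' * u == v) = (u == v / w i').
  by rewrite mulrC -[RHS](inj_eq (mulIf (w0 i'))) divfK.
have [M [_ MN div]] := uniform_weights (d := fun x y => x / y) (@mulrC k) opd cnt.
set W := undup (codom w) in MN; have wW l : w l \in W by rewrite mem_undup codom_f.
have [j Wj] : exists j, size W = (p ^ j)%N.
  have /(dvdn_pfactor _ _ (pcharf_prime pk)) [j _ ->] : (size W %| p ^ n)%N.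
    by rewrite -cI -MN dvdn_mulr.
  by exists j.
have perm : perm_eq [seq u / w i | u <- W] W.
  apply: uniq_perm; rewrite ?undup_uniq //.
    by rewrite map_inj_uniq ?undup_uniq //; apply: mulIf; rewrite invr_neq0.
  apply: (uniq_min_size _ _ _).2.
  - by rewrite map_inj_uniq ?undup_uniq //; apply: mulIf; rewrite invr_neq0.
  - move=> _ /mapP[u + ->]; rewrite mem_undup => /codomP[l ->].
    by have [l' <-] := div l i.
  - by rewrite size_map.
have := perm_big (op := *%R) (x := 1) (P := xpredT) (F := id) _ perm.
rewrite big_map big_split /= big_const_seq count_predT iter_mulr_1 Wj.
have P0 : \prod_(u <- W) u != 0.
  rewrite prodf_seq_neq0; apply/allP => u; rewrite mem_undup => /codomP[l ->].
  by rewrite w0.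
move=> /eqP; rewrite -[X in _ == X]mulr1 (inj_eq (mulfI P0)) => /eqP e.
apply: (expr_pchar_inj pk (a := j)); rewrite /= expr1n.
by rewrite -[LHS]invrK -exprVn e invr1.
Qed.

End PowerEigenbasis.

(** * Weights on the tensor square and the canonical maps *)

Section HopfWeights.
Variables (k : fieldType) (H : hopfAlgType k).
Local Notation S := (@antipode k H).
Local Notation eps := (@counit k H).

(** Through Psi, D acts on H (x) H as F does on the factor selected by s, the other factor
    contributing the multiplicity |I|; on the tensors b i (x) b j it has the weights op (w i) (w
    j). *)
Lemma hopf_weights (I : finType) (F : H -> H) (w : I -> k) b beta
    (op : k -> k -> k) (D Psi : tensor H H -> tensor H H) (s : bool) :
    eigenbasis F w b beta -> lin D -> lin Psi ->
    (forall t, Psi t = 0 -> t = 0) ->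
    (forall i j, D (tens (b i) (b j)) = op (w i) (w j) *: tens (b i) (b j)) ->
    (forall u v, D (Psi (tens u v)) =
       Psi (if s then tens (F u) v else tens u (F v))) ->
  forall v, (#|I| * #|[pred i | w i == v]| <=
    #|[pred q : I * I | op (w q.1) (w q.2) == v]|)%N.
Proof.
move=> [bb Fb] hD hPsi inj Db DPsi v.
pose a' (q : I * I) := if s then w q.1 else w q.2.
have -> : (#|I| * #|[pred i | w i == v]|)%N = #|[pred q | a' q == v]|.
  rewrite /a'; case: (s).
    rewrite mulnC -cardX; apply: eq_card => -[i j]; rewrite !inE /=.
    by rewrite andbT.
  by rewrite -cardX; apply: eq_card => -[i j]; rewrite !inE.
have eb : eigenbasis D (fun q : I * I => op (w q.1) (w q.2))
    (fun q => tens (b q.1) (b q.2))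
    (fun q => tlift (fun u v => (beta q.1 u : k) *: beta q.2 v)).
  by split=> [|q]; [apply: tens_dual_bases | apply: Db].
apply: (eigen_count v hD hPsi inj eb) => q.
rewrite DPsi /a'; case: (s); rewrite Fb -(linZ _ _ hPsi); congr Psi.
  by rewrite (linZ _ _ (f := fun u => tens u _)) //; lintac.
by rewrite (linZ _ _ (f := tens _)) //; lintac.
Qed.

(** The canonical maps of H as a Galois extension of k; the antipode provides their inverses. *)
Definition galois_l (t : tensor H H) : tensor H H :=
  tlift (fun a b => sw (fun a1 a2 => tens a1 (a2 * b)) a) t.
Definition galois_lV (t : tensor H H) : tensor H H :=
  tlift (fun a b => sw (fun a1 a2 => tens a1 (S a2 * b)) a) t.
Definition galois_r (t : tensor H H) : tensor H H :=
  tlift (fun a b => sw (fun b1 b2 => tens (a * b1) b2) b) t.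
Definition galois_rV (t : tensor H H) : tensor H H :=
  tlift (fun a b => sw (fun b1 b2 => tens (a * S b1) b2) b) t.

Lemma lin_galois_l : lin galois_l. Proof. by rewrite /galois_l; lintac. Qed.
Lemma lin_galois_lV : lin galois_lV. Proof. by rewrite /galois_lV; lintac. Qed.
Lemma lin_galois_r : lin galois_r. Proof. by rewrite /galois_r; lintac. Qed.
Lemma lin_galois_rV : lin galois_rV. Proof. by rewrite /galois_rV; lintac. Qed.

Lemma galois_l_tens a b :
  galois_l (tens a b) = sw (fun a1 a2 => tens a1 (a2 * b)) a.
Proof. by rewrite /galois_l tlift_tens // => *; lintac. Qed.
Lemma galois_lV_tens a b :
  galois_lV (tens a b) = sw (fun a1 a2 => tens a1 (S a2 * b)) a.
Proof. by rewrite /galois_lV tlift_tens // => *; lintac. Qed.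
Lemma galois_r_tens a b :
  galois_r (tens a b) = sw (fun b1 b2 => tens (a * b1) b2) b.
Proof. by rewrite /galois_r tlift_tens // => *; lintac. Qed.
Lemma galois_rV_tens a b :
  galois_rV (tens a b) = sw (fun b1 b2 => tens (a * S b1) b2) b.
Proof. by rewrite /galois_rV tlift_tens // => *; lintac. Qed.

Lemma tens_lin_ext (W : lmodType k) (f g : tensor H H -> W) : lin f -> lin g ->
  (forall a b, f (tens a b) = g (tens a b)) -> f =1 g.
Proof.
move=> hf hg e t; elim/tens_ind: t => [|s t hs ht|u v //].
  by rewrite !lin0.
by rewrite !linD // hs ht.
Qed.

Lemma galois_lK : cancel galois_l galois_lV.
Proof.
apply: (tens_lin_ext (f := fun t => galois_lV (galois_l t)) (g := fun t => t)).
- exact: lin_comp lin_galois_lV lin_galois_l.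
- exact: lin_id.
move=> a b; rewrite galois_l_tens (sw_lin _ _ lin_galois_lV).
transitivity (sw (fun a1 x => sw (fun a2 a3 =>
   (tens a1 (S a2 * a3 * b) : tensor H H)) x) a).
  rewrite -(swA (F := fun a1 a2 a3 => (tens a1 (S a2 * a3 * b) : tensor H H)));
    last by lintac.
  by eqsw => x a3; rewrite galois_lV_tens; eqsw => a1 a2; rewrite mulrA.
rewrite -[RHS](sw_counitr (f := fun a => tens a b)); last by lintac.
eqsw => a1 x; rewrite [LHS](sw_antil (f := fun z => tens a1 (z * b)));
  last by lintac.
by rewrite mul1r.
Qed.

Lemma galois_lVK : cancel galois_lV galois_l.
Proof.
apply: (tens_lin_ext (f := fun t => galois_l (galois_lV t)) (g := fun t => t)).
- exact: lin_comp lin_galois_l lin_galois_lV.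
- exact: lin_id.
move=> a b; rewrite galois_lV_tens (sw_lin _ _ lin_galois_l).
transitivity (sw (fun a1 x => sw (fun a2 a3 =>
   (tens a1 (a2 * S a3 * b) : tensor H H)) x) a).
  rewrite -(swA (F := fun a1 a2 a3 => (tens a1 (a2 * S a3 * b) : tensor H H)));
    last by lintac.
  by eqsw => x a3; rewrite galois_l_tens; eqsw => a1 a2; rewrite mulrA.
rewrite -[RHS](sw_counitr (f := fun a => tens a b)); last by lintac.
eqsw => a1 x; rewrite [LHS](sw_antir (f := fun z => tens a1 (z * b)));
  last by lintac.
by rewrite mul1r.
Qed.

Lemma galois_rK : cancel galois_r galois_rV.
Proof.
apply: (tens_lin_ext (f := fun t => galois_rV (galois_r t)) (g := fun t => t)).
- exact: lin_comp lin_galois_rV lin_galois_r.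
- exact: lin_id.
move=> a b; rewrite galois_r_tens (sw_lin _ _ lin_galois_rV).
transitivity (sw (fun x b3 => sw (fun b1 b2 =>
   (tens (a * (b1 * S b2)) b3 : tensor H H)) x) b).
  rewrite (swA (F := fun b1 b2 b3 => (tens (a * (b1 * S b2)) b3 : tensor H H)));
    last by lintac.
  by eqsw => b1 x; rewrite galois_rV_tens; eqsw => b2 b3; rewrite mulrA.
rewrite -[RHS](sw_counitl (f := fun b => tens a b)); last by lintac.
eqsw => x b3; rewrite [LHS](sw_antir (f := fun z => tens (a * z) b3));
  last by lintac.
by rewrite mulr1.
Qed.

End HopfWeights.

(** * The fourth power of the antipode *)

Section Unipotent.
Variables (k : closedFieldType) (p n : nat) (H : hopfAlgType k).
Hypotheses (pk : p \in [pchar k]) (dimH : \dim {:H} = (p ^ n)%N).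
Local Notation S := (@antipode k H).
Local Notation eps := (@counit k H).

Let H0 : (0 < dim H)%N.
Proof. by rewrite -dimvf dimH expn_gt0 prime_gt0 ?(pcharf_prime pk). Qed.

Lemma lin_iter (F : H -> H) m : lin F -> lin (iter m F).
Proof. by move=> hF; elim: m => [|m IH] //=; exact: lin_comp hF IH. Qed.

Lemma tmapE (f g : H -> H) u v : lin f -> lin g ->
  tmap f g (tens u v) = tens (f u) (g v).
Proof. by move=> hf hg; rewrite /tmap tlift_tens // => *; lintac. Qed.

Lemma lin_tmap (f g : H -> H) : lin (tmap f g).
Proof. by rewrite /tmap; lintac. Qed.

(** Some p-power iterate of F is diagonalizable, and [weights_eq1] makes all its weights 1. The
    exponent is found only in the proof, so the compatibility with Psi is assumed for all
    iterates. *)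
Lemma pchar_exp_eq1 (F : H -> H) (Psi : nat -> tensor H H -> tensor H H)
    (s : bool) : lin F -> injective F ->
    (forall q, lin (Psi q)) -> (forall q, injective (Psi q)) ->
    (forall q u v, tmap (iter q F) (iter q F) (Psi q (tens u v)) =
       Psi q (if s then tens (iter q F u) v else tens u (iter q F v))) ->
  exists a, forall h, iter (p ^ a) F h = h.
Proof.
move=> hF injF hPsi injPsi FPsi.
have [a [m [mE [w [b [beta eb]]]]]] := exists_pchar_eigenbasis pk H0 hF.
exists a; set G := iter _ F in eb *; have [[hb bb bE] Gb] := eb.
have hG : lin G by apply: lin_iter.
have injG : injective G by rewrite /G; elim: (p ^ a)%N => //= q IH x y /injF/IH.
suff w1 i : w i = 1.
  move=> h; rewrite [h in LHS]bE (lin_bigsum _ _ _ hG) [RHS]bE.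
  by apply: eq_bigr => i _; rewrite (linZ _ _ hG) Gb w1 scale1r.
apply: (weights_eq1 pk (n := n) (w := w)).
- by rewrite card_ord mE -dimvf.
- move=> j; apply/eqP => wj.
  have : b j = 0 by apply: injG; rewrite Gb wj scale0r lin0.
  move/(congr1 (beta j)); rewrite bb eqxx (lin0 (hb j)) => /eqP.
  by apply/negP; apply: oner_neq0.
move=> v; apply: (hopf_weights (D := tmap G G) (Psi := Psi (p ^ a)%N) (s := s)
  (op := *%R) eb) => //.
- exact: lin_tmap.
- by move=> t t0; apply: (injPsi (p ^ a)%N); rewrite t0 lin0.
- move=> j l; rewrite tmapE // !Gb.
  rewrite (linZ _ _ (f := fun u => tens u _)); last by lintac.
  by rewrite (linZ _ _ (f := tens _)) ?scalerA //; lintac.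
- by move=> t u; apply: FPsi.
Qed.

(** Since comul (g h) = (g (x) g) comul h, the map [galois_l] carries multiplication by g on the
    first factor to multiplication by g (x) g. *)
Lemma grouplike_pchar (g : H) : grouplike g -> exists a, g ^+ (p ^ a) = 1.
Proof.
move=> gg; pose F h := g * h.
have iterF q h : iter q F h = g ^+ q * h.
  by elim: q => [|q IH] /=; rewrite ?mul1r // /F IH exprS mulrA.
have hF : lin F by rewrite /F; lintac.
have [|||q u v|a Fa] := pchar_exp_eq1 (F := F) (Psi := fun _ => @galois_l k H)
  (s := true) hF; last by exists a; have := Fa 1; rewrite iterF mulr1.
- by move=> x y /(congr1 (fun h => S g * h)); rewrite !mulrA grouplike_mulVr // !mul1r.
- by move=> _; apply: lin_galois_l.
- by move=> _; apply: can_inj (@galois_lK k H).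
rewrite !galois_l_tens iterF swM; last by lintac.
rewrite (sw_grouplike (grouplikeX q gg)); last by lintac.
rewrite (sw_lin _ _ (lin_tmap _ _)); eqsw => a b.
by rewrite tmapE ?iterF ?mulrA //; apply: lin_iter.
Qed.

Definition ract (f : H -> k^o) (h : H) : H := sw (fun a b => (f b : k) *: a) h.

Variable alpha : H -> k^o.
Hypotheses (ha : lin alpha) (alphaM : forall a b, alpha (a * b) = alpha a * alpha b :> k)
  (alpha1 : alpha 1 = 1 :> k).

Lemma lin_ract : lin (ract alpha). Proof. by rewrite /ract; lintac. Qed.

Lemma ractM a b : ract alpha (a * b) = ract alpha a * ract alpha b.
Proof.
rewrite /ract swM; last by lintac.
rewrite [RHS](sw_lin _ _ (L := fun z => z * _)); last by lintac.
eqsw => a1 a2; rewrite [RHS](sw_lin _ _ (L := fun z => _ * z)); last by lintac.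
by eqsw => b1 b2; rewrite -scalerAl -scalerAr scalerA -alphaM.
Qed.

Lemma sw_ract (W : lmodType k) (f : H -> H -> W) h : bilin f ->
  sw f (ract alpha h) = sw (fun a b => f a (ract alpha b)) h.
Proof.
case=> f1 f2; rewrite /ract [LHS](sw_lin _ _ (L := sw f)); last by lintac.
transitivity (sw (fun a x => sw (fun b c => (alpha c : k) *: f a b) x) h).
  rewrite -(swA (F := fun a b c => (alpha c : k) *: f a b)); last by lintac.
  eqsw => x c; rewrite (linZ (f := sw f)) ?[LHS](sw_lin _ _ (L := fun z => _ *: z)) //;
  by lintac.
eqsw => a x; rewrite [RHS](sw_lin _ _ (L := f a)) //; eqsw => b c.
by rewrite (linZ _ _ (f2 a)).
Qed.

Lemma ract_inj : injective (ract alpha).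
Proof.
pose rinv h : H := sw (fun a b => (alpha (S b) : k) *: a) h.
suff : cancel (ract alpha) rinv by apply: can_inj.
move=> h; rewrite /rinv sw_ract; last by lintac.
rewrite -[RHS](sw_counitr (f := fun h => h)) //; eqsw => a x.
transitivity (sw (fun b c => (alpha (S b * c) : k) *: a) x); last first.
  rewrite [LHS](sw_antil (f := fun z => (alpha z : k) *: a)); last by lintac.
  by rewrite alpha1 scale1r.
rewrite /ract (sw_lin _ _ (L := fun z => (alpha (S z) : k) *: a)); last by lintac.
by eqsw => b c; rewrite linearZ (linZ _ _ ha) alphaM mulrC.
Qed.

Lemma iter_ractM q a b :
  iter q (ract alpha) (a * b) = iter q (ract alpha) a * iter q (ract alpha) b.
Proof. by elim: q => //= q ->; apply: ractM. Qed.

Lemma sw_iter_ract q (W : lmodType k) (f : H -> H -> W) h : bilin f ->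
  sw f (iter q (ract alpha) h) = sw (fun a b => f a (iter q (ract alpha) b)) h.
Proof.
have hr := lin_ract.
elim: q f => [|q IH] f [f1 f2] //=; rewrite sw_ract // IH //.
by split=> u; [apply: f1 | apply: lin_comp (f2 u) hr].
Qed.

(** The dual of [grouplike_pchar], as alpha is grouplike in the dual of H; here the inverse
    canonical map intertwines, and the action is on the second factor. *)
Lemma ract_pchar : exists a, forall h, iter (p ^ a) (ract alpha) h = h.
Proof.
have hi q : lin (iter q (ract alpha)) by apply: lin_iter lin_ract.
have hid : lin (fun h : H => h) by apply: lin_id.
apply: (pchar_exp_eq1 (Psi := fun _ => @galois_lV k H) (s := false)).
- exact: lin_ract.
- exact: ract_inj.
- by move=> _; apply: lin_galois_lV.
- by move=> _; apply: can_inj (@galois_lVK k H).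
move=> q u v; set F := iter q _.
have hF : lin F by apply: hi.
suff E t : galois_l (tmap F F t) = tmap (fun h => h) F (galois_l t).
  apply: (can_inj (@galois_lK k H)).
  by rewrite E !galois_lVK tmapE.
apply: (tens_lin_ext (f := fun t => galois_l (tmap F F t))
  (g := fun t => tmap (fun h => h) F (galois_l t))).
- exact: lin_comp (@lin_galois_l k H) (lin_tmap _ _).
- exact: lin_comp (lin_tmap _ _) (@lin_galois_l k H).
move=> a b; rewrite tmapE // !galois_l_tens sw_iter_ract; last by lintac.
rewrite [RHS](sw_lin _ _ (lin_tmap _ _)); eqsw => a1 a2.
by rewrite tmapE // /F iter_ractM.
Qed.

Lemma lin_lact_alpha : lin (lact alpha). Proof. exact: lin_lact. Qed.

Lemma lact_ract h : lact alpha (ract alpha h) = ract alpha (lact alpha h).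
Proof.
rewrite /lact sw_ract; last by lintac.
by rewrite (sw_lin _ _ lin_ract); eqsw => a b; rewrite (linZ _ _ lin_ract).
Qed.

Lemma counit_ract h : eps (ract alpha h) = alpha h :> k.
Proof.
rewrite /ract [LHS](sw_lin _ _ (L := eps)); last by lintac.
rewrite -[RHS](sw_counitl (f := alpha)) //; eqsw => a b.
by rewrite linearZ; apply: mulrC.
Qed.

Lemma counit_lact h : eps (lact alpha h) = alpha h :> k.
Proof.
rewrite /lact [LHS](sw_lin _ _ (L := eps)); last by lintac.
rewrite -[RHS](sw_counitr (f := alpha)) //; eqsw => a b.
by rewrite linearZ; apply: mulrC.
Qed.

Lemma sw_lact (W : lmodType k) (f : H -> H -> W) h : bilin f ->
  sw f (lact alpha h) = sw (fun a b => f (lact alpha a) b) h.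
Proof.
case=> f1 f2; rewrite /lact [LHS](sw_lin _ _ (L := sw f)); last by lintac.
transitivity (sw (fun x c => sw (fun a b => (alpha a : k) *: f b c) x) h).
  rewrite (swA (F := fun a b c => (alpha a : k) *: f b c)); last by lintac.
  eqsw => a x; rewrite (linZ (f := sw f)) ?[LHS](sw_lin _ _ (L := fun z => _ *: z)) //;
  by lintac.
eqsw => x c; rewrite [RHS](sw_lin _ _ (L := f^~ c)) //; eqsw => a b.
by rewrite (linZ _ _ (f1 c)).
Qed.

(** Composed with the counit, both iterates give the same functional, the q-th convolution power of
    alpha, from which either action is recovered. *)
Lemma iter_lact_id q : (forall h, iter q (ract alpha) h = h) ->
  forall h, iter q (lact alpha) h = h.
Proof.
move=> rq h; have hl := lin_lact_alpha.
have hi m : lin (iter m (lact alpha)) by apply: lin_iter.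
have comm m h' : iter m (ract alpha) (lact alpha h') = lact alpha (iter m (ract alpha) h').
  by elim: m => //= m ->; rewrite lact_ract.
have e m h' : eps (iter m (ract alpha) h') = eps (iter m (lact alpha) h') :> k.
  elim: m h' => // m IH h'; rewrite iterS counit_ract -counit_lact -comm IH.
  by rewrite -iterSr.
have sl m (W : lmodType k) (f : H -> H -> W) h' : bilin f ->
    sw f (iter m (lact alpha) h') = sw (fun a b => f (iter m (lact alpha) a) b) h'.
  elim: m f => [|m IH] f [f1 f2] //=; rewrite sw_lact // IH //.
  by split=> u; [apply: lin_comp (f1 u) hl | apply: f2].
rewrite -[LHS](sw_counitl (f := fun h => h)) // sl; last by lintac.
rewrite -[RHS](sw_counitl (f := fun h => h)) //; eqsw => a b.
by rewrite -e rq.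
Qed.

(** Both sides are convolution inverses of alpha composed with S. *)
Lemma char_antipode2 h : alpha (S (S h)) = alpha h :> k.
Proof.
have hS : lin (fun h => alpha (S h)) by lintac.
apply: (conv_inv_uniq (A := k^o) (f := fun h => alpha (S (S h)))
  (g := fun h => alpha (S h)) (v := alpha)) => // [|h'|h']; first by lintac.
  transitivity (sw (fun a b => alpha (S (S a * b))) h').
    by eqsw => a b; rewrite antipodeM alphaM mulrC.
  rewrite [LHS](sw_antil (f := fun z => alpha (S z))) //.
  by rewrite antipode1 alpha1.
transitivity (sw (fun a b => alpha (S a * b)) h').
  by eqsw => a b; rewrite alphaM.
by rewrite [LHS](sw_antil (f := alpha)) // alpha1.
Qed.

Lemma ract_grouplike (g : H) : grouplike g -> ract alpha g = (alpha g : k) *: g.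
Proof. by move=> gg; rewrite /ract (sw_grouplike gg) //; lintac. Qed.

End Unipotent.

Section Antipode4.
Variables (k : closedFieldType) (p n : nat) (H : hopfAlgType k).
Hypotheses (pk : p \in [pchar k]) (dimH : \dim {:H} = (p ^ n)%N).
Local Notation S := (@antipode k H).
Local Notation eps := (@counit k H).

Lemma iter_comm_comp (T : Type) (A B : T -> T) m x :
  (forall x, A (B x) = B (A x)) ->
  iter m (fun x => A (B x)) x = iter m A (iter m B x).
Proof.
move=> AB; elim: m => //= m ->; congr (A _).
by elim: m (iter m B x) => //= m IH y; rewrite -IH AB.
Qed.

Lemma iter_id_mul (T : Type) (A : T -> T) m q : (forall x, iter m A x = x) ->
  forall x, iter (m * q) A x = x.
Proof.
move=> Am; elim: q => [|q IH] x; first by rewrite muln0.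
by rewrite mulnS iterD IH Am.
Qed.

Let bij := @antipode_bij k H.

(** With l and r the two actions of alpha and Ad the conjugation by g, Radford's formula reads S^4 l
    = Ad r. As S^4 commutes with l and Ad with r, a power of p that makes l, r and Ad trivial does
    the same for S^4. *)
Lemma antipode4_pchar : exists a, forall h : H, iter (p ^ a * 4) S h = h.
Proof.
have [l [L lL]] := exists_frobenius_pair H; have [T [ST TS]] := bij.
set alpha := modular_function l L; set g := modular_element l L.
have ha : lin alpha := lin_modular_function lL.
have alphaM : forall a b, alpha (a * b) = alpha a * alpha b :> k := modular_functionM lL.
have alpha1 : alpha 1 = 1 :> k by have := modular_function1 lL.
have gg : grouplike g.
  by split; [apply: comul_modular_element | apply: counit_modular_element].
pose S4 (h : H) : H := S (S (S (S h))).
pose Ad (h : H) : H := g * h * S g.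
have rad h : S4 (lact alpha h) = Ad (ract alpha h).
  rewrite -[RHS](radford lL ST TS) /lact /S4.
  rewrite (sw_lin _ _ (L := fun z : H => S (S (S (S z))))); last by lintac.
  by eqsw => a b; rewrite !linearZ.
have S4l h : S4 (lact alpha h) = lact alpha (S4 h).
  rewrite /S4 /lact !sw_antipode2; [|lintac..].
  rewrite (sw_lin _ _ (L := fun z : H => S (S (S (S z))))); last by lintac.
  by eqsw => a b; rewrite !linearZ !(char_antipode2 ha alphaM alpha1).
have Adr h : Ad (ract alpha h) = ract alpha (Ad h).
  rewrite /Ad !(ractM ha alphaM) (ract_grouplike ha gg).
  have -> : ract alpha (S g) = (alpha (S g) : k) *: S g.
    rewrite /ract sw_antipode; last by lintac.
    by rewrite (sw_grouplike gg) //; lintac.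
  rewrite -!scalerAl -scalerAr scalerA -alphaM grouplike_mulrV // alpha1.
  by rewrite scale1r.
have [a ga] := grouplike_pchar pk dimH gg.
have [b rb] := ract_pchar pk dimH ha alphaM alpha1.
have lb := iter_lact_id ha rb.
exists (a + b)%N => h.
have iterAd m : iter m Ad h = g ^+ m * h * S (g ^+ m).
  elim: m => [|m IH]; first by rewrite antipode1 mul1r mulr1.
  by rewrite iterS IH /Ad [in RHS]exprS antipodeM !mulrA.
have Adq : iter (p ^ (a + b)) Ad h = h.
  by rewrite iterAd expnD exprM ga expr1n antipode1 mul1r mulr1.
have rq x : iter (p ^ (a + b)) (ract alpha) x = x.
  by rewrite expnD mulnC; apply: iter_id_mul.
have lq x : iter (p ^ (a + b)) (lact alpha) x = x.
  by rewrite expnD mulnC; apply: iter_id_mul.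
have -> : iter (p ^ (a + b) * 4) S h = iter (p ^ (a + b)) S4 h.
  by elim: (p ^ (a + b))%N => //= q <-.
rewrite -[X in iter _ _ X]lq -iter_comm_comp //.
transitivity (iter (p ^ (a + b)) (fun x => Ad (ract alpha x)) h).
  by apply: eq_iter => x; apply: rad.
by rewrite iter_comm_comp // rq Adq.
Qed.

(** Unimodularity makes L a right integral, so alpha is the counit and both its actions in Radford's
    formula are trivial. *)
Lemma antipode4_unimodular : unimodular H ->
  exists g : H, [/\ grouplike g, forall h, S (S (S (S h))) = g * h * S g
    & exists a, g ^+ (p ^ a) = 1].
Proof.
have [l [L lL]] := exists_frobenius_pair H; have [T [ST TS]] := bij.
move=> uni; have iL := frobenius_integral lL.
have ae h : modular_function l L h = eps h :> k.
  have [hl _ _ _ lLy] := lL; rewrite /modular_function ((uni L).1 iL h) linZ //.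
  by rewrite -[L]mul1r lLy counit1; apply: mulr1.
have gg : grouplike (modular_element l L).
  by split; [apply: comul_modular_element | apply: counit_modular_element].
exists (modular_element l L); split=> // [h|]; last exact: (grouplike_pchar pk dimH gg).
have := radford lL ST TS h.
rewrite (_ : sw _ h = sw (fun a b => (eps a : k) *: S (S (S (S b)))) h); last first.
  by eqsw => a b; rewrite ae.
rewrite (sw_counitl (f := fun z => S (S (S (S z))))) => [->|]; last by lintac.
congr (_ * _ * _).
rewrite (_ : sw _ h = sw (fun a b => (eps b : k) *: a) h); last first.
  by eqsw => a b; rewrite ae.
by rewrite (sw_counitr (f := fun z => z)).
Qed.

End Antipode4.

(** * Idempotents of k[x] *)

Section Reduced.
Variables (k : fieldType) (A : falgType k).
Hypothesis mulC : forall a b : A, a * b = b * a.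

(** For a minimal ideal L i, the ideal a L i is 0 or L i, and in the second case L i = a a L i = 0.
    So a annihilates every summand, and with them 1. *)
Lemma semisimple_comm_reduced (a : A) : semisimple_algebra A -> a * a = 0 -> a = 0.
Proof.
case=> m [L [mL _ LE]] aa0.
have kill i b : b \in L i -> a * b = 0.
  have [hL L0 minL] := mL i; move=> bL.
  have sJL : (<[a]> * L i <= L i)%VS.
    by apply: subv_trans hL; apply: prodvSl; apply: subvf.
  have hJ : left_ideal (<[a]> * L i)%VS.
    rewrite /left_ideal prodvA.
    apply: subv_trans (_ : <[a]> * fullv * L i <= _)%VS.
      apply: prodvSl; apply/prodvP => u v _ va.
      by rewrite mulC memv_mul ?memvf.
    by rewrite -prodvA; apply: prodvSr.
  case: (minL _ hJ sJL) => E.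
    by apply/eqP; rewrite -memv0 -E memv_mul ?memv_line.
  case: L0; rewrite -E -E prodvA prodv_line aa0.
  apply/eqP; rewrite -subv0; apply/prodvP => u v /vlineP[c ->] _.
  by rewrite scaler0 mul0r mem0v.
have : (1 : A) \in (\sum_i L i)%VS by rewrite LE memvf.
case/memv_sumP => b bL e1; rewrite -[a]mulr1 e1 mulr_sumr.
by apply: big1 => i _; apply: kill (bL i isT).
Qed.

End Reduced.

Section GenSubalg.
Variables (k : fieldType) (A : falgType k) (x : A).
Local Notation K := (gen_subalg x).

(** Two centralizers in turn: K commutes with x, so x lies in the centralizer of K, which then
    contains K. *)
Lemma gen_subalgC a b : a \in K -> b \in K -> a * b = b * a.
Proof.
have c1 : (1 + <[x]> <= 'C[x])%VS.
  by rewrite subv_add -!memvE cent1v1 cent1v_id.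
have c2 : (K <= 'C[x])%VS.
  apply: agenv_sub_modl; first by apply: subv_trans c1; apply: addvSl.
  by apply/prodvP => u v /(subvP c1) /cent1vP ux /cent1vP vx; apply/cent1vP;
    rewrite -mulrA vx mulrA ux mulrA.
have c3 : (1 + <[x]> <= 'C(K))%VS.
  rewrite subv_add -!memvE centv1.
  by apply/centvP => v /(subvP c2) /cent1vP.
have c4 : (K <= 'C(K))%VS.
  apply: agenv_sub_modl; first by apply: subv_trans c3; apply: addvSl.
  apply/prodvP => u v /(subvP c3) /centvP uK /centvP vK; apply/centvP => w wK.
  by rewrite -mulrA vK // mulrA uK // mulrA.
by move=> /(subvP c4) /centvP aK bK; apply: aK.
Qed.

Lemma horner_gen_subalg Q : horner_alg x Q \in K.
Proof.
have xK : x \in K by apply: memv_adjoin.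
have K1 : 1 \in K by apply: (subvP (sub1_agenv _)); apply: memv_line.
elim/poly_ind: Q => [|Q c IH]; first by rewrite rmorph0 mem0v.
rewrite rmorphD rmorphM /= horner_algX horner_algC.
by rewrite rpredD ?memvZ //; apply: (subvP (prodv_sub (subvv _) (subvv _)));
  apply: memv_mul.
Qed.

Lemma gen_subalg_nilpotent a m : semisimple_element x -> a \in K -> a ^+ m = 0 ->
  a = 0.
Proof.
move=> ss aK; have C (u v : subvs_of K) : u * v = v * u.
  by apply: val_inj; apply: (gen_subalgC (subvsP u) (subvsP v)).
have red b : b \in K -> b * b = 0 -> b = 0.
  move=> bK bb; suff : Subvs bK = 0 by move/(congr1 val).
  by apply: (semisimple_comm_reduced C ss); apply: val_inj.
have am q : a ^+ q.+1 \in K.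
  elim: q => [|q IH]; first by rewrite expr1.
  by rewrite exprS; apply: (subvP (prodv_sub (subvv _) (subvv _))); apply: memv_mul.
(* Only square roots of 0 can be removed, so the exponent m is first raised to a power of 2. *)
have big q : a ^+ (2 ^ q) = 0 -> a = 0.
  elim: q => [|q IH]; first by rewrite expr1.
  rewrite expnSr exprM expr2 => h; apply: IH; apply: red h.
  by rewrite -(prednK (expn_gt0 2 q)).
move=> a0; apply: (big m); rewrite -(subnK (ltnW (ltn_expl m (ltnSn 1)))).
by rewrite exprD a0 mulr0.
Qed.

End GenSubalg.

Section Lagrange.
Variables (k : fieldType) (rs : seq k).
Hypothesis urs : uniq rs.

Definition lagrange_poly (v : k) : {poly k} :=
  \prod_(w <- rs | w != v) ((v - w)^-1 *: ('X - w%:P)).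

Lemma lagrange_polyE u v : u \in rs -> v \in rs ->
  (lagrange_poly v).[u] = (u == v)%:R.
Proof.
move=> urs' vrs; rewrite /lagrange_poly horner_prod.
have [->|uv] := eqVneq u v.
  rewrite big1 // => w wv; rewrite hornerZ !hornerE mulVf // subr_eq0 eq_sym //.
by rewrite (big_rem u) //= uv hornerZ !hornerE subrr mulr0 mul0r.
Qed.

Lemma lagrange_poly_root v : v \in rs ->
  exists c, ('X - v%:P) * lagrange_poly v = c *: \prod_(r <- rs) ('X - r%:P).
Proof.
move=> vrs; exists (\prod_(w <- rs | w != v) (v - w)^-1).
rewrite /lagrange_poly scaler_prod -scalerAr; congr (_ *: _).
rewrite [RHS](bigID (pred1 v)) /=; congr (_ * _).
rewrite -big_filter.
have -> : [seq i <- rs | i == v] = [:: v] by apply: filter_pred1_uniq.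
by rewrite big_seq1.
Qed.

(** The difference of the two sides has degree below [size rs] and vanishes on all of rs. *)
Lemma sum_lagrange_poly : (0 < size rs)%N -> \sum_(v <- rs) lagrange_poly v = 1.
Proof.
move=> rs0; apply/eqP; rewrite -subr_eq0; apply/negPn/negP => nz.
have roots : all (root (\sum_(v <- rs) lagrange_poly v - 1)) rs.
  apply/allP => u urs'; rewrite rootE !hornerE horner_sum.
  rewrite (bigD1_seq u) //= lagrange_polyE // eqxx big_seq_cond big1 ?addr0 ?subrr //.
  by move=> v /andP[vrs vu]; rewrite lagrange_polyE // eq_sym (negPf vu).
have := max_poly_roots nz roots urs; apply/negP; rewrite -leqNgt.
have sz v : v \in rs -> (size (lagrange_poly v) <= size rs)%N.
  move=> vrs; rewrite /lagrange_poly scaler_prod.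
  apply: leq_trans (size_scale_leq _ _) _.
  rewrite -big_filter size_prod_XsubC size_filter.
  by rewrite -(count_predC (pred1 v) rs) -addn1 addnC leq_add2r -has_count has_pred1.
apply: leq_trans (size_polyD _ _) _; rewrite geq_max size_polyN size_poly1 rs0 andbT.
rewrite big_seq; elim/big_ind: _ => [|f g hf hg|i /sz //].
  by rewrite size_poly0.
by apply: leq_trans (size_polyD _ _) _; rewrite geq_max hf hg.
Qed.

End Lagrange.

Section Roots.
Variables (k : closedFieldType) (A : falgType k) (x : A).
Hypothesis ss : semisimple_element x.
Local Notation K := (gen_subalg x).

Let A0 : (0 < dim A)%N.
Proof. by rewrite -dimvf adim_gt0. Qed.

Lemma horner_model m (phi : A -> 'rV[k]_m.+1) psi (M : 'M[k]_m.+1) Q u :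
    lin phi -> lin psi -> cancel phi psi -> cancel psi phi ->
    (forall u, phi (psi u * x) = u *m M) ->
  phi (psi u * horner_alg x Q) = u *m horner_mx M Q.
Proof.
move=> hphi hpsi phiK psiK xM; elim/poly_ind: Q u => [|Q c IH] u.
  by rewrite !rmorph0 mulr0 (lin0 hphi) mulmx0.
rewrite !rmorphD !rmorphM /= horner_algX horner_algC horner_mx_X horner_mx_C.
rewrite mulrDr (linD _ _ hphi) mulmxDr -scalerAr mulr1 (linZ _ _ hphi) psiK.
by rewrite mul_mx_scalar mulrA -[psi u * _]phiK xM IH mulmxA.
Qed.

(** The polynomial with simple roots at the eigenvalues of right multiplication by x has a power
    divisible by the characteristic polynomial, so its value at x is nilpotent, and k[x] is
    reduced. *)
Lemma semisimple_element_roots : exists rs : seq k, uniq rs /\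
  horner_alg x (\prod_(r <- rs) ('X - r%:P)) = 0.
Proof.
have [m [phi [psi [hphi hpsi phiK psiK _]]]] := matrix_model A0.
have [M xM] := exists_matrix (F := fun h => h * x) hphi hpsi (lin_mulr x (lin_id (U := A))).
have [rs Mrs] := closed_field_poly_normal (char_poly M).
rewrite (eqP (char_poly_monic M)) scale1r in Mrs.
exists (undup rs); split; first exact: undup_uniq.
apply: (gen_subalg_nilpotent (m := size rs) ss (horner_gen_subalg _ _)).
have : char_poly M %| (\prod_(r <- undup rs) ('X - r%:P)) ^+ size rs.
  rewrite {1}Mrs -prodrXl -big_undup_iterop_count /=.
  elim/big_ind2: _ => // [u v u' v'|r _]; first exact: dvdp_mul.
  by apply: dvdp_exp2l; apply: count_size.
case/dvdpP=> Q QE; rewrite -rmorphXn QE rmorphM /=.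
have h0 : horner_alg x (char_poly M) = 0.
  rewrite -[LHS]phiK -[horner_alg _ _]mul1r -[1]phiK.
  by rewrite (horner_model _ _ hphi hpsi phiK psiK xM) Cayley_Hamilton mulmx0 (lin0 hpsi).
by rewrite h0 mulr0.
Qed.

Lemma mulx_eigenbasis (rs : seq k) : uniq rs ->
    horner_alg x (\prod_(r <- rs) ('X - r%:P)) = 0 ->
  exists m, m = dim A /\
    exists w b beta, @eigenbasis k A 'I_m (fun h => h * x) w b beta.
Proof.
move=> urs x0; have [m [phi [psi [hphi hpsi phiK psiK mE]]]] := matrix_model A0.
have [M xM] := exists_matrix (F := fun h => h * x) hphi hpsi (lin_mulr x (lin_id (U := A))).
exists m.+1; split=> //; apply: (eigenbasis_of_diagonalizable hphi hpsi phiK psiK xM).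
apply/diagonalizableP; exists rs => //; apply: mxminpoly_min.
apply/row_matrixP => i; rewrite rowE -(horner_model _ _ hphi hpsi phiK psiK xM).
by rewrite x0 mulr0 (lin0 hphi) row0.
Qed.

End Roots.

Lemma free_separated (k : fieldType) (U W : vectType k) (J : eqType) (s : seq J)
    (f : J -> U) (g : J -> U -> W) : uniq s -> (forall i, lin (g i)) ->
    {in s &, forall i j, i != j -> g i (f j) = 0} ->
    {in s, forall i, g i (f i) != 0} ->
  free [seq f i | i <- s].
Proof.
move=> us hg g0 g1; elim: s us g0 g1 => [|i s IH] /=; first by rewrite nil_free.
case/andP=> is_ us g0 g1; rewrite free_cons IH ?andbT //; first last.
- by move=> j js; apply: g1; rewrite inE js orbT.
- by move=> j l js ls; apply: g0; rewrite inE ?js ?ls orbT.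
have [G GE] := lin_hom (hg i).
apply/negP => fs; have /eqP : g i (f i) != 0 by apply: g1; rewrite inE eqxx.
apply; apply/eqP; rewrite -GE -memv_ker; apply: (subvP _ _ fs).
apply/span_subvP => _ /mapP[j js ->]; rewrite memv_ker GE; apply/eqP.
apply: g0; rewrite ?inE ?eqxx ?js ?orbT //.
by apply: contraNneq is_ => ->.
Qed.

Section Idempotents.
Variables (k : fieldType) (A : falgType k) (x : A) (rs : seq k).
Hypotheses (urs : uniq rs)
  (x0 : horner_alg x (\prod_(r <- rs) ('X - r%:P)) = 0).
Local Notation K := (gen_subalg x).

Definition weight_idem (v : k) : A := horner_alg x (lagrange_poly rs v).
Local Notation e := weight_idem.

(** The list rs may contain numbers that are not eigenvalues of x; their idempotents vanish and are
    discarded. *)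
Definition weight_set : seq k := [seq v <- rs | e v != 0].
Local Notation W := weight_set.

Lemma weight_idemP v : v \in W -> v \in rs /\ e v <> 0.
Proof. by rewrite mem_filter => /andP[/eqP]. Qed.

Lemma uniq_weight_set : uniq W. Proof. exact: filter_uniq. Qed.

Lemma horner_algl Q v h : h * x = v *: h -> h * horner_alg x Q = Q.[v] *: h.
Proof.
move=> hx; elim/poly_ind: Q => [|Q c IH]; first by rewrite rmorph0 mulr0 horner0 scale0r.
rewrite rmorphD rmorphM /= horner_algX horner_algC mulrDr mulrA IH -scalerAl hx.
by rewrite scalerA -scalerAr mulr1 !hornerE scalerDl.
Qed.

Lemma horner_algr Q v h : x * h = v *: h -> horner_alg x Q * h = Q.[v] *: h.
Proof.
move=> hx; elim/poly_ind: Q => [|Q c IH]; first by rewrite rmorph0 mul0r horner0 scale0r.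
rewrite rmorphD rmorphM /= horner_algX horner_algC mulrDl -mulrA hx -scalerAr IH.
by rewrite scalerA mulrC -scalerAl mul1r !hornerE scalerDl.
Qed.

Lemma weight_idem_memK v : e v \in K. Proof. exact: horner_gen_subalg. Qed.

Lemma mulx_weight_idem v : v \in rs -> x * e v = v *: e v.
Proof.
move=> vrs; have [c cE] := lagrange_poly_root urs vrs.
have := congr1 (horner_alg x) cE.
rewrite -mul_polyC !rmorphM /= x0 mulr0 rmorphB /= horner_algX horner_algC.
by rewrite mulrBl -scalerAl mul1r => /eqP; rewrite subr_eq0 => /eqP.
Qed.

Lemma weight_idem_mulx v : v \in rs -> e v * x = v *: e v.
Proof.
move=> vrs; rewrite -mulx_weight_idem //.
exact: gen_subalgC (weight_idem_memK v) (memv_adjoin _ _).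
Qed.

Lemma weight_idem_mul u v : u \in rs -> v \in rs ->
  e u * e v = if u == v then e v else 0.
Proof.
move=> urs' vrs; rewrite (horner_algr _ (mulx_weight_idem vrs)) lagrange_polyE //.
by rewrite eq_sym; case: eqP => _; rewrite ?scale1r ?scale0r.
Qed.

Lemma weight_idem_absorb_l v h : v \in rs -> h * x = v *: h -> h * e v = h.
Proof. by move=> vrs hx; rewrite (horner_algl _ hx) lagrange_polyE // eqxx scale1r. Qed.

Lemma sum_weight_idem : \sum_(v <- W) e v = 1.
Proof.
have rs0 : (0 < size rs)%N.
  rewrite lt0n; apply/eqP => /size0nil rs0; move: x0.
  by rewrite rs0 big_nil rmorph1 => /eqP; rewrite oner_eq0.
rewrite big_filter -[RHS](rmorph1 (horner_alg x)) -(sum_lagrange_poly urs rs0).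
rewrite rmorph_sum /= [RHS](bigID (fun v => e v != 0)) /= [X in _ + X]big1 ?addr0 //.
by move=> v; rewrite negbK => /eqP.
Qed.

Lemma gen_subalg_span : K = <<[seq e v | v <- W]>>%VS :> {vspace A}.
Proof.
apply/eqP; rewrite eqEsubv; apply/andP; split; last first.
  by apply/span_subvP => _ /mapP[v _ ->]; apply: weight_idem_memK.
have one : 1 \in <<[seq e v | v <- W]>>%VS.
  rewrite -sum_weight_idem big_seq; apply: memv_suml => v vW.
  by apply: memv_span; apply: map_f.
apply: agenv_sub_modl; first by rewrite -memvE.
rewrite prodvDl prod1v subv_add subvv /=.
apply/prodvP => _ y /vlineP[c ->] yW.
have yW' : y \in <<in_tuple [seq e v | v <- W]>>%VS by [].
rewrite (coord_span yW').
rewrite mulr_sumr; apply: memv_suml => i _.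
rewrite -scalerAr -scalerAl memvZ // memvZ //.
have /mapP[v vW /= ->] : (in_tuple [seq e v | v <- W])`_i \in [seq e v | v <- W] by rewrite mem_nth.
have [vrs _] := weight_idemP vW.
by rewrite mulx_weight_idem // memvZ // memv_span // map_f.
Qed.

Lemma dim_gen_subalg : \dim K = size W.
Proof.
rewrite gen_subalg_span; have : free [seq e v | v <- W].
  apply: (free_separated (g := fun v y => y * e v)); first exact: uniq_weight_set.
  - by move=> v; lintac.
  - move=> u v /weight_idemP[? _] /weight_idemP[? _] uv.
    by rewrite weight_idem_mul // eq_sym (negPf uv).
  - by move=> v /weight_idemP[? /eqP ?]; rewrite weight_idem_mul // eqxx.
by rewrite /free size_map => /eqP.
Qed.

Lemma gen_subalg_weight y v : y \in K -> v \in W -> exists c, y * e v = c *: e v.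
Proof.
rewrite gen_subalg_span => yK vW; have [vrs _] := weight_idemP vW.
exists (\sum_(i < size [seq e v | v <- W])
  coord (in_tuple [seq e v | v <- W]) i y * (W`_i == v)%:R).
have yK' : y \in <<in_tuple [seq e v | v <- W]>>%VS by [].
rewrite {1}(coord_span yK') mulr_suml scaler_suml; apply: eq_bigr => i _ /=.
have iW : (i < size W)%N by rewrite -(size_map e W).
have [? _] := weight_idemP (mem_nth 0 iW).
rewrite (nth_map 0) // -scalerAl weight_idem_mul // -scalerA.
by case: eqP => _; rewrite ?scale1r ?scale0r ?scaler0.
Qed.

(** Some f e v is nonzero. As f = f e v + (f - f e v) is an orthogonal decomposition in k[x], f
    equals f e v, a multiple of e v, and being idempotent it is e v. *)
Lemma primitive_idempotent_weight f : primitive_idempotent K f ->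
  exists2 v, v \in W & f = e v.
Proof.
case=> fK f0 ff prim.
have [v vW fv] : exists2 v, v \in W & f * e v <> 0.
  have [/hasP[v vW fv]|no] := boolP (has (fun v => f * e v != 0) W).
    by exists v => //; apply/eqP.
  case: f0; rewrite -[f]mulr1 -sum_weight_idem mulr_sumr big_seq big1 // => v vW.
  by apply/eqP/negPn/negP => h; move/hasPn: no => /(_ v vW); rewrite h.
exists v => //; have [c cE] := gen_subalg_weight fK vW.
have [vrs ev0] := weight_idemP vW.
have eK := weight_idem_memK v; have C := gen_subalgC fK eK.
have ee : e v * e v = e v by rewrite weight_idem_mul // eqxx.
have gK : f * e v \in K by rewrite cE memvZ.
have ffe : f * (f * e v) = f * e v by rewrite mulrA ff.
have gg : f * e v * (f * e v) = f * e v.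
  by rewrite -mulrA (mulrA (e v)) -C -mulrA ee ffe.
have fg : f * e v * f = f * e v by rewrite -mulrA -C ffe.
have [| | | | |//|h0] := prim (f * e v) (f - f * e v) gK _ gg.
- by rewrite rpredB.
- by rewrite /Defs.idempotent mulrBl !mulrBr ff gg ffe fg subrr subr0.
- by rewrite mulrBr fg gg subrr.
- by rewrite mulrBl gg ffe subrr.
- by rewrite addrC subrK.
have fE : f = f * e v by apply/eqP; rewrite -subr_eq0 h0.
have c1 : c *: f = f by rewrite {1}fE scalerAr -cE ffe -fE.
have /eqP : (c - 1) *: f = 0 by rewrite scalerBl c1 scale1r subrr.
rewrite scaler_eq0 subr_eq0 => /orP[/eqP c1'|/eqP //].
by rewrite fE cE c1' scale1r.
Qed.

End Idempotents.

(** * Weights of the primitive element *)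

Section PrimitiveWeights.
Variables (k : closedFieldType) (H : hopfAlgType k) (x : H) (rs : seq k).
Hypotheses (px : primitive_element x) (urs : uniq rs)
  (x0 : horner_alg x (\prod_(r <- rs) ('X - r%:P)) = 0).
Local Notation S := (@antipode k H).
Local Notation eps := (@counit k H).
Local Notation e := (weight_idem x rs).
Local Notation W := (weight_set x rs).

Lemma sw_primitive (U : lmodType k) (f : H -> H -> U) : bilin f ->
  sw f x = f x 1 + f 1 x.
Proof.
case=> f1 f2; rewrite /sw px [LHS](linearD (tlift f)) /=.
by rewrite !tlift_tens.
Qed.

(** Right multiplication by comul x, under which the weights of tensors of eigenvectors add;
    [galois_r] carries right multiplication by x on the second factor to it. *)
Definition comul_mul (t : tensor H H) : tensor H H :=
  tlift (fun u v => tens (u * x) v + tens u (v * x)) t.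

Lemma lin_comul_mul : lin comul_mul. Proof. by rewrite /comul_mul; lintac. Qed.

Lemma comul_mul_tens u v : comul_mul (tens u v) = tens (u * x) v + tens u (v * x).
Proof. by rewrite /comul_mul tlift_tens // => *; lintac. Qed.

Lemma comul_mul_galois u v :
  comul_mul (galois_r (tens u v)) = galois_r (tens u (v * x)).
Proof.
rewrite !galois_r_tens swM; last by lintac.
rewrite (sw_lin _ _ lin_comul_mul); eqsw => a b; rewrite comul_mul_tens.
by rewrite sw_primitive ?mulr1 ?mulrA //; lintac.
Qed.

Lemma weight_moduleP v h : v \in rs ->
  (h \in principal_left_ideal (e v)) = (h * x == v *: h).
Proof.
move=> vrs; apply/principal_left_idealP/eqP => [[b ->]|hx].
  by rewrite -mulrA weight_idem_mulx // scalerAr.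
by exists h; rewrite weight_idem_absorb_l.
Qed.

Lemma dim_weight_module (I : finType) (w : I -> k) b beta v :
    eigenbasis (fun h : H => h * x) w b beta -> v \in rs ->
  \dim (principal_left_ideal (e v)) = #|[pred i | w i == v]|.
Proof.
move=> eb vrs; have [[hb bb bE] bx] := eb.
have hx : lin (fun h : H => h * x) by lintac.
have -> : principal_left_ideal (e v) = <<[seq b i | i <- enum [pred i | w i == v]]>>%VS.
  apply/vspaceP => h; rewrite weight_moduleP //; apply/eqP/idP => [hv|].
    rewrite [h]bE (bigID [pred i | w i == v]) /= [X in _ + X]big1 ?addr0.
      apply: memv_suml => i wi; rewrite memvZ // memv_span // map_f //.
      by rewrite mem_enum.
    move=> i wi; have := eigenbasis_coord i h hx eb; rewrite hv (linZ _ _ (hb i)).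
    move/eqP; rewrite -subr_eq0 -mulrBl mulf_eq0 subr_eq0 eq_sym (negPf wi) /=.
    by move/eqP => ->; rewrite scale0r.
  move=> hs; apply/eqP; rewrite -weight_moduleP //; apply: (subvP _ _ hs).
  apply/span_subvP => _ /mapP[i + ->]; rewrite mem_enum inE => /eqP wi.
  by rewrite weight_moduleP // bx wi.
have fr : free [seq b i | i <- enum [pred i | w i == v]].
  apply: (free_separated (g := beta)); rewrite ?enum_uniq //.
    by move=> i j _ _ ij; rewrite bb (negPf ij).
  by move=> i _; rewrite bb eqxx oner_neq0.
by move: fr; rewrite /free size_map => /eqP ->; rewrite cardE.
Qed.

Lemma primitive_weights : exists M,
  [/\ forall v, v \in W -> \dim (principal_left_ideal (e v)) = M,
      (size W * M = \dim {:H})%N & forall u v, u \in W -> v \in W -> u - v \in W].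
Proof.
have [m [mE [w [b [beta eb]]]]] := mulx_eigenbasis urs x0.
have [[hb bb bE] bx] := eb.
have cnt v : (#|'I_m| * #|[pred i | w i == v]| <=
    #|[pred q : 'I_m * 'I_m | (w q.1 + w q.2)%R == v]|)%N.
  apply: (hopf_weights (D := comul_mul) (Psi := @galois_r k H) (s := false)
    (op := +%R) eb).
  - exact: lin_comul_mul.
  - exact: lin_galois_r.
  - by move=> t t0; apply: (can_inj (@galois_rK k H)); rewrite t0 (lin0 (@lin_galois_r k H)).
  - move=> i j; rewrite comul_mul_tens !bx scalerDl.
    rewrite (linZ _ _ (f := fun u => tens u _)); last by lintac.
    by rewrite (linZ _ _ (f := tens _)) //; lintac.
  - by move=> u u'; apply: comul_mul_galois.
have opd i (u v : k) : (w i + u == v) = (u == v - w i).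
  by rewrite -subr_eq0 -[RHS]subr_eq0 opprB addrCA addrA addrAC.
have [M [wM sM wd]] := uniform_weights (d := fun u v => u - v) (@addrC k) opd cnt.
(* The numbers with nonzero idempotent are the weights of the eigenbasis, because He_v is the
   eigenspace of right multiplication by x for v. *)
have WE v : (v \in W) = (v \in codom w).
  apply/idP/codomP => [/weight_idemP[vrs ev0]|[i ->]].
    have : (0 < \dim (principal_left_ideal (e v)))%N.
      rewrite lt0n dimv_eq0; apply/negP => /eqP z; apply: ev0; apply/eqP.
      rewrite -memv0 -z; apply/principal_left_idealP; exists 1.
      by rewrite mul1r.
    rewrite (dim_weight_module eb vrs) => /card_gt0P[i]; rewrite inE => /eqP wi.
    by exists i.
  have bi0 : b i != 0.
    apply/eqP => /(congr1 (beta i)); rewrite bb eqxx (lin0 (hb i)) => /eqP.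
    by apply/negP; apply: oner_neq0.
  have wrs : w i \in rs.
    have := horner_algl (\prod_(r <- rs) ('X - r%:P)) (bx i).
    rewrite x0 mulr0 => /esym/eqP; rewrite scaler_eq0 (negPf bi0) orbF.
    by rewrite -rootE root_prod_XsubC.
  rewrite mem_filter wrs andbT; apply: contraNneq bi0 => ev0.
  by rewrite -(weight_idem_absorb_l wrs (bx i)) ev0 mulr0.
have sW : size W = size (undup (codom w)).
  apply/perm_size/uniq_perm; rewrite ?undup_uniq ?uniq_weight_set // => v.
  by rewrite mem_undup WE.
exists M; split=> [v||u v].
- rewrite WE => /codomP[i vE]; have : v \in W by rewrite WE vE codom_f.
  by case/weight_idemP => vrs _; rewrite (dim_weight_module eb vrs) vE wM.
- by rewrite sW sM card_ord mE dimvf.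
rewrite !WE => /codomP[i ->] /codomP[j ->]; have [l <-] := wd i j.
exact: codom_f.
Qed.

End PrimitiveWeights.

(** * Traces and unipotent operators *)

Lemma mx_unipotent_pchar (k : fieldType) p n (M : 'M[k]_n) :
    p \in [pchar k] -> p = n -> char_poly M = ('X - 1) ^+ n ->
  forall u : 'rV_n, iter p (mulmx^~ M) u = u.
Proof.
move=> pk pn; case: n M pn => [|n] M pn MX u; first by apply/rowP; case.
have iterM q : iter q (mulmx^~ M) u = u *m M ^+ q.
  by elim: q => [|q IH] /=; rewrite ?mulmx1 // IH -mulmxA exprSr.
rewrite iterM; suff -> : M ^+ p = 1 by rewrite mulmx1.
have XE : ('X - 1) ^+ p = 'X^p - 1 :> {poly k}.
  by have := exp_XsubC_pchar pk 1 1; rewrite expr1n expn1.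
have := Cayley_Hamilton M; rewrite MX -[X in _ ^+ X]pn XE rmorphB rmorphXn /= rmorph1 horner_mx_X.
by move/eqP; rewrite subr_eq0 => /eqP.
Qed.

Section Trace.
Variables (k : closedFieldType) (V : vectType k).
Variable G : V -> V.
Hypothesis hG : lin G.

Let M : 'M[k]_(dim V) := \matrix_(i, j) basis_coord j (G (basis_vec i)).

Let ME v : v2r (G v) = v2r v *m M.
Proof.
apply/rowP => j; rewrite [RHS]mxE -[LHS]/(basis_coord j (G v)).
rewrite (lin_basisE (f := fun v => basis_coord j (G v))); last exact: lin_comp (lin_basis_coord j) hG.
by apply: eq_bigr => i _; rewrite mxE.
Qed.

(** The list holds the roots of the characteristic polynomial with multiplicity. In the last clause
    this polynomial is (X - 1)^p = X^p - 1, and Cayley-Hamilton applies. *)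
Lemma trl_eigenvalues : exists rs : seq k,
  [/\ size rs = dim V, trl G = \sum_(r <- rs) r,
      forall r, r \in rs <-> exists2 v, v <> 0 & G v = r *: v
    & (0 < dim V)%N -> (forall r, r \in rs -> r = 1) ->
      forall p, p \in [pchar k] -> p = dim V -> forall v, iter p G v = v].
Proof.
have [rs Mrs] := closed_field_poly_normal (char_poly M).
rewrite (eqP (char_poly_monic M)) scale1r in Mrs.
have srs : size rs = dim V.
  by apply/succn_inj; rewrite -(size_char_poly M) Mrs size_prod_XsubC.
exists rs; split=> // [|r|V0 rs1 p pk pV v].
- have [V0|V0] := posnP (dim V).
    rewrite (size0nil (etrans srs V0)) big_nil /trl.
    by apply: big1 => i; have := ltn_ord i; rewrite {2}V0.
  have -> : trl G = \tr M by apply: eq_bigr => i _; rewrite mxE.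
  apply: oppr_inj; rewrite -char_poly_trace // Mrs -srs.
  by rewrite coefPn_prod_XsubC // srs -lt0n.
- have -> : (r \in rs) = eigenvalue M r.
    by rewrite eigenvalue_root_char Mrs root_prod_XsubC.
  split=> [/eigenvalueP[u uM u0]|[v v0 Gv]].
    exists (r2v u).
      by move=> /(congr1 v2r); rewrite r2vK linear0 => /eqP; apply/negP.
    by rewrite -[LHS]v2rK ME r2vK uM linearZ.
  apply/eigenvalueP; exists (v2r v); first by rewrite -ME Gv linearZ.
  by apply/eqP => /(congr1 r2v); rewrite v2rK linear0.
have iterM q : v2r (iter q G v) = iter q (mulmx^~ M) (v2r v).
  by elim: q => //= q <-; rewrite ME.
rewrite -[LHS]v2rK iterM -[RHS]v2rK; congr r2v.
apply: mx_unipotent_pchar => //; rewrite Mrs -[in RHS]srs.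
elim: (rs) rs1 => [|r s IH] rs1; first by rewrite big_nil.
rewrite big_cons IH => [|q qs]; last by apply: rs1; rewrite inE qs orbT.
by rewrite (rs1 r) ?inE ?eqxx //= exprS polyC1.
Qed.

Lemma trl_nilpotent m : (forall v, iter m G v = 0) -> trl G = 0.
Proof.
move=> Gm; have [rs [_ -> ev _]] := trl_eigenvalues.
rewrite big_seq big1 // => r /ev[v v0 Gv].
have e q : iter q G v = r ^+ q *: v.
  elim: q => [|q IH] /=; first by rewrite scale1r.
  by rewrite IH (linZ _ _ hG) Gv scalerA -exprSr.
have /eqP := Gm v; rewrite e scaler_eq0 expf_eq0 => /orP[/andP[_ /eqP]//|/eqP//].
Qed.

(* The eigenvalues are 1 and -1; both multiplicities being determined modulo p
   by their sum p and their difference 0, one of them is p. *)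
Lemma trl0_unipotent p a : p \in [pchar k] -> (2 < p)%N -> dim V = p ->
    trl G = 0 -> (forall v, iter (p ^ a * 2) G v = v) ->
    (exists2 v, v <> 0 & G v = v) ->
  forall v, iter p G v = v.
Proof.
move=> pk p2 dV tr0 Gq [v1 v10 Gv1].
have pp := pcharf_prime pk.
have [rs [srs trE ev uni]] := trl_eigenvalues.
have pm1 r : r \in rs -> (r == 1) || (r == -1).
  move=> /ev[v v0 Gv]; have e q : iter q G v = r ^+ q *: v.
    elim: q => [|q IH] /=; first by rewrite scale1r.
    by rewrite IH (linZ _ _ hG) Gv scalerA -exprSr.
  have := Gq v; rewrite e mulnC exprM => /eqP.
  rewrite -subr_eq0 -[X in _ - X]scale1r -scalerBl scaler_eq0.
  case/orP => [|/eqP//]; rewrite subr_eq0 => /eqP h.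
  rewrite -sqrf_eq1; apply/eqP; apply: (expr_pchar_inj pk (a := a)).
  by rewrite /= expr1n.
have r1 : (0 < count_mem 1%R rs)%N.
  by rewrite -has_count has_pred1; apply/ev; exists v1 => //; rewrite scale1r.
(* Since r + 1 is 2 for r = 1 and 0 for r = -1, trace plus dimension counts the eigenvalues 1
   twice. *)
have sumE (s : seq k) : (forall r, r \in s -> (r == 1) || (r == -1)) ->
    \sum_(r <- s) r + (size s)%:R = (count_mem 1 s).*2%:R :> k.
  elim: s => [|r s IH] hs; first by rewrite big_nil addr0.
  have {}IH := IH (fun q qs => hs q (mem_behead (s := r :: s) qs)).
  rewrite big_cons /= -add1n natrD addrACA IH doubleD natrD; congr (_ + _).
  have /orP[/eqP->|/eqP->] := hs r (mem_head _ _); first by rewrite eqxx.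
  rewrite addNr; have /negbTE -> // : (-1 : k) != 1.
  rewrite eq_sym -addr_eq0 -[1 + 1]/(2%:R) -(dvdn_pcharf pk).
  by rewrite gtnNdvd.
have pc : (p %| count_mem 1%R rs)%N.
  have := sumE rs pm1; rewrite -trE tr0 add0r srs dV (pcharf0 pk) => /esym/eqP.
  rewrite -(dvdn_pcharf pk) -mul2n Euclid_dvdM // => /orP[|//].
  by rewrite gtnNdvd.
have all1 : all (pred1 1) rs.
  rewrite all_count eqn_leq count_size srs dV dvdn_leq //.
apply: uni => //; first by rewrite dV prime_gt0.
by move=> r rr; move/allP: all1 => /(_ r rr)/eqP.
Qed.

End Trace.

(** * Indecomposability *)

Section Restriction.
Variables (k : fieldType) (V : vectType k) (U : {vspace V}) (F : V -> V).
Hypotheses (hF : lin F) (FU : forall u, u \in U -> F u \in U).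

Definition vrestrict (u : subvs_of U) : subvs_of U := vsproj U (F (vsval u)).

Lemma lin_vrestrict : lin vrestrict.
Proof. by move=> c u v; rewrite /vrestrict [vsval _]linearP hF; apply: linearP. Qed.

Lemma vrestrictE u : vsval (vrestrict u) = F (vsval u).
Proof. by rewrite vsprojK // FU // subvsP. Qed.

Lemma iter_vrestrictE q u : vsval (iter q vrestrict u) = iter q F (vsval u).
Proof. by elim: q => //= q IH; rewrite vrestrictE IH. Qed.

(** F is the inclusion of U after a map into U, and exchanging the two does not change the trace. *)
Lemma trl_vrestrict : (forall h, F h \in U) -> trl vrestrict = trl F.
Proof.
move=> FhU; rewrite (eq_trl (G := fun h => vsval (vsproj U (F h)))); last first.
  by move=> h; rewrite vsprojK.
rewrite (trl_comm (A := vsval) (B := fun h => vsproj U (F h))) //.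
by move=> c u v; rewrite hF; apply: linearP.
Qed.

End Restriction.

Section Idempotent.
Variables (k : closedFieldType) (A : falgType k).
Local Notation PLI := (@principal_left_ideal k A).

Lemma exists_annihilator (b : A) : exists2 P : {poly k}, P != 0 & horner_alg b P = 0.
Proof.
have A0 : (0 < dim A)%N by rewrite -dimvf adim_gt0.
have [m [phi [psi [hphi hpsi phiK psiK _]]]] := matrix_model A0.
have [M bM] := exists_matrix (F := fun h => h * b) hphi hpsi (lin_mulr b (lin_id (U := A))).
exists (char_poly M); first exact: monic_neq0 (char_poly_monic M).
rewrite -[LHS]phiK -[horner_alg _ _]mul1r -[1]phiK.
by rewrite (horner_model _ _ hphi hpsi phiK psiK bM) Cayley_Hamilton mulmx0 (lin0 hpsi).
Qed.

Definition rtr (a : A) : k^o := trl (fun h => h * a).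

Lemma lin_rtr : lin rtr.
Proof.
move=> c u v; rewrite /rtr /trl scaler_sumr -big_split; apply: eq_bigr => i _.
by rewrite mulrDr -scalerAr lin_basis_coord.
Qed.

Variable f : A.
Hypotheses (ff : f * f = f) (f0 : f <> 0).

Lemma mem_principal a : (a \in PLI f) = (a * f == a).
Proof.
apply/principal_left_idealP/eqP => [[b ->]|<-]; first by rewrite -mulrA ff.
by exists a.
Qed.

Lemma principal_gt0 : (0 < \dim (PLI f))%N.
Proof.
rewrite lt0n dimv_eq0; apply/negP => /eqP z; apply: f0; apply/eqP.
by rewrite -memv0 -z mem_principal ff.
Qed.

Lemma rtr_idem : rtr f = (\dim (PLI f))%:R :> k.
Proof.
have hF : lin (fun h : A => h * f) by lintac.
rewrite /rtr -(trl_vrestrict (U := PLI f) hF) => [|h]; last first.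
  by rewrite mem_principal -mulrA ff.
rewrite (eq_trl (G := fun u => u)) => [|u]; last first.
  apply: val_inj; rewrite /= vrestrictE => [|h]; last by rewrite !mem_principal -mulrA ff.
  by apply/eqP; rewrite -mem_principal subvsP.
rewrite /trl (eq_bigr (fun=> 1)) => [|i _]; last by rewrite basis_coord_vec eqxx.
by rewrite sumr_const card_ord.
Qed.

Lemma rtr_nilpotent b m : b ^+ m = 0 -> rtr b = 0 :> k.
Proof.
move=> bm; apply: (@trl_nilpotent _ _ _ _ m) => [|v]; first by lintac.
suff -> : iter m (fun h => h * b) v = v * b ^+ m by rewrite bm mulr0.
by elim: m {bm} => [|m IH] /=; rewrite ?mulr1 // IH exprSr mulrA.
Qed.

Hypothesis prim : forall q, q * q = q -> f * q = q -> q * f = q -> q = 0 \/ q = f.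

(* Fitting's lemma: a power of a - c f divides an idempotent of fAf, which
   vanishes when c is an eigenvalue of the multiplication by a on Af. *)
Lemma scalar_plus_nilpotent a : f * a = a -> a * f = a ->
  exists c m, (a - c *: f) ^+ m.+1 = 0.
Proof.
move=> fa af.
have hF : lin (fun h : A => h * a) by lintac.
have [rs [srs _ ev _]] := trl_eigenvalues (lin_vrestrict (U := PLI f) hF).
have [c crs] : exists c, c \in rs.
  case: rs srs {ev} => [/= d0|c rs _]; last by exists c; rewrite mem_head.
  by have := principal_gt0; rewrite -[\dim _]d0.
have [u u0 /(congr1 vsval)] := (ev c).1 crs.
rewrite vrestrictE => [/= uc|h]; last first.
  by rewrite !mem_principal -mulrA af.
have uf : vsval u * f = vsval u by apply/eqP; rewrite -mem_principal subvsP.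
set b := a - c *: f.
have ub : vsval u * b = 0 by rewrite /b mulrBr uc -scalerAr uf subrr.
have fb : f * b = b by rewrite /b mulrBr fa -scalerAr ff.
have bf : b * f = b by rewrite /b mulrBl af -scalerAl ff.
have [P P0 Pb] := exists_annihilator b.
have [m [Q]] := multiplicity_XsubC P 0.
rewrite P0 /= subr0 => Q0 PE.
have /Bezout_eq1_coprimepP [[X Y] /= XY] : coprimep ('X ^+ m.+1) Q.
  apply: coprimep_expl; rewrite coprimep_sym.
  by rewrite -[X in coprimep _ X]subr0 coprimep_XsubC.
exists c, m; rewrite -/b.
have hb q : horner_alg b ('X ^+ q) = b ^+ q by rewrite rmorphXn /= horner_algX.
set q := horner_alg b (X * 'X^(m.+1)).
set r := horner_alg b (Y * Q).
have qr1 : q + r = 1 by rewrite -rmorphD /= XY rmorph1.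
have bQ : b ^+ m.+1 * horner_alg b Q = 0.
  rewrite -hb -rmorphM /= exprS -mulrA [_ ^+ m * Q]mulrC -PE rmorphM /= Pb.
  by rewrite mulr0.
have br : b ^+ m.+1 * r = 0.
  by rewrite /r [Y * Q]mulrC rmorphM /= mulrA bQ mul0r.
have qE : q = horner_alg b X * b ^+ m.+1 by rewrite /q rmorphM /= hb.
have qE' : q = b ^+ m.+1 * horner_alg b X by rewrite /q mulrC rmorphM /= hb.
have qr0 : q * r = 0 by rewrite qE -mulrA br mulr0.
have qq : q * q = q by rewrite -[RHS]mulr1 -qr1 mulrDr qr0 addr0.
have [||q0|qf] := prim qq.
- by rewrite qE' mulrA exprS mulrA fb.
- by rewrite qE -mulrA exprSr -!mulrA bf.
- by rewrite -[LHS]mulr1 -qr1 mulrDr q0 mulr0 br addr0.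
case: u0; apply: val_inj; transitivity (0 : A); last exact: esym (linear0 vsval).
have uq : vsval u * q = 0 by rewrite qE' exprS !mulrA ub !mul0r.
by move: uq; rewrite qf uf.
Qed.

(** a is c f plus a nilpotent. If c were 0, a would be nilpotent, of trace 0; so c is invertible and
    a geometric series gives the left inverse. *)
Lemma rtr_neq0_inv a : f * a = a -> a * f = a -> rtr a != 0 ->
  exists a', a' * a = f.
Proof.
move=> fa af ra; have [c [m]] := scalar_plus_nilpotent fa af.
set b := _ - _ => bm; have fb : f * b = b by rewrite /b mulrBr fa -scalerAr ff.
have bf : b * f = b by rewrite /b mulrBl af -scalerAl ff.
have aE : a = b + c *: f by rewrite subrK.
have c0 : c != 0.
  apply: contraNneq ra => c0; apply/eqP.
  by apply: (rtr_nilpotent (m := m.+1)); rewrite aE c0 scale0r addr0.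
pose n := - c^-1 *: b; pose s := \sum_(i < m.+1) n ^+ i.
have nm : n ^+ m.+1 = 0 by rewrite exprZn bm scaler0.
have sn : s * (1 - n) = 1.
  have := subrX1 n m.+1; rewrite nm sub0r -/s => /eqP.
  rewrite eqr_oppLR -mulNr opprB => /eqP h; rewrite [RHS]h.
  apply: esym; apply: commr_sum => i _; apply: commrX.
  by rewrite /GRing.comm mulrBl mulrBr mulr1 mul1r.
exists (c^-1 *: s); rewrite -scalerAl.
have -> : a = c *: ((1 - n) * f).
  rewrite mulrBl mul1r /n -scalerAl bf scaleNr opprK scalerDr scalerA divff //.
  by rewrite scale1r addrC.
by rewrite -scalerAr mulrA sn mul1r scalerA mulVf // scale1r.
Qed.

End Idempotent.

(** * Idempotents and their conjugates under an endomorphism with vanishing traces *)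

Section Twisted.
Variables (k : closedFieldType) (p : nat) (A : falgType k) (sg : A -> A).
Hypotheses (pk : p \in [pchar k]) (hsg : lin sg)
  (sgM : forall a b, sg (a * b) = sg a * sg b) (sg1 : sg 1 = 1)
  (tr0 : forall a, trl (fun h => sg h * a) = 0).
Local Notation PLI := (@principal_left_ideal k A).

Lemma iter_sgM q a b : iter q sg (a * b) = iter q sg a * iter q sg b.
Proof. by elim: q => //= q ->; rewrite sgM. Qed.

Lemma lin_iter_sg q : lin (iter q sg).
Proof. by elim: q => [|q IH] //=; apply: lin_comp hsg IH. Qed.

Section Primitive.
Variable f : A.
Hypotheses (ff : f * f = f) (f0 : f <> 0)
  (prim : forall q, q * q = q -> f * q = q -> q * f = q -> q = 0 \/ q = f)
  (dim_unit : (\dim (PLI f))%:R != 0 :> k)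
  (sgp : forall h, h * f = h -> iter p sg h = h).

Let sgf q : iter q sg f * iter q sg f = iter q sg f.
Proof. by rewrite -iter_sgM ff. Qed.

(** The product sg^(q-1)(a) ... sg(a) a, which arises from the iterates of h |-> sg h a. *)
Fixpoint twisted_norm (a : A) (q : nat) : A :=
  if q is q'.+1 then sg (twisted_norm a q') * a else 1.

Lemma iter_twist a q h :
  iter q (fun h => sg h * a) h = iter q sg h * twisted_norm a q.
Proof.
elim: q => [|q IH] /=; first by rewrite mulr1.
by rewrite IH sgM mulrA.
Qed.

Lemma twisted_normr a q : a * f = a -> twisted_norm a q.+1 * f = twisted_norm a q.+1.
Proof. by move=> af /=; rewrite -mulrA af. Qed.

Lemma twisted_norml a q : sg f * a = a -> iter q.+1 sg f * twisted_norm a q.+1 = twisted_norm a q.+1.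
Proof.
move=> fa; elim: q => [|q IH] /=; first by rewrite sg1 mul1r.
by rewrite mulrA -sgM -/(iter q.+1 sg f) IH.
Qed.

(* The p-th power of h |-> sg h * a acts on Af as the norm, that is, as a scalar
   up to a nilpotent; its trace being 0, so is the scalar. *)
Lemma twisted_norm_nilpotent a : sg f * a = a -> a * f = a ->
  exists m, twisted_norm a p ^+ m = 0.
Proof.
move=> fa af; have pE := prednK (prime_gt0 (pcharf_prime pk)).
set N := twisted_norm a p.
have Nf : N * f = N by rewrite /N -pE twisted_normr.
have fN : f * N = N by rewrite -{1}(sgp ff) /N -pE twisted_norml.
have [c [m Nc]] := scalar_plus_nilpotent ff f0 prim fN Nf.
pose F h := sg h * a.
have hF : lin F by rewrite /F; lintac.
have FU h : F h \in PLI f by rewrite mem_principal // /F -mulrA af.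
have [rs [srs trE ev _]] := trl_eigenvalues (lin_vrestrict (U := PLI f) hF).
have rc r : r \in rs -> r ^+ p = c.
  case/ev => u u0 ur; have uf : vsval u * f = vsval u.
    by apply/eqP; rewrite -mem_principal // subvsP.
  have e q : iter q (vrestrict F) u = r ^+ q *: u.
    elim: q => [|q IH] /=; first by rewrite scale1r.
    by rewrite IH (linZ _ _ (lin_vrestrict hF)) ur scalerA -exprSr.
  have : vsval u * (N - c *: f) = (r ^+ p - c) *: vsval u.
    have := congr1 vsval (e p); rewrite iter_vrestrictE // iter_twist sgp // -/N.
    rewrite linearZ /= mulrBr => ->.
    by rewrite -scalerAr uf scalerBl.
  set b := N - _ => ub.
  have ubq q : vsval u * b ^+ q = (r ^+ p - c) ^+ q *: vsval u.
    elim: q => [|q IH]; first by rewrite mulr1 scale1r.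
    by rewrite exprS mulrA ub -scalerAl IH scalerA -exprS.
  have /esym/eqP := ubq m.+1; rewrite Nc mulr0 scaler_eq0 expf_eq0 /= subr_eq0.
  case/orP => [/eqP//|/eqP z]; case: u0; apply: val_inj.
  by rewrite [LHS]z; apply: esym (linear0 vsval).
have c0 : c = 0.
  have dpos := principal_gt0 ff f0.
  have [r0 r0rs] : exists r, r \in rs.
    case: (rs) srs => [/= d0|r s _]; last by exists r; rewrite mem_head.
    by move: dpos; rewrite -[\dim _]d0.
  (* All eigenvalues have the p-th power c, so they coincide in characteristic p; the trace is dim
     (Af) times this common value, and the dimension is a unit. *)
  have rr r : r \in rs -> r = r0.
    move=> rrs; apply: (expr_pchar_inj pk (a := 1)); rewrite /= expn1.
    by rewrite !rc.
  have : trl (vrestrict (U := PLI f) F) = r0 *+ \dim (PLI f).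
    rewrite trE -[\dim _]srs big_seq (eq_bigr (fun=> r0)) => [|r /rr //].
    by rewrite -big_seq big_const_seq count_predT iter_addr_0.
  rewrite trl_vrestrict // [trl F]tr0 -mulr_natr => /esym/eqP.
  rewrite mulf_eq0 (negPf dim_unit) orbF => /eqP r00.
  by rewrite -(rc r0) // r00 expr0n -pE.
by exists m.+1; move: Nc; rewrite c0 scale0r subr0.
Qed.

(** A left inverse of a yields a left inverse D of the norm N, and D^(m+1) N^(m+1) = f contradicts
    the nilpotency of N. *)
Lemma twisted_norm_inv a a' : sg f * a = a -> a * f = a -> a' * a = f -> False.
Proof.
move=> fa af aa; have pE := prednK (prime_gt0 (pcharf_prime pk)).
have [m Nm] := twisted_norm_nilpotent fa af.
have [D DN] : exists D, D * twisted_norm a p = f.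
  rewrite -pE; elim: p.-1 => [|q [D DN]]; first by exists a'; rewrite /= sg1 mul1r.
  by exists (a' * sg D); rewrite /= mulrA -(mulrA a') -sgM DN -mulrA fa aa.
set N := twisted_norm a p in Nm DN.
have fN : f * N = N by rewrite -{1}(sgp ff) /N -pE twisted_norml.
have DmN q : D ^+ q.+1 * N ^+ q.+1 = f.
  elim: q => [|q IH]; first by rewrite !expr1.
  by rewrite exprSr [N ^+ _]exprS -mulrA (mulrA D) DN [N ^+ _]exprS (mulrA f) fN -exprS.
by apply: f0; rewrite -(DmN m) [N ^+ _]exprSr Nm mul0r mulr0.
Qed.

Let sgpf q : iter (p * q) sg f = f.
Proof.
elim: q => [|q IH]; first by rewrite muln0.
by rewrite mulnS iterD IH sgp.
Qed.

(* A chain b : f -> sg^i f of isomorphisms, followed until sg^(ij) f = sg f,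
   would give an invertible element of sg f A f. *)
Lemma rtr_twist_eq0 i b b' : (0 < i < p)%N ->
    iter i sg f * b = b -> b * f = b -> f * b' = b' -> b' * iter i sg f = b' ->
  rtr (b' * b) = 0 :> k.
Proof.
case/andP=> i0 ip fb bf fb' bf'; apply/eqP/negPn/negP => nz.
have pp := pcharf_prime pk.
have [||c cbb] := rtr_neq0_inv ff f0 prim _ _ nz.
- by rewrite mulrA fb'.
- by rewrite -mulrA bf.
pose beta := c * b'.
have bb : beta * b = f by rewrite /beta -mulrA.
have betaf : beta * iter i sg f = beta by rewrite /beta -mulrA bf'.
pose B := fix B q := if q is q'.+1 then iter i sg (B q') * b else f.
pose C := fix C q := if q is q'.+1 then beta * iter i sg (C q') else f.
have Bf q : B q * f = B q by case: q => [|q] /=; rewrite ?ff // -mulrA bf.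
have fB q : iter (i * q) sg f * B q = B q.
  elim: q => [|q IH]; first by rewrite muln0 /= ff.
  by rewrite mulnS iterD /= mulrA -iter_sgM IH.
have CB q : C q * B q = f.
  elim: q => [|q IH] /=; first exact: ff.
  by rewrite -mulrA (mulrA _ _ b) -iter_sgM IH fb.
have [j [s js]] : exists j s, (i * j = p * s + 1)%N.
  have : coprime i p by rewrite coprime_sym prime_coprime // gtnNdvd.
  case/(coprimeP _ i0) => -[j s] /= e; exists j, s.
  by rewrite mulnC [(p * s)%N]mulnC -e subnKC // ltnW // -subn_gt0 e.
apply: (twisted_norm_inv (a := B j) (a' := C j)) => //.
have -> : sg f = iter (i * j) sg f by rewrite js addn1 iterS sgpf.
exact: fB.
Qed.

(** The functionals T j y = rtr (f sg^(p-j)(y) f) separate the conjugates F i = sg^i f: T j (F i) =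
    0 for i <> j by [rtr_twist_eq0], while T j (F j) is dim (Af), a unit. So the p conjugates form a
    basis of Ae. As T j also vanishes on Af for 0 < j < p, the elements of Af involve only F 0 =
    f. *)
Lemma twist_orbit_line (e : A) : e * e = e -> sg e = e -> f * e = f ->
    \dim (PLI e) = p ->
  forall h, exists c : k, h * f = c *: f.
Proof.
move=> ee se fe dime h.
have pp := pcharf_prime pk; have p0 := prime_gt0 pp.
pose F i := iter i sg f; have FF i : F i * F i = F i by apply: sgf.
pose T j y := rtr (f * iter (p - j) sg y * f).
have hT j : lin (T j).
  move=> c u v; rewrite /T -lin_rtr lin_iter_sg mulrDr mulrDl.
  by rewrite -scalerAr -scalerAl.
have T0 j y : (0 < j < p)%N -> y * f = y -> T j y = 0.
  move=> /andP[j0 jp] yf; have lp : (0 < p - j < p)%N.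
    by rewrite subn_gt0 jp -{2}(subn0 p) ltn_sub2l.
  rewrite /T -{1}yf iter_sgM -/(F (p - j)%N) -FF.
  have -> : f * (iter (p - j) sg y * (F (p - j)%N * F (p - j)%N)) * f =
    (f * (iter (p - j) sg y * F (p - j)%N)) * (F (p - j)%N * f) by rewrite !mulrA.
  apply: (rtr_twist_eq0 lp); rewrite -/(F _) ?mulrA ?FF ?ff //.
    by rewrite -mulrA ff.
  by rewrite -!mulrA FF.
have TF j i : (j < p)%N -> (i < p)%N -> j != i -> T j (F i) = 0.
  move=> jp ip ji; rewrite /T /F -iterD.
  (* The exponent p - j + i is reduced modulo p, the period of sg on f. *)
  have [l lp ->] : exists2 l, (0 < l < p)%N & iter (p - j + i) sg f = F l.
    case: (ltngtP j i) ji => // ji _.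
      exists (i - j)%N; first by rewrite subn_gt0 ji (leq_ltn_trans (leq_subr _ _)).
      rewrite addnC addnBA ?(ltnW jp) // -addnBAC ?(ltnW ji) // iterD.
      by rewrite sgp.
    exists (p - j + i)%N => //; rewrite ltn_addr ?subn_gt0 //=.
    by rewrite -ltn_subRL subKn // ltnW.
  rewrite -FF; have -> : f * (F l * F l) * f = (f * F l) * (F l * f) by rewrite !mulrA.
  apply: (rtr_twist_eq0 lp); rewrite -/(F _) ?mulrA ?FF ?ff //.
    by rewrite -mulrA ff.
  by rewrite -!mulrA FF.
have TFF j : (j < p)%N -> T j (F j) != 0.
  move=> jp; rewrite /T /F -iterD subnK ?(ltnW jp) // sgp // !ff.
  by rewrite rtr_idem.
set X := [seq F i | i <- iota 0 p].
have freeX : free X.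
  apply: (free_separated (g := T)) => //; first exact: iota_uniq.
    by move=> j i; rewrite !mem_iota; apply: TF.
  by move=> j; rewrite mem_iota; apply: TFF.
have XE : <<X>>%VS = PLI e.
  apply/eqP; rewrite eqEdim dime; apply/andP; split.
    apply/span_subvP => _ /mapP[i _ ->]; rewrite mem_principal //.
    have {1}<- : iter i sg e = e by elim: i => //= i ->.
    by rewrite -iter_sgM fe.
  by move: freeX; rewrite /free size_map size_iota => /eqP ->.
set a := h * f; have af : a * f = a by rewrite /a -mulrA ff.
have aX : a \in <<in_tuple X>>%VS by rewrite [<<_>>%VS]XE mem_principal // -af -mulrA fe.
have sX : size X = p by rewrite size_map size_iota.
have nthX i : (i < p)%N -> X`_i = F i.
  by move=> ip; rewrite (nth_map 0%N) ?size_iota // nth_iota.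
have coord0 (j : 'I_(size X)) : (0 < j)%N -> coord (in_tuple X) j a = 0.
  move=> j0; have jp : (j < p)%N by rewrite -sX.
  have := T0 j a; rewrite j0 jp => /(_ isT af).
  rewrite {1}(coord_span aX) (lin_bigsum _ _ _ (hT j)) (bigD1 j) //= big1 => [|i ij].
    rewrite addr0 (linZ _ _ (hT j)) nthX // => /eqP.
    by rewrite scaler_eq0 (negPf (TFF j jp)) orbF => /eqP.
  have ip : (i < p)%N by rewrite -sX.
  by rewrite (linZ _ _ (hT j)) nthX // TF ?scaler0 // eq_sym.
have sX0 : (0 < size X)%N by rewrite sX.
exists (coord (in_tuple X) (Ordinal sX0) a).
rewrite -/a {1}(coord_span aX) (bigD1 (Ordinal sX0)) //= big1 => [|i i0].
  by rewrite addr0 nthX.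
rewrite coord0 ?scale0r // lt0n; apply: contraNneq i0 => i0.
by apply/eqP/val_inj.
Qed.

End Primitive.

Lemma exists_primitive_idem (q : A) : q * q = q -> q <> 0 ->
  exists f, [/\ f * f = f, f <> 0, q * f = f, f * q = f &
    (\dim (PLI f) <= \dim (PLI q))%N /\
    forall r, r * r = r -> f * r = r -> r * f = r -> r = 0 \/ r = f].
Proof.
have [n] := ubnP (\dim (PLI q)); elim: n q => // n IH q /ltnSE dq qq q0.
have [[r [rr qr rq r0 rnq]]|no] := classic (exists r,
  [/\ r * r = r, q * r = r, r * q = r, r <> 0 & r <> q]).
  have sub : (PLI r <= PLI q)%VS.
    apply/subvP => h; rewrite !mem_principal // => /eqP <-.
    by rewrite -mulrA rq.
  have lt : (\dim (PLI r) < \dim (PLI q))%N.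
    rewrite ltn_neqAle dimvS // andbT; apply/eqP => de; apply: rnq.
    have E : PLI r = PLI q by apply/eqP; rewrite eqEdim sub de leqnn.
    have : q \in PLI r by rewrite E mem_principal // qq.
    by rewrite mem_principal // => /eqP <-.
  have [f [f1 f2 f3 f4 [f5 f6]]] := IH r (leq_trans lt dq) rr r0.
  exists f; split=> //.
  - by rewrite -f3 mulrA qr.
  - by rewrite -f4 -mulrA rq.
  - by split=> //; apply: leq_trans f5 (ltnW lt).
exists q; split=> //; split=> // r rr qr rq; have [r0|r0] := classic (r = 0); first by left.
by right; apply: NNPP => rnq; apply: no; exists r.
Qed.

(** A proper idempotent q below e contains a primitive f with 0 < dim (Af) < p, so this dimension is
    a unit in k, as [twist_orbit_line] requires. *)
Lemma no_idempotent (e : A) : e * e = e -> e <> 0 -> sg e = e ->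
    \dim (PLI e) = p -> (forall h, h * e = h -> iter p sg h = h) ->
    (forall f : A, f * f = f -> f <> 0 -> ~ (forall h, exists c : k, h * f = c *: f)) ->
  forall q, q * q = q -> e * q = q -> q * e = q -> q = 0 \/ q = e.
Proof.
move=> ee e0 se dime sgp noline q qq eq qe.
have [q0|q0] := classic (q = 0); [by left | right].
apply: NNPP => qne.
have [f [ff f0 qf fq [df prim]]] := exists_primitive_idem qq q0.
have fe : f * e = f by rewrite -fq -mulrA qe.
have dqp : (\dim (PLI q) < p)%N.
  rewrite -dime; have sub : (PLI q <= PLI e)%VS.
    apply/subvP => h; rewrite !mem_principal // => /eqP <-.
    by rewrite -mulrA qe.
  rewrite ltn_neqAle dimvS // andbT; apply/eqP => de; apply: qne.
  have E : PLI q = PLI e by apply/eqP; rewrite eqEdim sub de leqnn.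
  have : e \in PLI q by rewrite E mem_principal // ee.
  by rewrite mem_principal // eq => /eqP.
have du : (\dim (PLI f))%:R != 0 :> k.
  rewrite -(dvdn_pcharf pk) gtnNdvd ?principal_gt0 //.
  exact: leq_ltn_trans df dqp.
apply: (noline f ff f0); apply: (twist_orbit_line ff f0 prim du _ ee se fe dime).
by move=> h hf; apply: sgp; rewrite -hf -mulrA fe.
Qed.

End Twisted.

(** * Consequences of nonsemisimplicity *)

Section Nonsemisimple.
Variables (k : closedFieldType) (H : hopfAlgType k).
Hypothesis ns : ~ semisimple_algebra H.
Local Notation S := (@antipode k H).
Local Notation eps := (@counit k H).

Lemma lin_inj_surj (V : vectType k) (F : V -> V) : lin F -> injective F ->
  forall y, exists x, F x = y.
Proof.
move=> hF injF y; have [G GE] := lin_hom hF.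
have k0 : lker G == 0%VS.
  apply/eqP/vspaceP => h; rewrite memv_ker memv0 GE.
  apply/eqP/eqP => [h0|->]; last exact: lin0.
  by apply: injF; rewrite h0 lin0.
by exists (G^-1%VF y); rewrite -GE; apply: lker0_lfunVK.
Qed.

(* A one-dimensional projective module; twisted by its character, it becomes
   trivial and yields an integral not killed by the counit. *)
Lemma no_projective_line (f : H) : f * f = f -> f <> 0 ->
  ~ (forall h, exists c : k, h * f = c *: f).
Proof.
move=> ff f0 line.
have [i fi] : exists i, hcoord i f != 0.
  apply: NNPP => no; apply: f0; apply: hcoord_inj => i; rewrite (lin0 (lin_hcoord i)).
  by apply/eqP/negPn/negP => h; apply: no; exists i.
pose chi h : k^o := hcoord i (h * f) / hcoord i f.
have chiE h : h * f = (chi h : k) *: f.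
  have [c cE] := line h; rewrite /chi cE (linZ _ _ (lin_hcoord i)).
  by rewrite /GRing.scale /= mulfK.
have hchi : lin chi.
  move=> c u v; rewrite /chi mulrDl -scalerAl lin_hcoord /GRing.scale /=.
  by rewrite mulrDl mulrA.
have chiM a b : chi (a * b) = chi a * chi b :> k.
  rewrite [LHS]/chi -mulrA [b * f]chiE -scalerAr [a * f]chiE scalerA.
  by rewrite (linZ _ _ (lin_hcoord i)) /GRing.scale /= mulfK // mulrC.
have chif : chi f = 1 :> k by rewrite /chi ff divff.
have chi1 : chi 1 = 1 :> k by rewrite /chi mul1r divff.
apply: ns; apply: (maschke (L := ract chi f)) => [y|]; last first.
  by rewrite (counit_ract hchi) chif oner_neq0.
have [y' <-] := lin_inj_surj (lin_ract chi) (ract_inj hchi chiM chi1) y.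
rewrite -(ractM hchi chiM) chiE (linZ _ _ (lin_ract chi)).
by rewrite (counit_ract hchi).
Qed.

Lemma nonsemisimple_trace a : trl (fun h : H => S (S h) * a) = 0.
Proof.
have [l [L lL]] := exists_frobenius_pair H.
rewrite (trl_antipode2 lL) (nonsemisimple_integral ns (frobenius_integral lL)).
exact: mul0r.
Qed.

(** This excludes n = 0, where the truncated predecessor would make p^n and p^(n-1) both equal to
    1. *)
Lemma nonsemisimple_dim_gt1 : (1 < \dim {:H})%N.
Proof.
rewrite ltn_neqAle adim_gt0 andbT; apply/eqP => d1.
apply: (no_projective_line (f := 1)); rewrite ?mulr1 //.
  by apply/eqP; apply: oner_neq0.
move=> h; have : h \in <[1]>%VS.
  have -> : <[1]>%VS = fullv :> {vspace H}.
    by apply/eqP; rewrite eqEdim subvf -d1 dim_vline oner_neq0.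
  exact: memvf.
by case/vlineP => c ->; exists c; rewrite mulr1.
Qed.

End Nonsemisimple.

(** * The square of the antipode *)

Section Square.
Variables (k : closedFieldType) (H : hopfAlgType k) (x : H).
Hypothesis px : primitive_element x.
Local Notation S := (@antipode k H).
Local Notation eps := (@counit k H).

Lemma antipode_primitive : S x = - x.
Proof.
have ex : eps x = 0 :> k.
  have := sw_counitl x (f := fun h : H => h) (lin_id (U := H)).
  rewrite (sw_primitive px); last by lintac.
  rewrite counit1 scale1r => /eqP; rewrite -subr_eq0 addrK scaler_eq0 oner_eq0 orbF.
  by move/eqP.
have := sw_antil x (f := fun h : H => h) (lin_id (U := H)).
rewrite (sw_primitive px); last by lintac.
rewrite ex scale0r antipode1 mulr1 mul1r => /eqP.
by rewrite addr_eq0 => /eqP.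
Qed.

Lemma antipode2_primitive : S (S x) = x.
Proof. by rewrite antipode_primitive linearN antipode_primitive opprK. Qed.

Lemma antipode2M (a b : H) : S (S (a * b)) = S (S a) * S (S b).
Proof. by rewrite !antipodeM. Qed.

Lemma antipode2_1 : S (S 1) = 1.
Proof. by rewrite !antipode1. Qed.

Lemma antipode2_horner Q : S (S (horner_alg x Q)) = horner_alg x Q.
Proof.
elim/poly_ind: Q => [|Q c IH]; first by rewrite rmorph0 !linear0.
rewrite rmorphD rmorphM /= horner_algX horner_algC !linearD /= antipode2M IH.
by rewrite antipode2_primitive !linearZ /= antipode2_1.
Qed.

Lemma lin_antipode2 : lin (fun h : H => S (S h)).
Proof. by lintac. Qed.

Lemma iter_antipode2 q (h : H) : iter q (fun h => S (S h)) h = iter (q * 2) S h.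
Proof. by elim: q => //= q ->. Qed.

End Square.

Section Order.
Variables (k : closedFieldType) (p n : nat) (H : hopfAlgType k).
Hypotheses (pk : p \in [pchar k]) (p2 : (2 < p)%N) (dimH : \dim {:H} = (p ^ n)%N)
  (ns : ~ semisimple_algebra H).
Local Notation S := (@antipode k H).

(** The factor e in [F] forces the values into He and changes nothing on He, because S^2 fixes e.
    The vanishing trace on H is thus the trace of S^2 on He, and e is a fixed vector. *)
Lemma iter_antipode2_principal (e : H) : e * e = e -> e <> 0 -> S (S e) = e ->
    \dim (principal_left_ideal e) = p ->
  forall h, h * e = h -> iter p (fun h => S (S h)) h = h.
Proof.
move=> ee e0 Se dime h he.
pose F (h : H) := S (S h) * e; have hF : lin F by rewrite /F; lintac.
have FU u : F u \in principal_left_ideal e by rewrite mem_principal // -mulrA ee.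
have FU' u : u \in principal_left_ideal e -> F u \in principal_left_ideal e by [].
have FE q u : u * e = u -> iter q F u = iter q (fun h => S (S h)) u.
  move=> ue; elim: q => //= q IH; rewrite IH /F -{1}Se -antipode2M; congr (S (S _)).
  elim: q {IH} => //= q IH.
  by rewrite -{1}Se -antipode2M IH.
have hU : h \in principal_left_ideal e by rewrite mem_principal // he.
have eU : e \in principal_left_ideal e by rewrite mem_principal // ee.
have [a Sa] := antipode4_pchar pk dimH.
have tr0 : trl (vrestrict (U := principal_left_ideal e) F) = 0.
  by rewrite trl_vrestrict //; apply: nonsemisimple_trace.
have Fq (u : subvs_of (principal_left_ideal e)) : iter (p ^ a * 2) (vrestrict F) u = u.
  apply: val_inj; rewrite /= iter_vrestrictE // FE; last first.
    by apply/eqP; rewrite -mem_principal // subvsP.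
  by rewrite iter_antipode2 -mulnA Sa.
have F1 : exists2 u : subvs_of (principal_left_ideal e), u <> 0 & vrestrict F u = u.
  exists (Subvs eU); first by move/(congr1 vsval).
  by apply: val_inj; rewrite /= vrestrictE //= /F Se ee.
have := trl0_unipotent (lin_vrestrict hF) pk p2 dime tr0 Fq F1 (Subvs hU).
by move/(congr1 vsval); rewrite iter_vrestrictE //= FE.
Qed.

End Order.

(** * Projectivity and indecomposability of the module generated by an idempotent *)

Section Modules.
Variables (k : fieldType) (A : falgType k) (e : A).
Hypothesis ee : e * e = e.
Local Notation M := (principal_left_module e).

Let eM_subproof : (e : A^o) \in principal_left_ideal_pred e.
Proof. by apply: (introT (principal_left_idealP e e)); exists e; rewrite ee. Qed.

Let eM : M := PrincipalLeftModule eM_subproof.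

Let plm_valr (m : M) : (plm_val m : A) * e = plm_val m.
Proof.
by case: m => a /= /(elimT (principal_left_idealP e a)) [b ->]; rewrite -mulrA ee.
Qed.

Let plmE (m : M) : m = (plm_val m : A) *: eM.
Proof. by apply: val_inj => /=; rewrite -[LHS]plm_valr. Qed.

(** As m = m e, a map out of Ae is determined by the image of e; any preimage x0 of that image gives
    the lift m |-> m x0. *)
Lemma principal_projective : projective_module M.
Proof.
move=> X Y g f gsurj; have [x0 gx0] := gsurj (f eM).
have hl : linear (fun m : M => (plm_val m : A) *: x0).
  move=> a u v.
  have -> : plm_val (a *: u + v) = a * plm_val u + plm_val v :> A by [].
  by rewrite scalerDl scalerA.
pose hL := GRing.isLinear.Build _ _ _ _ (fun m : M => (plm_val m : A) *: x0) hl.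
pose h : {linear M -> X} := HB.pack (fun m : M => (plm_val m : A) *: x0) hL.
exists h => m; rewrite [h m]/=.
by rewrite linearZ /= gx0 -linearZ /= -plmE.
Qed.

(** The components of e in the two submodules are orthogonal idempotents of eAe and act as right
    units on their submodules; one of them is 0. *)
Lemma principal_indecomposable : e <> 0 ->
  (forall q, q * q = q -> e * q = q -> q * e = q -> q = 0 \/ q = e) ->
  indecomposable_module M.
Proof.
move=> e0 prim; split; first by exists eM => /(congr1 (@plm_val _ _ _)).
move=> N P NP N0P.
have [n [q [nN qP eE]]] := NP eM.
pose vn : A := plm_val n; pose vq : A := plm_val q.
have eE' : e = vn + vq by have := congr1 (@plm_val _ _ _) eE.
have act (m : M) : m = (plm_val m : A) *: n + (plm_val m : A) *: q.
  by rewrite {1}(plmE m) eE scalerDr.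
have dec (m : M) : m \in N -> (plm_val m : A) *: q = 0.
  move=> mN; apply: N0P; last by rewrite rpredZ.
  have -> : (plm_val m : A) *: q = m - (plm_val m : A) *: n.
    by rewrite {2}(act m) addrC addKr.
  by rewrite -scaleN1r rpredD ?rpredZ.
have dec' (m : M) : m \in P -> (plm_val m : A) *: n = 0.
  move=> mP; apply: N0P; first by rewrite rpredZ.
  have -> : (plm_val m : A) *: n = m - (plm_val m : A) *: q.
    by rewrite {2}(act m) addrK.
  by rewrite -scaleN1r rpredD ?rpredZ.
have nq : vn * vq = 0 by have := congr1 (@plm_val _ _ _) (dec n nN).
have qn : vq * vn = 0 by have := congr1 (@plm_val _ _ _) (dec' q qP).
have ne : vn * e = vn by apply: plm_valr.
have nn : vn * vn = vn by rewrite -[RHS]ne eE' mulrDr nq addr0.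
have en : e * vn = vn by rewrite eE' mulrDl qn addr0.
have [n0|nE] := prim vn nn en ne.
  have n0' : n = 0 by apply: val_inj.
  by left => m mN; rewrite (act m) n0' scaler0 add0r dec.
have q0 : q = 0.
  apply: val_inj; apply: (addrI vn); rewrite addr0 -[LHS]eE' nE //.
by right => m mP; rewrite (act m) q0 scaler0 addr0 dec'.
Qed.

End Modules.

(** * Central grouplikes *)

Section TensorPowers.
Variables (k : fieldType).

Lemma tens_eq0 (U V : vectType k) (u : U) (v : V) : tens u v = 0 -> u = 0 \/ v = 0.
Proof.
move=> uv0; have [->|u0] := eqVneq u 0; [by left | right].
have [i ui] : exists i, basis_coord i u != 0.
  apply/existsP; apply: contraNT u0 => /existsPn z; apply/eqP/basis_coord_inj => i.
  by rewrite (lin0 (lin_basis_coord i)); apply/eqP; move: (z i); rewrite negbK.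
apply: basis_coord_inj => j; rewrite (lin0 (lin_basis_coord j)).
have := congr1 (fun m : 'M[k]_(_, _) => m i j) uv0.
rewrite /tens !mxE big_ord1 mxE => /eqP.
by rewrite mulf_eq0 (negPf ui) => /eqP.
Qed.

Lemma tens_exp (A B : falgType k) (a : A) (b : B) q :
  (tens a b : tensor A B) ^+ q = tens (a ^+ q) (b ^+ q).
Proof.
elim: q => [|q IH]; first by rewrite !expr0.
by rewrite !exprS IH [LHS]tmul_tens.
Qed.

Lemma binomial_unit p N i : p \in [pchar k] -> (N < p)%N -> (i <= N)%N ->
  'C(N, i)%:R != 0 :> k.
Proof.
move=> pk Np iN; have pp := pcharf_prime pk.
rewrite -(dvdn_pcharf pk); apply/negP => pC.
have : (p %| N`!)%N by rewrite -(bin_fact iN) dvdn_mulr.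
elim: N Np {iN pC} => [|N IH] Np; first by rewrite dvdn1 gtn_eqF ?prime_gt1.
rewrite factS Euclid_dvdM // => /orP[|/IH]; first by rewrite gtnNdvd.
by apply; apply: ltnW.
Qed.

End TensorPowers.

Section Central.
Variables (k : closedFieldType) (p : nat) (H : hopfAlgType k) (x g : H) (rs : seq k).
Hypotheses (pk : p \in [pchar k])
  (px : primitive_element x) (urs : uniq rs)
  (x0 : horner_alg x (\prod_(r <- rs) ('X - r%:P)) = 0)
  (gg : grouplike g) (gx : g * x = x * g).
Local Notation S := (@antipode k H).
Local Notation e := (weight_idem x rs).
Local Notation W := (weight_set x rs).
Hypotheses (Wsub : forall u v, u \in W -> v \in W -> u - v \in W)
  (dimHe : forall v, v \in W -> \dim (principal_left_ideal (e v)) = p).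
Variable a : nat.
Hypothesis ga : g ^+ (p ^ a) = 1.

Local Notation y := (g - 1).

Let yg : y * g = g * y. Proof. by rewrite mulrBl mulrBr mul1r mulr1. Qed.

Let g_horner Q : g * horner_alg x Q = horner_alg x Q * g.
Proof.
elim/poly_ind: Q => [|Q c IH]; first by rewrite rmorph0 mulr0 mul0r.
rewrite rmorphD rmorphM /= horner_algX horner_algC mulrDr mulrDl mulrA IH.
by rewrite -!mulrA gx -scalerAr -scalerAl mulr1 mul1r.
Qed.

Lemma grouplike_sub1_nilpotent : y ^+ (p ^ a) = 0.
Proof.
have -> : y = horner_alg g ('X - 1%:P) by rewrite rmorphB /= horner_algX rmorph1.
rewrite -rmorphXn (exp_XsubC_pchar pk) expr1n rmorphB /= rmorphXn /= horner_algX.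
by rewrite ga rmorph1 subrr.
Qed.

(** x (x) 1 + 1 (x) x acts on e u (x) e w as u + w. In particular comul (e v) fixes e u (x) e w when
    v = u + w. *)
Lemma comul_horner u w Q : u \in rs -> w \in rs ->
  comul (horner_alg x Q) * tens (e u) (e w) = Q.[u + w] *: tens (e u) (e w).
Proof.
move=> urs' wrs; set t : tensor H H := tens (e u) (e w).
have xt : comul x * t = (u + w) *: t.
  rewrite px [LHS]mulrDl ![tens _ _ * t]tmul_tens !mul1r !mulx_weight_idem //.
  rewrite (linZ _ _ (f := fun t => tens t _)); last by lintac.
  rewrite (linZ _ _ (f := tens _)); last by lintac.
  by rewrite -scalerDl.
elim/poly_ind: Q => [|Q c IH].
  by rewrite rmorph0 linear0 mul0r horner0 scale0r.
transitivity (comul (horner_alg x Q) * (comul x * t) + c *: t).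
  rewrite rmorphD rmorphM /= horner_algX horner_algC linearD /= rmorphM /= linearZ /=.
  rewrite rmorph1 [RHS]addrC -[c *: t]mul1r -scalerAr scalerAl mulrA addrC.
  exact: mulrDl.
by rewrite xt -scalerAr IH scalerA -scalerDl !hornerE mulrC.
Qed.

Lemma comul_sub1 : comul y = tens y g + tens 1 y.
Proof.
rewrite linearB /= (proj1 gg) rmorph1 -[1 in LHS]/(tens 1 1 : tensor H H).
have E (u v w : H) : tens (u - v) w = tens u w - tens v w.
  by rewrite (linB _ _ (f := fun t => tens t w)) //; lintac.
have E' (u v w : H) : tens w (u - v) = tens w u - tens w v.
  by rewrite (linB _ _ (f := tens w)) //; lintac.
by rewrite E E' addrA subrK.
Qed.

Lemma comul_sub1_exp N : comul (y ^+ N) =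
  \sum_(i < N.+1) (tens (y ^+ i) (y ^+ (N - i) * g ^+ i)) *+ 'C(N, i).
Proof.
rewrite rmorphXn /= comul_sub1 addrC exprDn_comm; last first.
  rewrite /GRing.comm [LHS]tmul_tens [RHS]tmul_tens mul1r mulr1.
  by rewrite yg.
apply: eq_bigr => i _; rewrite !tens_exp expr1n; congr (_ *+ _).
by rewrite [LHS]tmul_tens mul1r.
Qed.

(* Multiplying comul (y^N e_v) (e_u (x) e_w) by y^(m-i) (x) 1 isolates, by
   induction on i, the term y^m e_u (x) y^(N-i) g^i e_w. *)
Lemma nilpotency_shift u v w N m i : u \in W -> w \in W -> v \in W -> u + w = v ->
    (N < p)%N -> y ^+ N * e v = 0 -> y ^+ m.+1 * e u = 0 -> y ^+ m * e u <> 0 ->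
  (i <= m)%N -> (i <= N)%N -> y ^+ (N - i) * e w = 0.
Proof.
move=> uW wW vW uwv Np yv yu0 yu; have [urs' _] := weight_idemP uW.
have [wrs _] := weight_idemP wW; have [vrs _] := weight_idemP vW.
have [n] := ubnP i; elim: n i => // n IH i /ltnSE ni im iN.
have gy q : g ^+ q * y = y * g ^+ q by apply/esym/commrX; rewrite /GRing.comm yg.
have z : (tens (y ^+ (m - i)) 1 : tensor H H) *
    (comul (y ^+ N * e v) * tens (e u) (e w)) = 0.
  by rewrite yv linear0 mul0r mulr0.
move: z; rewrite rmorphM /= -mulrA comul_horner // uwv lagrange_polyE // eqxx.
rewrite scale1r comul_sub1_exp mulr_suml mulr_sumr.
have term (r : 'I_N.+1) : (tens (y ^+ (m - i)) 1 : tensor H H) *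
    ((tens (y ^+ r) (y ^+ (N - r) * g ^+ r)) *+ 'C(N, r) * tens (e u) (e w)) =
    tens (y ^+ (m - i + r) * e u) (g ^+ r * (y ^+ (N - r) * e w)) *+ 'C(N, r).
  rewrite mulrnAl mulrnAr; congr (_ *+ _); rewrite [_ * tens (e u) _]tmul_tens.
  rewrite [LHS]tmul_tens mul1r mulrA -exprD; congr tens.
  by rewrite [RHS]mulrA; congr (_ * _); apply: esym; apply: commrX (gy r).
rewrite (eq_bigr _ (fun r _ => term r)).
have iN1 : (i < N.+1)%N by [].
rewrite (bigD1 (Ordinal iN1)) //= big1 => [|r ri]; last first.
  (* The terms with r < i vanish by induction, those with r > i because the exponent in the first
     leg exceeds m. *)
  case: (ltngtP (r : nat) i) => [lt|gt|eq].
  - have z : y ^+ (N - r) * e w = 0.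
      by apply: IH; [exact: leq_trans lt ni | exact: leq_trans (ltnW lt) im
        | exact: leq_trans (ltnW lt) iN].
    by rewrite z mulr0 tens0r mul0rn.
  - have -> : (m - i + r = (r - i.+1) + m.+1)%N.
      by rewrite addnBAC // addnS -addSn subnSK // [RHS]addnC addnBA // ltnW.
    by rewrite exprD -mulrA yu0 mulr0 tens0l mul0rn.
  - by case/eqP: ri; apply: val_inj.
rewrite addr0 subnK // -scaler_nat => /eqP.
rewrite scaler_eq0 (negPf (binomial_unit pk Np iN)) /= => /eqP /tens_eq0[//|z].
have gq : S (g ^+ i) * g ^+ i = 1 by apply: grouplike_mulVr (grouplikeX _ gg).
by rewrite -[LHS]mul1r -[X in X * _ = _]gq -mulrA z mulr0.
Qed.

Lemma nilpotency_index u : u \in W ->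
  exists m, y ^+ m * e u <> 0 /\ y ^+ m.+1 * e u = 0.
Proof.
move=> uW; have [_ eu0] := weight_idemP uW.
have ex : exists N, y ^+ N * e u == 0.
  by exists (p ^ a)%N; rewrite grouplike_sub1_nilpotent mul0r.
case: (ex_minnP ex) => -[|m] /eqP z min.
  by case: eu0; rewrite -[LHS]mul1r.
exists m; split=> // /eqP /min; by rewrite ltnn.
Qed.

(** A short nilpotency at one weight spreads to all: the decomposition v = v + 0 gives y e 0 = 0,
    and then 0 = u + (-u) gives y e u = 0 for every weight u. *)
Lemma short_nilpotency v N : v \in W -> (N < p)%N -> y ^+ N * e v = 0 -> g = 1.
Proof.
move=> vW Np yv; have [m [ym ym1]] := nilpotency_index vW.
have W0 : 0 \in W by rewrite -(subrr v) Wsub.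
have mN : (m < N)%N.
  rewrite ltnNge; apply/negP => Nm; apply: ym.
  by rewrite -(subnK Nm) exprD -mulrA yv mulr0.
(* The shift with N = m + 1 and i = m, so that N - i = 1. *)
have y0 : y ^+ 1 * e 0 = 0.
  rewrite -(subSnn m); apply: (nilpotency_shift (u := v) (v := v) (m := m)) => //.
  - exact: addr0.
  - exact: leq_ltn_trans mN Np.
apply/eqP; rewrite -subr_eq0; apply/eqP; rewrite -[LHS]mulr1.
rewrite -[X in _ * X = _](sum_weight_idem urs x0) mulr_sumr big_seq big1 // => u uW.
have [l [yl yl1]] := nilpotency_index uW.
have wW : - u \in W by have := Wsub W0 uW; rewrite sub0r.
case: l yl yl1 => [_ yl1|l yl yl1]; first by move: yl1; rewrite expr1.
have [_] := weight_idemP wW; case.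
(* The shift with N = i = 1 would give y^0 e (-u) = 0. *)
rewrite -[LHS]mul1r -[X in X * _](expr0 y) -[0%N in LHS](subnn 1).
apply: (nilpotency_shift (u := u) (v := 0) (m := l.+1)) => //.
- exact: subrr.
- exact: prime_gt1 (pcharf_prime pk).
Qed.

(** Up to the last nonvanishing power the vectors y^r e v are independent, and p of them suffice for
    the dimension of He_v. *)
Lemma weight_module_powers v : v \in W -> y ^+ p.-1 * e v <> 0 ->
  principal_left_ideal (e v) = <<[seq (y ^+ r * e v)%R | r <- iota 0 p]>>%VS.
Proof.
move=> vW nz; have [vrs ev0] := weight_idemP vW.
have [m [ym ym1]] := nilpotency_index vW.
have pm : (p.-1 <= m)%N.
  rewrite leqNgt; apply/negP => mp; apply: nz.
  by rewrite -(subnK mp) exprD -mulrA ym1 mulr0.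
set X := [seq _ | r <- _]; have sX : size X = p by rewrite size_map size_iota.
have p0 := prime_gt0 (pcharf_prime pk).
have nthX i : (i < p)%N -> X`_i = y ^+ i * e v.
  by move=> ip; rewrite (nth_map 0%N) ?size_iota // nth_iota.
have fX : free X.
  rewrite -[X]/(tval (in_tuple X)); apply/freeP => c c0 i.
  have [n] := ubnP (i : nat); elim: n i => // n IH i /ltnSE ni.
  have ip : (i < p)%N by rewrite -sX.
  have im : (i <= m)%N by apply: leq_trans pm; rewrite -ltnS prednK.
  have := congr1 (fun h => y ^+ (m - i) * h) c0.
  rewrite mulr0 mulr_sumr (bigD1 i) //= big1 => [|j ji].
    rewrite addr0 nthX // -scalerAr mulrA -exprD subnK // => /eqP.
    by rewrite scaler_eq0 => /orP[/eqP|/eqP/ym].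
  have jp : (j < p)%N by rewrite -sX.
  rewrite nthX // -scalerAr mulrA -exprD.
  case: (ltngtP (j : nat) i) => [lt|gt|eq].
  - by rewrite IH ?scale0r //; apply: leq_trans lt ni.
  - have -> : (m - i + j = (j - i.+1) + m.+1)%N.
      by rewrite addnBAC // addnS -addSn subnSK // [RHS]addnC addnBA // ltnW.
    by rewrite exprD -mulrA ym1 mulr0 scaler0.
  - by case/eqP: ji; apply: val_inj.
apply/esym/eqP; rewrite eqEdim dimHe //; apply/andP; split; last first.
  by move: fX; rewrite /free sX => /eqP ->.
apply/span_subvP => _ /mapP[r _ ->]; rewrite weight_moduleP //.
by rewrite -mulrA weight_idem_mulx // scalerAr.
Qed.

Lemma grouplike_central h : g * h = h * g.
Proof.
have [->|g1] := eqVneq g 1; first by rewrite mul1r mulr1.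
rewrite -[h]mulr1 -(sum_weight_idem urs x0) mulr_sumr mulr_sumr mulr_suml.
rewrite big_seq [RHS]big_seq; apply: eq_bigr => v vW.
have p0 := prime_gt0 (pcharf_prime pk).
have nz : y ^+ p.-1 * e v <> 0.
  move=> z; case/eqP: g1; apply: (short_nilpotency vW _ z).
  by rewrite prednK.
have : h * e v \in principal_left_ideal (e v).
  by apply/principal_left_idealP; exists h.
rewrite weight_module_powers //; set X := [seq _ | r <- _].
suff : (<<X>> <= 'C[g])%VS by move=> /subvP sub /sub /cent1vP ->.
apply/span_subvP => _ /mapP[r _ ->]; apply/cent1vP.
have gy : g * y ^+ r = y ^+ r * g by apply: commrX; rewrite /GRing.comm yg.
by rewrite mulrA gy -!mulrA g_horner.
Qed.

End Central.

Theorem proposition4p6 (k : closedFieldType) (p n : nat)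
    (H : hopfAlgType k) (x : H) :
  p \in [pchar k] -> (2 < p)%N ->
  \dim {:H} = (p ^ n)%N ->
  ~ semisimple_algebra H ->
  primitive_element x -> semisimple_element x ->
  \dim (gen_subalg x) = (p ^ n.-1)%N ->
  [/\ forall h : H, iter (2 * p) antipode h = h,
      forall e : H, primitive_idempotent (gen_subalg x) e ->
        [/\ \dim (principal_left_ideal e) = p,
            indecomposable_module (principal_left_module e) &
            projective_module (principal_left_module e)] &
      unimodular H -> forall h : H, antipode (antipode h) = h].
Proof.
move=> pk p2 dimH ns px ss dimK.
have p0 := prime_gt0 (pcharf_prime pk).
have n0 : (0 < n)%N.
  by case: (n) dimH (nonsemisimple_dim_gt1 ns) => // ->; rewrite ltnn.
have [rs [urs x0]] := semisimple_element_roots ss.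
set e := weight_idem x rs; set W := weight_set x rs.
have [M [dimM sM Wsub]] := primitive_weights px urs x0.
(* There are dim k[x] = p^(n-1) weights of equal multiplicity in a space of dimension p^n. *)
have dime v : v \in W -> \dim (principal_left_ideal (e v)) = p.
  move=> vW; rewrite dimM //; move: sM.
  rewrite dimH -(dim_gen_subalg urs x0) dimK -{2}(prednK n0) expnSr.
  by move/eqP; rewrite eqn_pmul2l ?expn_gt0 ?p0 // => /eqP.
have ee v : v \in W -> e v * e v = e v.
  by case/weight_idemP => vrs _; rewrite weight_idem_mul // eqxx.
have Se v : antipode (antipode (e v)) = e v by apply: antipode2_horner.
have sgp v : v \in W -> forall h, h * e v = h ->
    iter p (fun h : H => antipode (antipode h)) h = h.
  move=> vW; have [_ ev0] := weight_idemP vW.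
  exact: (iter_antipode2_principal pk p2 dimH ns (ee v vW) ev0 (Se v) (dime v vW)).
(* H is the sum of the He_v, because 1 is the sum of the e v. *)
have S2p h : iter p (fun h : H => antipode (antipode h)) h = h.
  have hl := lin_iter p (@lin_antipode2 k H).
  rewrite -[h]mulr1 -(sum_weight_idem urs x0) mulr_sumr (lin_bigsum _ _ _ hl).
  by apply: eq_big_seq => v vW; apply: (sgp v vW); rewrite -mulrA ee.
split=> [h|f /(primitive_idempotent_weight urs x0)[v vW ->]|uni h].
- by rewrite mulnC -iter_antipode2.
- have [_ ev0] := weight_idemP vW; split; first exact: dime.
    apply: (principal_indecomposable (ee v vW) ev0).
    apply: (no_idempotent (sg := fun h : H => antipode (antipode h)) pk (@lin_antipode2 k H)
      (@antipode2M k H) (@antipode2_1 k H) (nonsemisimple_trace ns) (ee v vW) ev0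
      (Se v) (dime v vW) (sgp v vW)).
    exact: no_projective_line ns.
  exact: principal_projective (ee v vW).
have [g [gg S4 [a ga]]] := antipode4_unimodular pk dimH uni.
(* S^2 fixes the primitive x, and S^4 is conjugation by g. *)
have gx : g * x = x * g.
  have := S4 x; rewrite !(antipode2_primitive px) => xE.
  by rewrite {2}xE -mulrA grouplike_mulVr // mulr1.
have cen := grouplike_central pk px urs x0 gg gx Wsub dime ga.
have S4id (z : H) : antipode (antipode (antipode (antipode z))) = z.
  by rewrite [LHS]S4 cen -mulrA grouplike_mulrV // mulr1.
have podd : odd p.
  case: (even_prime (pcharf_prime pk)) => // p_2; by rewrite p_2 in p2.
have pE : p = (p./2).*2.+1 by have := odd_double_half p; rewrite podd add1n.
have := S2p h; rewrite pE; elim: (p./2) => [//|q IH]; rewrite doubleS => E.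
by apply: IH; rewrite -[RHS]E !iterS S4id.
Qed.
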